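(* Let $\mathcal{E}$ be a Euclidean space, $f:\mathcal{E}\to\mathbb{R}$ be $C^3$, $\mathcal{M}$ be an embedded Riemannian submanifold of $\mathcal{E}$ with $\dim(\mathcal{M})=d$, and $1\le k<d$. Let $\mathbf{x}^\star\in\mathcal{M}$ be an index-$k$ constrained saddle point of $f$ on $\mathcal{M}$ such that $\mathrm{Hess}_{\mathcal{M}}f(\mathbf{x}^\star)$ is nondegenerate with eigenvalues $\lambda_1^\star\le\cdots\le\lambda_k^\star<0<\lambda_{k+1}^\star\le\cdots\le\lambda_d^\star$, and let $P^\star$ be the orthogonal projector onto the lowest $k$-dimensional invariant subspace of $\mathrm{Hess}_{\mathcal{M}}f(\mathbf{x}^\star)$. Put $\mathbf{w}^\star:=(\mathbf{x}^\star,P^\star)\in\mathrm{Gr}_k(\mathrm{T}\mathcal{M})$, and let $\{\mathbf{w}^{(t)}=(\mathbf{x}^{(t)},P^{(t)})\}_{t\ge0}$ be generated by the discretized constrained saddle dynamic $$\mathbf{w}^{(t+1)}:=\mathrm{R}^{\mathrm{Gr}_k(\mathrm{T}\mathcal{M})}_{\mathbf{w}^{(t)}}\big(\eta\,\mathbf{h}(\mathbf{w}^{(t)})\big),\qquad t=0,1,2,\dots$$ With the quantities $q_1(\eta),q_2(\eta),M,c_1,r_1,r_2,c_3,r_3,A(\eta),\tilde{\mathbf{w}}(D)$ defined in the context, assume the following. (1) (Step size) $$0<\eta<\min\left\{\frac{2}{\lambda_d^\star-\lambda_1^\star},\ \frac{q_1(\eta)+q_2(\eta)}{M},\ \frac{\min\{(r_1-r_2)/c_1,\,r_1\}}{\sup_{\|D\|_{\mathbf{w}^\star}\le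 r_1}\|\mathbf{h}(\tilde{\mathbf{w}}(D))\|_{\tilde{\mathbf{w}}(D)}}\right\}.$$ (2) (Initial point) $$\mathrm{dist}_{\mathrm{Gr}_k(\mathrm{T}\mathcal{M})}(\mathbf{w}^\star,\mathbf{w}^{(0)})<\frac{r_3}{\max\left\{\max\left\{\frac{\mu_1(\eta)^2}{\mu_1(\eta)-\mu_2(\eta)},1\right\}\|A(\eta)\|,\,1\right\}},$$ where $c_3$ and $r_3$ are chosen such that $$c_3r_3<\frac{(1-q_{\max}(\eta))^2}{\eta M+2(1-q_{\max}(\eta))},\qquad q_{\max}(\eta):=\max\{q_1(\eta),q_2(\eta)\},$$ and $$\mu_{1}(\eta):=\tfrac12\Big(q_1(\eta)+q_2(\eta)+2c_3r_3+\sqrt{(q_1(\eta)-q_2(\eta))^2+4c_3r_3(\eta M+c_3r_3)}\Big),$$ $$\mu_{2}(\eta):=\tfrac12\Big(q_1(\eta)+q_2(\eta)+2c_3r_3-\sqrt{(q_1(\eta)-q_2(\eta))^2+4c_3r_3(\eta M+c_3r_3)}\Big).$$ Then $\{\mathbf{w}^{(t)}\}$ converges linearly to $\mathbf{w}^\star$.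
   Context: Basic notation. $\mathcal{M}\subset\mathcal{E}$ carries the induced metric; $\mathrm{Proj}_{\mathrm{T}_{\mathbf{x}}\mathcal{M}}$ is the orthogonal projector of $\mathcal{E}$ onto $\mathrm{T}_{\mathbf{x}}\mathcal{M}$; $\mathcal{S}(\mathcal{E})$ is the Euclidean space (trace inner product) of self-adjoint operators on $\mathcal{E}$; $\mathbf{a}\mathbf{b}^\top$ is the operator $\mathbf{u}\mapsto\langle\mathbf{b},\mathbf{u}\rangle\mathbf{a}$; $[A,B]=AB-BA$. Identify $\mathcal{E}$ with $\mathbb{R}^n$ when matrix notation is used. $\mathrm{Hess}_{\mathcal{M}}f(\mathbf{x})$ is regarded as an element of $\mathcal{S}(\mathcal{E})$ by extension by zero on the normal space. An index-$k$ constrained saddle point is a zero of $\mathrm{grad}_{\mathcal{M}}f$ at which $\mathrm{Hess}_{\mathcal{M}}f$ has exactly $k$ negative eigenvalues. Grassmann bundle. $\mathrm{Gr}_k(\mathrm{T}\mathcal{M}):=\{(\mathbf{x},P)\mid\mathbf{x}\in\mathcal{M},\ P\in\mathrm{Gr}_k(\mathrm{T}_{\mathbf{x}}\mathcal{M})\}$, with $k$-dimensional subspaces of $\mathrm{T}_{\mathbf{x}}\mathcal{M}$ identified with orthogonal projectors $P\in\mathcal{S}(\mathcal{E})$ ($P^2=P$, rank $k$, range in $\mathrm{T}_{\mathbf{x}}\mathcal{M}$); it is an embedded submanifold of $\mathcal{E}\times\mathcal{S}(\mathcal{E})$. For $(\boldsymbol\delta,\Delta)\in\mathrm{T}_{(\mathbf{x},P)}\mathrm{Gr}_k(\mathrm{T}\mathcal{M})$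 write $\Delta_{\mathbf{x}}:=\mathrm{Proj}_{\mathrm{T}_{\mathbf{x}}\mathcal{M}}\circ\Delta\circ\mathrm{Proj}_{\mathrm{T}_{\mathbf{x}}\mathcal{M}}$. The Riemannian metric used is the Sasaki-type metric $\langle(\boldsymbol\delta,\Delta),(\tilde{\boldsymbol\delta},\tilde\Delta)\rangle_{(\mathbf{x},P)}:=\langle\boldsymbol\delta,\tilde{\boldsymbol\delta}\rangle+\langle\Delta_{\mathbf{x}},\tilde\Delta_{\mathbf{x}}\rangle$, with norm $\|\cdot\|_{(\mathbf{x},P)}$, exponential map $\mathrm{Exp}$ and Riemannian distance $\mathrm{dist}_{\mathrm{Gr}_k(\mathrm{T}\mathcal{M})}$. Vector field. $\mathrm{II}_{\mathbf{x}}(\mathbf{u},\mathbf{v}):=\mathrm{D}(\mathbf{y}\mapsto\mathrm{Proj}_{\mathrm{T}_{\mathbf{y}}\mathcal{M}})(\mathbf{x})[\mathbf{u}](\mathbf{v})$ for $\mathbf{u},\mathbf{v}\in\mathrm{T}_{\mathbf{x}}\mathcal{M}$; $\widehat{\mathrm{II}}_{\mathbf{x}}(\mathbf{u},Q):=\sum_{\ell=1}^k\mathrm{II}_{\mathbf{x}}(\mathbf{u},\mathbf{u}_\ell)\mathbf{u}_\ell^\top+\sum_{\ell=1}^k\mathbf{u}_\ell\mathrm{II}_{\mathbf{x}}(\mathbf{u},\mathbf{u}_\ell)^\top$ for $Q=\sum_{\ell=1}^k\mathbf{u}_\ell\mathbf{u}_\ell^\top$ with $\mathbf{u}_\ell$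 orthonormal in $\mathrm{T}_{\mathbf{x}}\mathcal{M}$; $R_{\mathbf{w}}(\mathbf{u}):=\mathbf{u}-2P\mathbf{u}$. For $\mathbf{w}=(\mathbf{x},P)$, $\mathbf{h}=(h_1,h_2)$ with $h_1(\mathbf{w}):=-R_{\mathbf{w}}(\mathrm{grad}_{\mathcal{M}}f(\mathbf{x}))$, $h_2(\mathbf{w}):=-[P,[P,\mathrm{Hess}_{\mathcal{M}}f(\mathbf{x})]]+\widehat{\mathrm{II}}_{\mathbf{x}}(h_1(\mathbf{w}),P)$; this is a tangent vector field on $\mathrm{Gr}_k(\mathrm{T}\mathcal{M})$. Retraction. $\mathrm{R}^{\mathrm{Gr}_k(\mathrm{T}\mathcal{M})}$ is a retraction on $\mathrm{Gr}_k(\mathrm{T}\mathcal{M})$ (smooth, defined near the zero section, $\mathrm{R}_{\mathbf{w}}(0)=\mathbf{w}$, $\mathrm{D}\mathrm{R}_{\mathbf{w}}(0)=\mathrm{Id}$) of the form $\mathrm{R}_{(\mathbf{x},P)}(\boldsymbol\delta,\Delta)=(\mathrm{R}^{\mathcal{M}}_{\mathbf{x}}(\boldsymbol\delta),\tilde V\tilde V^\top)$, $\tilde V=Y(Y^\top Y)^{-1/2}$, $Y=\mathrm{VT}^{\mathcal{M}}_{(\mathbf{x},\boldsymbol\delta)}(Z)$ (columnwise), $Z=\widehat{\mathrm{R}}_{P,V}(\Delta_{\mathbf{x}})$, where $V$ has orthonormal columns in $\mathrm{T}_{\mathbf{x}}\mathcal{M}$ with $P=VV^\top$; $\mathrm{R}^{\mathcal{M}}$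 is a retraction on $\mathcal{M}$; $\mathrm{VT}^{\mathcal{M}}$ is a vector transport associated with $\mathrm{R}^{\mathcal{M}}$ with $\mathrm{VT}_{(\mathbf{x},\boldsymbol\delta)}$ injective for small $\boldsymbol\delta$ and $\mathrm{D}(\iota\mapsto\mathrm{VT}_{(\mathbf{x},\iota)})(0)[\boldsymbol\delta](\mathbf{v})=\mathrm{II}_{\mathbf{x}}(\boldsymbol\delta,\mathbf{v})$; and $\widehat{\mathrm{R}}_{P,V}:\mathrm{T}_P\mathrm{Gr}_k(\mathrm{T}_{\mathbf{x}}\mathcal{M})\to\mathbb{R}^{n\times k}$ is smooth with $\widehat{\mathrm{R}}_{P,V}(0)=V$ and, for small $\Delta$, range of $\widehat{\mathrm{R}}_{P,V}(\Delta)$ in $\mathrm{T}_{\mathbf{x}}\mathcal{M}$, rank $k$, $\widehat{\mathrm{R}}_{P,VQ}(\Delta)=\widehat{\mathrm{R}}_{P,V}(\Delta)Q$ for orthogonal $Q$, and $\mathrm{D}\widehat{\mathrm{R}}_{P,V}(0)[\Delta]V^\top+V\,\mathrm{D}\widehat{\mathrm{R}}_{P,V}(0)[\Delta]^\top=\Delta$. The iteration in the claim is run without stopping rule. Constants. (a) $c_1>0,r_1>0$ are such that $\mathrm{Exp}_{\mathbf{w}^\star}$ is a diffeomorphism from $\{D\in\mathrm{T}_{\mathbf{w}^\star}\mathrm{Gr}_k(\mathrm{T}\mathcal{M}):\|D\|_{\mathbf{w}^\star}<r_1\}$ onto its image, and $\mathrm{dist}(\mathbf{w}',\mathrm{R}_{\mathbf{w}'}(\mathbf{u}'))\le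 c_1\|\mathbf{u}'\|_{\mathbf{w}'}$ for all $\mathbf{w}'$ in the image under $\mathrm{Exp}_{\mathbf{w}^\star}$ of the closed ball of radius $r_1$ and all tangent $\mathbf{u}'$ at $\mathbf{w}'$ with $\|\mathbf{u}'\|_{\mathbf{w}'}\le r_1$ (such constants exist). $r_2\in(0,r_1)$ is fixed. $\tilde{\mathbf{w}}(D):=\mathrm{Exp}_{\mathbf{w}^\star}(D)$. (b) $q_1(\eta):=\max\{|1-\eta\min_i|\lambda_i^\star||,\ |1-\eta\max_i|\lambda_i^\star||\}$, $q_2(\eta):=\max\{|1-\eta(\lambda_{k+1}^\star-\lambda_k^\star)|,\ |1-\eta(\lambda_d^\star-\lambda_1^\star)|\}$. (c) $M$ is the operator norm of the linear map $\mathrm{T}_{\mathbf{x}^\star}\mathcal{M}\ni\boldsymbol\delta\mapsto\mathrm{Proj}_{\mathrm{T}_{\mathbf{x}^\star}\mathcal{M}}\circ(\mathbf{m}_3(\mathbf{w}^\star)[\boldsymbol\delta])\circ\mathrm{Proj}_{\mathrm{T}_{\mathbf{x}^\star}\mathcal{M}}$, where, for $\mathbf{w}=(\mathbf{x},P)$, $$\mathbf{m}_3(\mathbf{w})[\boldsymbol\delta]:=-\mathrm{D}(\mathbf{y}\mapsto\mathrm{Op}^{\mathrm{Proj}}_{\mathbf{y},P})(\mathbf{x})[\boldsymbol\delta]\big(\mathrm{Hess}_{\mathcal{M}}f(\mathbf{x})\big)-\mathrm{Op}^{\mathrm{Proj}}_{\mathbf{w}}\big(\mathrm{D}\bar H(\mathbf{x})[\boldsymbol\delta]\big)+\mathrm{D}(\mathbf{y}\mapsto\mathrm{Op}^{\widehat{\mathrm{II}}}_{\mathbf{y}})(\mathbf{x})[\boldsymbol\delta](h_1(\mathbf{w}),P)+\mathrm{Op}^{\widehat{\mathrm{II}}}_{\mathbf{x}}\big(\mathrm{D}(\mathbf{y}\mapsto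 h_1(\mathbf{y},P))(\mathbf{x})[\boldsymbol\delta],P\big).$$ Here $\mathrm{Op}^{\mathrm{Proj}}_{\mathbf{y},Q}(N)=[Q,[Q,N]]$ extends $(\mathbf{x},P)\mapsto\mathrm{Proj}_{\mathrm{T}_P\mathrm{Gr}_k(\mathrm{T}_{\mathbf{x}}\mathcal{M})}$; $\mathrm{Op}^{\widehat{\mathrm{II}}}_{\mathbf{y}}$ (bilinear on $\mathcal{E}\times\mathcal{S}(\mathcal{E})$) and $\bar H$ are extensions of $\mathbf{x}\mapsto\widehat{\mathrm{II}}_{\mathbf{x}}$ and $\mathrm{Hess}_{\mathcal{M}}f$ to a neighborhood in $\mathcal{E}$; and $h_1(\mathbf{y},Q)$ is extended using $\mathbf{u}\mapsto\mathbf{u}-2Q\mathbf{u}$ on $\mathcal{E}$. (d) $F(D):=\mathrm{Exp}_{\mathbf{w}^\star}^{-1}\big(\mathrm{R}_{\tilde{\mathbf{w}}(D)}(\eta\,\mathbf{h}(\tilde{\mathbf{w}}(D)))\big)=:(F_1(D),F_2(D))$ for $\|D\|_{\mathbf{w}^\star}<r_2$. The constants $r_3\in(0,r_2]$, $c_3\ge0$ are such that, entrywise, $$\begin{pmatrix}\|F_1(D)\|\\ \|F_2(D)_{\mathbf{x}^\star}\|\end{pmatrix}\le A(\eta)\begin{pmatrix}\|\boldsymbol\delta\|\\ \|\Delta_{\mathbf{x}^\star}\|\end{pmatrix},\qquad A(\eta):=\begin{pmatrix}q_1(\eta)+c_3r_3&c_3r_3\\ \eta M+c_3r_3&q_2(\eta)+c_3r_3\end{pmatrix},$$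 for all $D=(\boldsymbol\delta,\Delta)$ with $\|D\|_{\mathbf{w}^\star}<r_3$. $\|A(\eta)\|$ is the spectral norm. Conventions: a fraction with zero denominator is read as $+\infty$, and $r_3/(+\infty)=0$. Linear convergence means: there are $C>0$ and $\rho\in(0,1)$ with $\mathrm{dist}_{\mathrm{Gr}_k(\mathrm{T}\mathcal{M})}(\mathbf{w}^\star,\mathbf{w}^{(t)})\le C\rho^t$ for all $t$. *)

(* Defs.v *)
(* MathComp-Analysis development.  The Euclidean space is 'cV[R]_n with the dot
   product, the space of operators is 'M[R]_n with the trace inner product. *)
From HB Require Import structures.
From mathcomp Require Import all_boot all_order all_algebra.
From mathcomp Require Import all_classical all_reals all_analysis.
Set Implicit Arguments.
Unset Strict Implicit.
Unset Printing Implicit Defensive.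
Import Order.TTheory GRing.Theory Num.Theory.
Import numFieldNormedType.Exports.
Local Open Scope classical_set_scope.
Local Open Scope ring_scope.

(** * Euclidean structure *)

(* Dot product of column vectors when n = 1, trace inner product in general.
   The library norm `|_| on matrices is the sup norm and is used only through
   the topology and the derivatives it induces. *)
Definition inner (R : realType) (m n : nat) (A B : 'M[R]_(m, n)) : R :=
  \tr (A^T *m B).

Definition fnorm (R : realType) (m n : nat) (A : 'M[R]_(m, n)) : R :=
  Num.sqrt (inner A A).

Definition spectral_norm (R : realType) (m n : nat) (A : 'M[R]_(m, n)) : R :=
  sup [set fnorm (A *m v) | v in [set v : 'cV[R]_n | fnorm v <= 1]].

Definition basis_vec (R : realType) (m : nat) (i : 'I_m) : 'cV[R]_m :=
  delta_mx i 0.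

Definition is_orthoproj (R : realType) (n : nat) (T : set 'cV[R]_n)
    (P : 'M[R]_n) : Prop :=
  [/\ P^T = P, P *m P = P & forall v : 'cV[R]_n, T v <-> P *m v = v].

Definition sqrtmx (R : realType) (k : nat) (A : 'M[R]_k) : 'M[R]_k :=
  xget 0 [set S : 'M[R]_k | [/\ S^T = S,
    forall v : 'cV[R]_k, 0 <= inner v (S *m v) & S *m S = A]].

Definition commutator (R : realType) (n : nat) (A B : 'M[R]_n) : 'M[R]_n :=
  A *m B - B *m A.

(** * Smoothness *)

(* C^j on an open set of a finite-dimensional space. *)
Fixpoint Ck (R : realType) (V W : normedModType R) (j : nat) (U : set V)
    (f : V -> W) : Prop :=
  match j with
  | 0 => forall x, U x -> {for x, continuous f}
  | j'.+1 => (forall x, U x -> differentiable f x) /\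
             forall v : V, Ck j' U (fun x => 'D_v f x)
  end.

Definition smooth (R : realType) (V W : normedModType R) (U : set V)
    (f : V -> W) : Prop := forall j, Ck j U f.

(* Smoothness on an arbitrary subset, by local smooth extensions. *)
Definition smooth_on (R : realType) (V W : normedModType R) (A : set V)
    (f : V -> W) : Prop :=
  forall a, A a -> exists (U : set V) (g : V -> W),
    [/\ open U, U a, smooth U g & forall x, A x -> U x -> g x = f x].

Definition rel_open (R : realType) (V : normedModType R) (S B : set V) : Prop :=
  exists2 O : set V, open O & B = S `&` O.

(* f is a diffeomorphism from A onto its image, an open subset of S. *)
Definition diffeo_into (R : realType) (V W : normedModType R) (S : set W)
    (A : set V) (f : V -> W) : Prop :=
  [/\ smooth_on A f, rel_open S (f @` A) &
      exists2 g : W -> V, smooth_on (f @` A) g & forall a, A a -> g (f a) = a].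

Definition local_param (R : realType) (V : normedModType R) (m : nat)
    (S : set V) (Om : set 'cV[R]_m) (phi : 'cV[R]_m -> V) : Prop :=
  open Om /\ diffeo_into S Om phi.

Definition submanifold (R : realType) (V : normedModType R) (m : nat)
    (S : set V) : Prop :=
  forall x, S x -> exists (Om : set 'cV[R]_m) (phi : 'cV[R]_m -> V),
    local_param S Om phi /\ (phi @` Om) x.

(* c is a smooth curve on S with c 0 = x and velocity v at 0. *)
Definition curve_through (R : realType) (V : normedModType R) (S : set V)
    (x v : V) (c : R -> V) : Prop :=
  exists J : set R, [/\ open J, J 0, smooth J c, forall t, J t -> S (c t) &
    c 0 = x /\ derive1 c 0 = v].

Definition tangent (R : realType) (V : normedModType R) (S : set V) (x : V) :
    set V :=
  [set v | exists c : R -> V, curve_through S x v c].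

(* Differential at x along the tangent vector u of a map G defined on S. *)
Definition tdiff (R : realType) (V W : normedModType R) (S : set V)
    (G : V -> W) (x u : V) : W :=
  xget 0 [set w | exists2 c : R -> V, curve_through S x u c &
                    is_derive (0 : R) (1 : R) (G \o c) w].

(** * Riemannian notions on a submanifold S with metric met *)

Definition met_norm (R : realType) (V : normedModType R)
    (met : V -> V -> V -> R) (w D : V) : R := Num.sqrt (met w D D).

Definition piecewise_smooth (R : realType) (V : normedModType R) (S : set V)
    (c : R -> V) : Prop :=
  (forall t : R, 0 <= t <= 1 -> S (c t)) /\
  exists (N : nat) (s : nat -> R),
    [/\ s 0%N = 0, s N = 1, forall i, (i < N)%N -> s i < s i.+1 &
      forall i, (i < N)%N -> exists (J : set R) (b : R -> V),
        [/\ open J, (forall t, s i <= t <= s i.+1 -> J t), smooth J b &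
            forall t, s i <= t <= s i.+1 -> b t = c t]].

Definition curve_length (R : realType) (V : normedModType R)
    (met : V -> V -> V -> R) (c : R -> V) : \bar R :=
  (\int[lebesgue_measure]_(t in `[0%R, 1%R])
     (met_norm met (c t) (derive1 c t))%:E)%E.

(* Infinite when no curve joins the two points. *)
Definition riem_dist (R : realType) (V : normedModType R) (S : set V)
    (met : V -> V -> V -> R) (w w' : V) : \bar R :=
  ereal_inf [set curve_length met c | c in
    [set c : R -> V | [/\ piecewise_smooth S c, c 0 = w & c 1 = w']]].

Definition gram (R : realType) (V : normedModType R) (met : V -> V -> V -> R)
    (m : nat) (phi : 'cV[R]_m -> V) (u : 'cV[R]_m) : 'M[R]_m :=
  \matrix_(i, j) met (phi u) ('D_(basis_vec R i) phi u)
                             ('D_(basis_vec R j) phi u).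

Definition christoffel (R : realType) (V : normedModType R)
    (met : V -> V -> V -> R) (m : nat) (phi : 'cV[R]_m -> V) (u : 'cV[R]_m)
    (l i j : 'I_m) : R :=
  2^-1 * \sum_(p < m) invmx (gram met phi u) l p *
    ('D_(basis_vec R i) (fun v => gram met phi v p j) u
     + 'D_(basis_vec R j) (fun v => gram met phi v p i) u
     - 'D_(basis_vec R p) (fun v => gram met phi v i j) u).

Definition geodesic_eq (R : realType) (V : normedModType R)
    (met : V -> V -> V -> R) (m : nat) (phi : 'cV[R]_m -> V)
    (u : R -> 'cV[R]_m) (t : R) : Prop :=
  forall l : 'I_m, derive1n 2 u t l 0 + \sum_(i < m) \sum_(j < m)
    christoffel met phi (u t) l i j * derive1 u t i 0 * derive1 u t j 0 = 0.

(* Geodesic on the open set J: the geodesic equation holds in every local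
   parametrization of S. *)
Definition geodesic (R : realType) (V : normedModType R) (S : set V)
    (met : V -> V -> V -> R) (J : set R) (c : R -> V) : Prop :=
  [/\ open J, smooth J c, forall t, J t -> S (c t) &
    forall (m : nat) (Om : set 'cV[R]_m) (phi : 'cV[R]_m -> V)
           (J' : set R) (u : R -> 'cV[R]_m),
      local_param S Om phi -> open J' -> J' `<=` J -> smooth J' u ->
      (forall t, J' t -> Om (u t) /\ phi (u t) = c t) ->
      forall t, J' t -> geodesic_eq met phi u t].

Definition exp_graph (R : realType) (V : normedModType R) (S : set V)
    (met : V -> V -> V -> R) (w D : V) : set V :=
  [set w' | exists (J : set R) (c : R -> V),
    [/\ geodesic S met J c, `[0, 1] `<=` J, c 0 = w, derive1 c 0 = D & c 1 = w']].

(* The default value w is returned where the exponential map is undefined. *)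
Definition Exp (R : realType) (V : normedModType R) (S : set V)
    (met : V -> V -> V -> R) (w D : V) : V :=
  xget w (exp_graph S met w D).

(* dom is an open neighbourhood of the zero section of the tangent bundle. *)
Definition is_retraction (R : realType) (V : normedModType R) (S : set V)
    (dom : set (V * V)) (r : V -> V -> V) : Prop :=
  [/\ rel_open [set p : V * V | S p.1 /\ tangent S p.1 p.2] dom,
      forall x, S x -> dom (x, 0),
      smooth_on dom (fun p : V * V => r p.1 p.2),
      forall x v, dom (x, v) -> S (r x v) &
      forall x, S x -> r x 0 = x /\
        forall v, tangent S x v -> is_derive (0 : V) v (r x) v].

(** * Geometry and calculus on a submanifold of Euclidean space *)

Definition projT (R : realType) (n : nat) (M : set 'cV[R]_n) (x : 'cV[R]_n) :
    'M[R]_n :=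
  xget 0 [set P | is_orthoproj (tangent M x) P].

Definition rgrad (R : realType) (n : nat) (M : set 'cV[R]_n)
    (f : 'cV[R]_n -> R) (x : 'cV[R]_n) : 'cV[R]_n :=
  xget 0 [set g | tangent M x g /\
                  forall v, tangent M x v -> inner g v = 'D_v f x].

(* The covariant derivative of the gradient, extended by zero on the normal
   space: the j-th column is its value at Proj(e_j). *)
Definition rhess (R : realType) (n : nat) (M : set 'cV[R]_n)
    (f : 'cV[R]_n -> R) (x : 'cV[R]_n) : 'M[R]_n :=
  \matrix_(i, j)
    (projT M x *m tdiff M (rgrad M f) x (projT M x *m basis_vec R j)) i 0.

(* Eigenvalues, with multiplicity and in increasing order, of the restriction
   to a d-dimensional space of an operator H vanishing on its complement. *)
Definition spectrum_on (R : realType) (n d : nat) (H : 'M[R]_n)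
    (lam : d.-tuple R) : Prop :=
  char_poly H = 'X^(n - d) * \prod_(l <- lam) ('X - l%:P) /\ sorted <=%R lam.

Definition index_saddle (R : realType) (n d : nat) (M : set 'cV[R]_n)
    (f : 'cV[R]_n -> R) (k : nat) (x : 'cV[R]_n) : Prop :=
  [/\ M x, rgrad M f x = 0 &
      exists2 lam : d.-tuple R, spectrum_on (rhess M f x) lam &
        count (fun l => l < 0) lam = k].

(* Span of the eigenspaces of the k lowest eigenvalues; eigenspace is about row
   vectors, whence the transposes. *)
Definition lowest_space (R : realType) (n d : nat) (H : 'M[R]_n)
    (lam : d.-tuple R) (k : nat) : set 'cV[R]_n :=
  [set v | (v^T <= \sum_(i < k) eigenspace H^T (nth 0 lam i))%MS].

Definition II (R : realType) (n : nat) (M : set 'cV[R]_n)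
    (x u v : 'cV[R]_n) : 'cV[R]_n :=
  tdiff M (projT M) x u *m v.

(* The orthonormal family is chosen; the result does not depend on it. *)
Definition frame (R : realType) (n k : nat) (Q : 'M[R]_n) : 'M[R]_(n, k) :=
  xget 0 [set V : 'M[R]_(n, k) | V^T *m V = 1%:M /\ Q = V *m V^T].

Definition IIhat (R : realType) (n k : nat) (M : set 'cV[R]_n)
    (x u : 'cV[R]_n) (Q : 'M[R]_n) : 'M[R]_n :=
  let V := frame k Q in
  \sum_(l < k) II M x u (col l V) *m (col l V)^T
  + \sum_(l < k) col l V *m (II M x u (col l V))^T.

(** * The Grassmann bundle *)

Definition grassmann (R : realType) (n k : nat) (T : set 'cV[R]_n) :
    set 'M[R]_n :=
  [set P | [/\ P^T = P, P *m P = P, \rank P = k &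
               forall v : 'cV[R]_n, T (P *m v)]].

Definition grass_bundle (R : realType) (n k : nat) (M : set 'cV[R]_n) :
    set ('cV[R]_n * 'M[R]_n) :=
  [set w | M w.1 /\ grassmann k (tangent M w.1) w.2].

Definition compress (R : realType) (n : nat) (M : set 'cV[R]_n)
    (x : 'cV[R]_n) (Dl : 'M[R]_n) : 'M[R]_n :=
  projT M x *m Dl *m projT M x.

Definition sasaki (R : realType) (n : nat) (M : set 'cV[R]_n)
    (w D D' : 'cV[R]_n * 'M[R]_n) : R :=
  inner D.1 D'.1 + inner (compress M w.1 D.2) (compress M w.1 D'.2).

Definition sasaki_norm (R : realType) (n : nat) (M : set 'cV[R]_n)
    (w D : 'cV[R]_n * 'M[R]_n) : R :=
  met_norm (sasaki M) w D.

Definition gdist (R : realType) (n k : nat) (M : set 'cV[R]_n)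
    (w w' : 'cV[R]_n * 'M[R]_n) : \bar R :=
  riem_dist (grass_bundle k M) (sasaki M) w w'.

Definition gtangent (R : realType) (n k : nat) (M : set 'cV[R]_n)
    (w : 'cV[R]_n * 'M[R]_n) : set ('cV[R]_n * 'M[R]_n) :=
  tangent (grass_bundle k M) w.

Definition gExp_defined (R : realType) (n k : nat) (M : set 'cV[R]_n)
    (w D : 'cV[R]_n * 'M[R]_n) : Prop :=
  exp_graph (grass_bundle k M) (sasaki M) w D !=set0.

Definition gExp (R : realType) (n k : nat) (M : set 'cV[R]_n)
    (w D : 'cV[R]_n * 'M[R]_n) : 'cV[R]_n * 'M[R]_n :=
  Exp (grass_bundle k M) (sasaki M) w D.

(** * The vector field *)

Definition reflection (R : realType) (n : nat) (P : 'M[R]_n) (u : 'cV[R]_n) :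
    'cV[R]_n := u - 2 *: (P *m u).

Definition h1 (R : realType) (n : nat) (M : set 'cV[R]_n)
    (f : 'cV[R]_n -> R) (w : 'cV[R]_n * 'M[R]_n) : 'cV[R]_n :=
  - reflection w.2 (rgrad M f w.1).

Definition h2 (R : realType) (n k : nat) (M : set 'cV[R]_n)
    (f : 'cV[R]_n -> R) (w : 'cV[R]_n * 'M[R]_n) : 'M[R]_n :=
  - commutator w.2 (commutator w.2 (rhess M f w.1))
  + IIhat k M w.1 (h1 M f w) w.2.

Definition hfield (R : realType) (n k : nat) (M : set 'cV[R]_n)
    (f : 'cV[R]_n -> R) (w : 'cV[R]_n * 'M[R]_n) : 'cV[R]_n * 'M[R]_n :=
  (h1 M f w, h2 k M f w).

(** * The retraction on the Grassmann bundle *)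

Definition vector_transport (R : realType) (n : nat) (M : set 'cV[R]_n)
    (dom : set ('cV[R]_n * 'cV[R]_n)) (RM : 'cV[R]_n -> 'cV[R]_n -> 'cV[R]_n)
    (VT : 'cV[R]_n -> 'cV[R]_n -> 'cV[R]_n -> 'cV[R]_n) : Prop :=
  [/\ smooth_on [set p : 'cV[R]_n * 'cV[R]_n * 'cV[R]_n |
                   dom p.1 /\ tangent M p.1.1 p.2]
        (fun p => VT p.1.1 p.1.2 p.2),
      forall x de v, dom (x, de) -> tangent M x v ->
        tangent M (RM x de) (VT x de v),
      forall x v, M x -> tangent M x v -> VT x 0 v = v &
      forall x de (a : R) u v, dom (x, de) -> tangent M x u ->
        tangent M x v -> VT x de (a *: u + v) = a *: VT x de u + VT x de v].

Definition admissible_transport (R : realType) (n : nat) (M : set 'cV[R]_n)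
    (dom : set ('cV[R]_n * 'cV[R]_n)) (RM : 'cV[R]_n -> 'cV[R]_n -> 'cV[R]_n)
    (VT : 'cV[R]_n -> 'cV[R]_n -> 'cV[R]_n -> 'cV[R]_n) : Prop :=
  [/\ vector_transport M dom RM VT,
      forall x, M x -> exists2 e : R, 0 < e &
        forall de, tangent M x de -> fnorm de < e -> dom (x, de) /\
          forall u v, tangent M x u -> tangent M x v ->
            VT x de u = VT x de v -> u = v &
      forall x de v, M x -> tangent M x de -> tangent M x v ->
        is_derive (0 : 'cV[R]_n) de (fun io => VT x io v) (II M x de v)].

(* Rh x P V Dl; the dependence on x is that of the domain, the tangent space at
   P of the Grassmannian of the tangent space at x. *)
Definition admissible_lift (R : realType) (n k : nat) (M : set 'cV[R]_n)
    (Rh : 'cV[R]_n -> 'M[R]_n -> 'M[R]_(n, k) -> 'M[R]_n -> 'M[R]_(n, k)) :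
    Prop :=
  forall (x : 'cV[R]_n) (P : 'M[R]_n) (V : 'M[R]_(n, k)),
    grass_bundle k M (x, P) -> V^T *m V = 1%:M -> P = V *m V^T ->
    let TP := tangent (grassmann k (tangent M x)) P in
    [/\ smooth_on TP (Rh x P V),
        Rh x P V 0 = V,
        exists2 e : R, 0 < e & forall Dl, TP Dl -> fnorm Dl < e ->
          [/\ forall v : 'cV[R]_k, tangent M x (Rh x P V Dl *m v),
              \rank (Rh x P V Dl) = k &
              forall Q : 'M[R]_k, Q^T *m Q = 1%:M ->
                Rh x P (V *m Q) Dl = Rh x P V Dl *m Q] &
        forall Dl, TP Dl -> exists2 B : 'M[R]_(n, k),
          is_derive (0 : 'M[R]_n) Dl (Rh x P V) B &
          B *m V^T + V *m B^T = Dl].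

(* The retraction has the prescribed form, all of whose ingredients are
   well-defined on its domain. *)
Definition lifted_form (R : realType) (n k : nat) (M : set 'cV[R]_n)
    (domM : set ('cV[R]_n * 'cV[R]_n)) (RM : 'cV[R]_n -> 'cV[R]_n -> 'cV[R]_n)
    (VT : 'cV[R]_n -> 'cV[R]_n -> 'cV[R]_n -> 'cV[R]_n)
    (Rh : 'cV[R]_n -> 'M[R]_n -> 'M[R]_(n, k) -> 'M[R]_n -> 'M[R]_(n, k))
    (domG : set (('cV[R]_n * 'M[R]_n) * ('cV[R]_n * 'M[R]_n)))
    (RG : 'cV[R]_n * 'M[R]_n -> 'cV[R]_n * 'M[R]_n -> 'cV[R]_n * 'M[R]_n) :
    Prop :=
  forall w D, domG (w, D) -> domM (w.1, D.1) /\
    forall V : 'M[R]_(n, k), V^T *m V = 1%:M -> w.2 = V *m V^T ->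
    let Z := Rh w.1 w.2 V (compress M w.1 D.2) in
    let Y : 'M[R]_(n, k) := \matrix_(i, l) VT w.1 D.1 (col l Z) i 0 in
    let Vt := Y *m invmx (sqrtmx (Y^T *m Y)) in
    [/\ forall l : 'I_k, tangent M w.1 (col l Z),
        Y^T *m Y \in unitmx &
        RG w D = (RM w.1 D.1, Vt *m Vt^T)].

Definition bundle_retraction (R : realType) (n k : nat) (M : set 'cV[R]_n)
    (domM : set ('cV[R]_n * 'cV[R]_n)) (RM : 'cV[R]_n -> 'cV[R]_n -> 'cV[R]_n)
    (VT : 'cV[R]_n -> 'cV[R]_n -> 'cV[R]_n -> 'cV[R]_n)
    (Rh : 'cV[R]_n -> 'M[R]_n -> 'M[R]_(n, k) -> 'M[R]_n -> 'M[R]_(n, k))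
    (domG : set (('cV[R]_n * 'M[R]_n) * ('cV[R]_n * 'M[R]_n)))
    (RG : 'cV[R]_n * 'M[R]_n -> 'cV[R]_n * 'M[R]_n -> 'cV[R]_n * 'M[R]_n) :
    Prop :=
  [/\ is_retraction M domM RM,
      admissible_transport M domM RM VT,
      admissible_lift M Rh,
      is_retraction (grass_bundle k M) domG RG &
      lifted_form M domM RM VT Rh domG RG].

(** * The constants *)

Definition OpProj (R : realType) (n : nat) (y : 'cV[R]_n) (Q N : 'M[R]_n) :
    'M[R]_n := commutator Q (commutator Q N).

Definition hess_extension (R : realType) (n : nat) (M : set 'cV[R]_n)
    (f : 'cV[R]_n -> R) (U : set 'cV[R]_n) (Hbar : 'cV[R]_n -> 'M[R]_n) :
    Prop :=
  [/\ Ck 1 U Hbar, forall y, U y -> (Hbar y)^T = Hbar y &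
      forall y, U y -> M y -> Hbar y = rhess M f y].

Definition II_extension (R : realType) (n k : nat) (M : set 'cV[R]_n)
    (U : set 'cV[R]_n) (OpII : 'cV[R]_n -> 'cV[R]_n -> 'M[R]_n -> 'M[R]_n) :
    Prop :=
  [/\ forall u Q, Q^T = Q -> Ck 1 U (fun y => OpII y u Q),
      forall y u Q, U y -> Q^T = Q -> (OpII y u Q)^T = OpII y u Q,
      forall y (a : R) u v Q, U y -> Q^T = Q ->
        OpII y (a *: u + v) Q = a *: OpII y u Q + OpII y v Q,
      forall y (a : R) u Q N, U y -> Q^T = Q -> N^T = N ->
        OpII y u (a *: Q + N) = a *: OpII y u Q + OpII y u N &
      forall y u Q, U y -> M y -> tangent M y u ->
        grassmann k (tangent M y) Q -> OpII y u Q = IIhat k M y u Q].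

Definition m3 (R : realType) (n : nat) (M : set 'cV[R]_n)
    (f : 'cV[R]_n -> R) (Hbar : 'cV[R]_n -> 'M[R]_n)
    (OpII : 'cV[R]_n -> 'cV[R]_n -> 'M[R]_n -> 'M[R]_n)
    (w : 'cV[R]_n * 'M[R]_n) (de : 'cV[R]_n) : 'M[R]_n :=
  - 'D_de (fun y => OpProj y w.2 (rhess M f w.1)) w.1
  - OpProj w.1 w.2 ('D_de Hbar w.1)
  + 'D_de (fun y => OpII y (h1 M f w) w.2) w.1
  + OpII w.1 (tdiff M (fun y => h1 M f (y, w.2)) w.1 de) w.2.

Definition Mconst (R : realType) (n : nat) (M : set 'cV[R]_n)
    (f : 'cV[R]_n -> R) (Hbar : 'cV[R]_n -> 'M[R]_n)
    (OpII : 'cV[R]_n -> 'cV[R]_n -> 'M[R]_n -> 'M[R]_n)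
    (w : 'cV[R]_n * 'M[R]_n) : R :=
  sup [set fnorm (compress M w.1 (m3 M f Hbar OpII w de)) | de in
         [set de | tangent M w.1 de /\ fnorm de <= 1]].

Definition exp_retraction_constants (R : realType) (n k : nat)
    (M : set 'cV[R]_n)
    (domG : set (('cV[R]_n * 'M[R]_n) * ('cV[R]_n * 'M[R]_n)))
    (RG : 'cV[R]_n * 'M[R]_n -> 'cV[R]_n * 'M[R]_n -> 'cV[R]_n * 'M[R]_n)
    (ws : 'cV[R]_n * 'M[R]_n) (c1 r1 : R) : Prop :=
  [/\ 0 < c1, 0 < r1,
      forall D, gtangent k M ws D -> sasaki_norm M ws D <= r1 ->
        gExp_defined k M ws D,
      diffeo_into (grass_bundle k M)
        [set D | gtangent k M ws D /\ sasaki_norm M ws D < r1] (gExp k M ws) &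
      forall D u', gtangent k M ws D -> sasaki_norm M ws D <= r1 ->
        let w' := gExp k M ws D in
        gtangent k M w' u' -> sasaki_norm M w' u' <= r1 ->
        domG (w', u') /\
        (gdist k M w' (RG w' u') <= (c1 * sasaki_norm M w' u')%:E)%E].

Definition q1 (R : realType) (lam : seq R) (eta : R) : R :=
  Num.max `|1 - eta * \big[Num.min/`|nth 0 lam 0|]_(l <- lam) `|l| |
          `|1 - eta * \big[Num.max/`|nth 0 lam 0|]_(l <- lam) `|l| |.

(* lam is indexed from 0. *)
Definition q2 (R : realType) (d k : nat) (lam : d.-tuple R) (eta : R) : R :=
  Num.max `|1 - eta * (nth 0 lam k - nth 0 lam k.-1)|
          `|1 - eta * (nth 0 lam d.-1 - nth 0 lam 0)|.

(* s stands for the product c3 * r3. *)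
Definition Amx (R : realType) (q q' etaM s : R) : 'M[R]_2 :=
  \matrix_(i < 2, j < 2)
    nth 0 (nth [::] [:: [:: q + s; s]; [:: etaM + s; q' + s]] i) j.

Definition mu1 (R : realType) (q q' etaM s : R) : R :=
  2^-1 * (q + q' + 2 * s
          + Num.sqrt ((q - q') ^+ 2 + 4 * s * (etaM + s))).

Definition mu2 (R : realType) (q q' etaM s : R) : R :=
  2^-1 * (q + q' + 2 * s
          - Num.sqrt ((q - q') ^+ 2 + 4 * s * (etaM + s))).

(* Inverse of the exponential map on the open ball of radius r1, applied to one
   step of the iteration started at the exponential of D. *)
Definition Fmap (R : realType) (n k : nat) (M : set 'cV[R]_n)
    (f : 'cV[R]_n -> R)
    (RG : 'cV[R]_n * 'M[R]_n -> 'cV[R]_n * 'M[R]_n -> 'cV[R]_n * 'M[R]_n)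
    (ws : 'cV[R]_n * 'M[R]_n) (r1 eta : R) (D : 'cV[R]_n * 'M[R]_n) :
    'cV[R]_n * 'M[R]_n :=
  let w := gExp k M ws D in
  xget 0 [set D' | [/\ gtangent k M ws D', sasaki_norm M ws D' < r1 &
                       gExp k M ws D' = RG w (eta *: hfield k M f w)]].

Definition col2 (R : realType) (n : nat) (M : set 'cV[R]_n)
    (ws D : 'cV[R]_n * 'M[R]_n) : 'cV[R]_2 :=
  \col_(i < 2) nth 0 [:: fnorm D.1; fnorm (compress M ws.1 D.2)] i.

(* A fraction with zero denominator is +oo, including 0 / 0. *)
Definition efrac (R : realType) (a b : \bar R) : \bar R :=
  (if b == 0 then +oo else a / b)%E.

Definition sup_hfield (R : realType) (n k : nat) (M : set 'cV[R]_n)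
    (f : 'cV[R]_n -> R) (ws : 'cV[R]_n * 'M[R]_n) (r1 : R) : \bar R :=
  ereal_sup [set (sasaki_norm M (gExp k M ws D) (hfield k M f (gExp k M ws D)))%:E |
    D in [set D | gtangent k M ws D /\ sasaki_norm M ws D <= r1]].

Definition converges_linearly (R : realType) (n k : nat) (M : set 'cV[R]_n)
    (ws : 'cV[R]_n * 'M[R]_n) (w : nat -> 'cV[R]_n * 'M[R]_n) : Prop :=
  exists C rho : R, [/\ 0 < C, 0 < rho, rho < 1 &
    forall t, (gdist k M ws (w t) <= (C * rho ^+ t)%:E)%E].

(* Main.v *)
Require Import Defs.
From HB Require Import structures.
From mathcomp Require Import all_boot all_order all_algebra.
From mathcomp Require Import all_classical all_reals all_analysis.
From mathcomp Require Import measurable_realfun ring lra.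
Set Implicit Arguments.
Unset Strict Implicit.
Unset Printing Implicit Defensive.
Import Order.TTheory GRing.Theory Num.Theory.
Import numFieldNormedType.Exports.
Local Open Scope classical_set_scope.
Local Open Scope ring_scope.

(* Write [w t = Exp_{w*}(D t)].  In the coordinates given by the exponential map and
   an orthonormal basis of the tangent space at [w*], the Gauss lemma shows that a
   curve starting at [Exp_{w*}(D)] with length less than [r1 - |D|] stays in the image
   of the ball of radius [r1].  The step-size condition makes one step of the
   iteration shorter than [r1 - r2], so [D (t+1) = Fmap (D t)] is well defined as long
   as [|D t| < r3], and the hypothesis on [Fmap] bounds the pair of norms of
   [D (t+1)] by [A] applied to that of [D t].  By Cayley-Hamilton,
   [A^t = a_t A - mu1 mu2 a_(t-1)] with [a_t = (mu1^t - mu2^t) / (mu1 - mu2)]; since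
   [mu2 >= 0] and [mu1 < 1], the negative term can be dropped, which keeps the iterates
   inside the ball of radius [r3] and makes them decay geometrically.  All this
   requires that the Grassmann bundle is a submanifold, that the Sasaki metric is
   smooth and definite on its tangent spaces, and that [hfield] is tangent to it. *)

(** * Calculus on finite-dimensional spaces *)

(** Neither completeness nor compactness is assumed, and distances are infima of lengths of curves
    free to leave any chart. The retraction is controlled only through the length of one step,
    whereas [Fmap] returns a default unless the new point is again [Exp_{w*}(D')] with [|D'| < r1].
    A length must therefore be turned into a radius, and the Gauss lemma does this. It is read off
    the metric matrix: rays through 0 are geodesics, so the Christoffel symbols contracted twice
    with [x] vanish, and this differential identity determines the metric in the radial direction.
    The constants come from the matrix: [mu1] and [mu2] are its eigenvalues; [eta M <= q1 + q2]
    makes its determinant [q1 q2 + s (q1 + q2 - eta M)] nonnegative, and the bound on [s = c3 r3]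
    makes its characteristic polynomial positive at 1. The factor [max(mu1^2 / (mu1 - mu2), 1)]
    bounds [a_t] for all [t >= 1], the 1 being [a_1]. For [mu1 = mu2] the conventions on fractions
    leave an admissible starting point only if [|A| = 0]. *)

Section Ck_calculus.
Context {R : realType}.
Implicit Types V W Z : normedModType R.

(** Coordinates are continuous functionals, and the family [e] is not asked to be free. They reduce
    vector-valued regularity to scalar regularity and let a varying direction of derivation be
    expanded over fixed ones. *)
Definition findim V := exists (I : finType) (e : I -> V) (l : I -> {linear V -> R^o}),
  (forall i, continuous (l i)) /\ forall v, v = \sum_i (l i v : R) *: e i.

Lemma open_near V (U : set V) x : open U -> U x -> \near x, U x.
Proof. by move=> oU Ux; apply: open_nbhs_nbhs. Qed.

Lemma near_eq_diff V W (f g : V -> W) x :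
  (\near x, f x = g x) -> differentiable f x ->
  differentiable g x /\ 'd g x = 'd f x :> (V -> W).
Proof.
move=> fg df.
have fgx : f x = g x by exact: nbhs_singleton fg.
have [fc fo] := (diff_locallyP x f).1 df.
have go : g \o shift x = cst (g x) + 'd f x +o_ 0 id.
  apply/eqaddoP => _/posnumP[e].
  move/eqaddoP : fo => /(_ _ (gt0 e)) fo; near=> h.
  have -> : (g \o shift x - (cst (g x) + 'd f x)) h =
     (f \o shift x - (cst (f x) + 'd f x)) h.
    rewrite !fctE /= fgx; congr (_ - _).
    near: h; move: fg => /nbhs0P; apply: filterS => h; rewrite addrC => ->.
    by rewrite addrC.
  by near: h.
have E : 'd g x = 'd f x :> (V -> W) by apply: diff_unique.
split; last exact: E.
by apply/diff_locallyP; rewrite E; split; [exact: fc|exact: go].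
Unshelve. all: by end_near. Qed.

Lemma continuous_near_eq V W (f g : V -> W) x :
  (\near x, f x = g x) -> {for x, continuous f} -> {for x, continuous g}.
Proof.
move=> fg fc; rewrite /prop_for /continuous_at -(nbhs_singleton fg).
exact: cvg_trans (near_eq_cvg fg) fc.
Qed.

Lemma Ck_ext V W j (U : set V) (f g : V -> W) :
  open U -> (forall x, U x -> f x = g x) -> Ck j U f -> Ck j U g.
Proof.
move=> oU; elim: j f g => [|j IH] f g fg /=.
  move=> fc x Ux; apply: continuous_near_eq (fc x Ux).
  by apply: filterS (open_near oU Ux) => y; exact: fg.
have nfg x : U x -> \near x, f x = g x.
  by move=> Ux; apply: filterS (open_near oU Ux) => y; exact: fg.
move=> [fd fD]; split=> [x Ux|v].
  exact: (near_eq_diff (nfg x Ux) (fd x Ux)).1.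
by apply: IH (fD v) => x Ux; apply: near_eq_derive; exact: nfg.
Qed.

Lemma Ck_sub V W j (U U' : set V) (f : V -> W) : U' `<=` U -> Ck j U f -> Ck j U' f.
Proof.
move=> UU; elim: j f => [|j IH] f /=; first by move=> h x /UU; exact: h.
by move=> [fd fD]; split=> [x /UU /fd//|v]; apply: IH.
Qed.

Lemma Ck_bigcup V W j (f : V -> W) (I : Type) (U : I -> set V) :
  (forall i, Ck j (U i) f) -> Ck j (\bigcup_i U i) f.
Proof.
elim: j f => [|j IH] f /= h; first by move=> x [i _ Ui]; exact: h Ui.
split=> [x [i _ Ui]|v]; first by have [fd _] := h i; exact: fd Ui.
by apply: IH => i; have [_ ] := h i; apply.
Qed.

(** Every clause of [Ck] is pointwise, so it passes to unions; the union is taken over all open sets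
    on which [f] is [Ck]. *)
Lemma Ck_local V W j (U : set V) (f : V -> W) :
  (forall x, U x -> exists (U' : set V) (g : V -> W),
     [/\ open U', U' x, Ck j U' g & forall y, U' y -> g y = f y]) -> Ck j U f.
Proof.
move=> h.
pose I := {U' : set V | open U' /\ Ck j U' f}.
have : Ck j (\bigcup_(i : I) sval i) f by apply: Ck_bigcup => -[U' []].
apply: Ck_sub => x /h[U' [g [oU' Ux gC gf]]].
have UC : open U' /\ Ck j U' f by split => //; apply: Ck_ext gC.
by exists (exist _ U' UC).
Qed.

Lemma Ck_pred V W j (U : set V) (f : V -> W) : Ck j.+1 U f -> Ck j U f.
Proof.
elim: j f => [|j IH] f.
  by move=> [fd _] x Ux; apply: differentiable_continuous; exact: fd.
by move=> [fd fD]; split => // v; apply: IH; exact: fD.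
Qed.

Lemma Ck_cst V W j (U : set V) (a : W) : Ck j U (fun _ : V => a).
Proof.
elim: j a => [|j IH] a; first by move=> x _; exact: cvg_cst.
split=> [x _|v]; first exact: differentiable_cst.
have -> : (fun x : V => 'D_v (fun=> a) x) = (fun=> 0).
  by apply/funext => x; exact: derive_cst.
exact: IH.
Qed.

Lemma Ck_lin V W j (U : set V) (l : {linear V -> W}) : continuous l -> Ck j U l.
Proof.
move=> lc; case: j => [|j]; first by move=> x _; exact: lc.
split=> [x _|v]; first exact: linear_differentiable.
have -> : (fun x : V => 'D_v l x) = (fun=> l v).
  by apply/funext => x; rewrite deriveE ?diff_lin //; exact: linear_differentiable.
exact: Ck_cst.
Qed.

Lemma derive_eqP V W (U : set V) (f : V -> W) (df : V -> W) v j :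
  open U -> (forall x, U x -> 'D_v f x = df x) -> Ck j U df ->
  Ck j U (fun x => 'D_v f x).
Proof. by move=> oU E; apply: Ck_ext => // x Ux; rewrite E. Qed.

Lemma Ck_add V W j (U : set V) (f g : V -> W) : open U ->
  Ck j U f -> Ck j U g -> Ck j U (fun x => f x + g x).
Proof.
move=> oU; elim: j f g => [|j IH] f g.
  by move=> fC gC x Ux; apply: cvgD; [exact: fC|exact: gC].
move=> [fd fD] [gd gD]; split=> [x Ux|v].
  by apply: differentiableD; [exact: fd|exact: gd].
apply: (derive_eqP (df := fun x => 'D_v f x + 'D_v g x)) => //; last by apply: IH; [exact: fD|exact: gD].
by move=> x Ux; apply: deriveD; apply: diff_derivable; [exact: fd|exact: gd].
Qed.

Lemma Ck_sum V W j (U : set V) (I : Type) (r : seq I) (P : pred I) (f : I -> V -> W) :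
  open U -> (forall i, P i -> Ck j U (f i)) -> Ck j U (fun x => \sum_(i <- r | P i) f i x).
Proof.
move=> oU fC; elim: r => [|i r IH].
  rewrite (_ : (fun x => _) = fun=> 0); first exact: Ck_cst.
  by apply/funext => x; rewrite big_nil.
case Pi : (P i); last first.
  by rewrite (_ : (fun x => _) = fun x => \sum_(i <- r | P i) f i x) //;
    apply/funext => x; rewrite big_cons Pi.
rewrite (_ : (fun x => _) = fun x => f i x + \sum_(i <- r | P i) f i x); last first.
  by apply/funext => x; rewrite big_cons Pi.
by apply: Ck_add => //; exact: fC.
Qed.


Lemma Ck_lincomp V W Z j (U : set V) (l : {linear W -> Z}) (f : V -> W) :
  open U -> continuous l -> Ck j U f -> Ck j U (fun x => l (f x)).
Proof.
move=> oU lc; elim: j f => [|j IH] f.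
  by move=> fC x Ux; apply: continuous_comp; [exact: fC|exact: lc].
move=> [fd fD].
have ld y : differentiable l y by exact: linear_differentiable.
split=> [x Ux|v]; first by apply: differentiable_comp; [exact: fd|exact: ld].
apply: (derive_eqP (df := fun x => l ('D_v f x))) => //; last by apply: IH; exact: fD.
move=> x Ux; have fdx := fd x Ux.
rewrite deriveE; last by apply: differentiable_comp.
by rewrite diff_comp //= diff_lin // -deriveE.
Qed.

Lemma Ck_mul V j (U : set V) (a b : V -> R) : open U ->
  Ck j U a -> Ck j U b -> Ck j U (fun x => a x * b x).
Proof.
move=> oU; elim: j a b => [|j IH] a b.
  by move=> aC bC x Ux; apply: cvgM; [exact: aC|exact: bC].
move=> aC bC; have [ad aD] := aC; have [bd bD] := bC.
split=> [x Ux|v].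
  by apply: differentiableM; [exact: ad|exact: bd].
apply: (derive_eqP (df := fun x => a x * 'D_v b x + b x * 'D_v a x)) => //.
  by move=> x Ux; apply: deriveM; apply: diff_derivable; [exact: ad|exact: bd].
by apply: Ck_add => //; apply: IH; by [exact: Ck_pred|exact: aD|exact: bD].
Qed.

Lemma Ck_scalel V W j (U : set V) (a : V -> R) (w : W) : open U ->
  Ck j U a -> Ck j U (fun x => a x *: w).
Proof.
move=> oU; elim: j a => [|j IH] a.
  by move=> aC x Ux; apply: cvgZr_tmp; exact: aC.
move=> [ad aD].
split=> [x Ux|v]; first by apply: differentiableZl; exact: ad.
apply: (derive_eqP (df := fun x => 'D_v a x *: w)) => //; last by apply: IH; exact: aD.
move=> x Ux; rewrite deriveE; last by apply: differentiableZl; exact: ad.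
by rewrite diffZl ?deriveE //; exact: ad.
Qed.

Lemma Ck_findim V W j (U : set V) (I : finType) (e : I -> W) (l : I -> {linear W -> R^o}) f :
  open U -> (forall v, v = \sum_i (l i v : R) *: e i) ->
  (forall i, Ck j U (fun x => l i (f x) : R)) -> Ck j U f.
Proof.
move=> oU le fC; rewrite (_ : f = fun x => \sum_i (l i (f x) : R) *: e i); last first.
  by apply/funext => x; rewrite -le.
by apply: Ck_sum => // i _; apply: Ck_scalel.
Qed.

Lemma Ck_scale V W j (U : set V) (a : V -> R) (f : V -> W) : findim W -> open U ->
  Ck j U a -> Ck j U f -> Ck j U (fun x => a x *: f x).
Proof.
move=> [I [e [l [lc le]]]] oU aC fC; apply: (Ck_findim oU le) => i.
rewrite (_ : (fun x => _) = fun x => a x * (l i (f x) : R)); last first.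
  by apply/funext => x; rewrite linearZ.
by apply: Ck_mul => //; apply: Ck_lincomp.
Qed.

Lemma derive_comp V W Z (f : V -> W) (g : W -> Z) x v :
  differentiable f x -> differentiable g (f x) ->
  'D_v (fun x => g (f x)) x = 'D_('D_v f x) g (f x).
Proof.
move=> df dg; rewrite deriveE; last exact: differentiable_comp.
by rewrite diff_comp //= [in RHS]deriveE // deriveE.
Qed.

Lemma derive_lincomb W Z (g : W -> Z) y (I : finType) (c : I -> R) (e : I -> W) :
  differentiable g y ->
  'D_(\sum_i c i *: e i) g y = \sum_i c i *: 'D_(e i) g y.
Proof.
move=> dg; rewrite deriveE // linear_sum; apply: eq_bigr => i _.
by rewrite linearZ /= deriveE.
Qed.

(** The derivative of the composite along [v] is that of [g] in the direction ['D_v f x], which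
    varies with [x]. Expanded over [e] it involves only fixed directions, to which the induction
    hypothesis applies. *)
Lemma Ck_comp V W Z j (U : set V) (U' : set W) (f : V -> W) (g : W -> Z) :
  findim W -> findim Z -> open U -> (forall x, U x -> U' (f x)) ->
  Ck j U f -> Ck j U' g -> Ck j U (fun x => g (f x)).
Proof.
move=> [I [e [l [lc le]]]] fZ oU; elim: j f g => [|j IH] f g UU'.
  by move=> fC gC x Ux; apply: continuous_comp; [exact: fC|exact/gC/UU'].
move=> fC [gd gD]; have [fd fD] := fC.
split=> [x Ux|v]; first by apply: differentiable_comp; [exact: fd|exact/gd/UU'].
apply: (derive_eqP (df := fun x => \sum_i (l i ('D_v f x) : R) *: 'D_(e i) g (f x))) => //.
  move=> x Ux; rewrite (derive_comp v (fd x Ux) (gd _ (UU' _ Ux))).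
  rewrite {1}[in LHS](le ('D_v f x)) derive_lincomb //; exact/gd/UU'.
apply: Ck_sum => // i _; apply: Ck_scale => //; first by apply: Ck_lincomp => //; exact: fD.
by apply: (IH f (fun y => 'D_(e i) g y)) => //; [exact: Ck_pred|exact: gD].
Qed.

Lemma Ck_inv V j (U : set V) (a : V -> R) : open U -> (forall x, U x -> a x != 0) ->
  Ck j U a -> Ck j U (fun x => (a x)^-1).
Proof.
move=> oU a0; elim: j a a0 => [|j IH] a a0.
  by move=> aC x Ux; apply: cvgV; [exact: a0|exact: aC].
move=> aC; have [ad aD] := aC.
split=> [x Ux|v]; first by apply: differentiableV; [exact: ad|exact: a0].
have ia := IH a a0 (Ck_pred aC).
apply: (derive_eqP (df := fun x => - 1 * ((a x)^-1 * (a x)^-1) * 'D_v a x)) => //.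
  move=> x Ux; rewrite deriveV; [|exact: a0|exact/diff_derivable/ad].
  by rewrite mulN1r -invfM -expr2.
apply: Ck_mul => //; last exact: aD.
by apply: Ck_mul => //; [exact: Ck_cst|exact: Ck_mul].
Qed.

Lemma Ck_id V j (U : set V) : Ck j U (fun x : V => x).
Proof. by apply: (@Ck_lin _ _ j U idfun) => x; exact: cvg_id. Qed.

Lemma Ck_opp V W j (U : set V) (f : V -> W) : open U -> Ck j U f ->
  Ck j U (fun x => - f x).
Proof. by move=> oU; apply: (Ck_lincomp (l := -%R)) => // x; exact: opp_continuous. Qed.

Lemma Ck_sub_fun V W j (U : set V) (f g : V -> W) : open U ->
  Ck j U f -> Ck j U g -> Ck j U (fun x => f x - g x).
Proof. by move=> oU fC gC; apply: Ck_add => //; exact: Ck_opp. Qed.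

Lemma Ck_prod V j (U : set V) (I : Type) (r : seq I) (f : I -> V -> R) :
  open U -> (forall i, Ck j U (f i)) -> Ck j U (fun x => \prod_(i <- r) f i x).
Proof.
move=> oU fC; elim: r => [|i r IH].
  rewrite (_ : (fun x => _) = fun=> 1); first exact: Ck_cst.
  by apply/funext => x; rewrite big_nil.
rewrite (_ : (fun x => _) = fun x => f i x * \prod_(i <- r) f i x); first exact: Ck_mul.
by apply/funext => x; rewrite big_cons.
Qed.

Lemma findim_R : findim R.
Proof.
exists unit, (fun=> 1), (fun=> idfun); split => [i x|v]; first exact: cvg_id.
by rewrite big_const card_unit /= addr0 /GRing.scale /= mulr1.
Qed.

Definition mxcoord m n (i : 'I_m) (j : 'I_n) (A : 'M[R]_(m, n)) : R^o := A i j.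

Lemma mxcoord_linear m n i j : linear (@mxcoord m n i j).
Proof. by move=> a A B; rewrite /mxcoord !mxE. Qed.

HB.instance Definition _ m n i j := GRing.isLinear.Build R 'M[R]_(m, n) R^o *:%R
  (@mxcoord m n i j) (@mxcoord_linear m n i j).

Lemma findim_mx m n : findim 'M[R]_(m, n).
Proof.
exists ('I_m * 'I_n)%type, (fun ij => delta_mx ij.1 ij.2), (fun ij => @mxcoord m n ij.1 ij.2).
split=> [ij A|A]; first exact: coord_continuous.
by rewrite {1}(matrix_sum_delta A) pair_bigA.
Qed.

Lemma sum_scale_pairl V W (I : finType) (c : I -> R) (e : I -> V) :
  \sum_i c i *: (e i, 0 : W) = (\sum_i c i *: e i, 0).
Proof.
rewrite [LHS]surjective_pairing (raddf_sum fst) (raddf_sum snd) /=; congr pair.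
by rewrite big1 // => i _; rewrite scaler0.
Qed.

Lemma sum_scale_pairr V W (I : finType) (c : I -> R) (e : I -> V) :
  \sum_i c i *: (0 : W, e i) = (0, \sum_i c i *: e i).
Proof.
rewrite [LHS]surjective_pairing (raddf_sum fst) (raddf_sum snd) /=; congr pair.
by rewrite big1 // => i _; rewrite scaler0.
Qed.

Lemma findim_prod V W : findim V -> findim W -> findim (V * W)%type.
Proof.
move=> [I [e [l [lc le]]]] [I' [e' [l' [lc' le']]]].
exists (I + I')%type.
exists (fun i => match i with inl i => (e i, 0) | inr i => (0, e' i) end).
exists (fun i => match i with inl i => (l i \o fst : {linear _ -> _})
                           | inr i => (l' i \o snd : {linear _ -> _}) end).
split=> [[i|i] p|[v w]] /=.
- by apply: continuous_comp; [exact: cvg_fst|exact: lc].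
- by apply: continuous_comp; [exact: cvg_snd|exact: lc'].
rewrite big_sumType /=.
rewrite sum_scale_pairl sum_scale_pairr -le -le'.
by congr (_, _) => /=; rewrite ?addr0 ?add0r.
Qed.

Lemma Ck_mxP V j (U : set V) m n (f : V -> 'M[R]_(m, n)) : open U ->
  (forall i k, Ck j U (fun x => f x i k)) -> Ck j U f.
Proof.
move=> oU fC.
apply: (Ck_findim (I := ('I_m * 'I_n)%type) (e := fun ij => delta_mx ij.1 ij.2)
   (l := fun ij => @mxcoord m n ij.1 ij.2)) => // [A|[i k]]; last exact: fC.
by rewrite {1}(matrix_sum_delta A) pair_bigA.
Qed.

Lemma Ck_entry V j (U : set V) m n (f : V -> 'M[R]_(m, n)) i k : open U ->
  Ck j U f -> Ck j U (fun x => f x i k).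
Proof.
move=> oU; apply: (Ck_lincomp (l := @mxcoord m n i k)) => // x; exact: coord_continuous.
Qed.

Lemma Ck_trmx V j (U : set V) m n (f : V -> 'M[R]_(m, n)) : open U ->
  Ck j U f -> Ck j U (fun x => (f x)^T).
Proof.
move=> oU fC; apply: Ck_mxP => // i k.
rewrite (_ : (fun x => _) = fun x => f x k i); first exact: Ck_entry.
by apply/funext => x; rewrite mxE.
Qed.

Lemma Ck_mulmx V j (U : set V) m n p (f : V -> 'M[R]_(m, n)) (g : V -> 'M[R]_(n, p)) :
  open U -> Ck j U f -> Ck j U g -> Ck j U (fun x => f x *m g x).
Proof.
move=> oU fC gC; apply: Ck_mxP => // i k.
rewrite (_ : (fun x => _) = fun x => \sum_l f x i l * g x l k); last first.
  by apply/funext => x; rewrite mxE.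
by apply: Ck_sum => // l _; apply: Ck_mul => //; exact: Ck_entry.
Qed.

Lemma Ck_det V j (U : set V) n (f : V -> 'M[R]_n) :
  open U -> Ck j U f -> Ck j U (fun x => \det (f x)).
Proof.
move=> oU fC; apply: Ck_sum => // s _; apply: Ck_mul => //; first exact: Ck_cst.
by apply: Ck_prod => // i; exact: Ck_entry.
Qed.

Lemma Ck_invmx V j (U : set V) n (f : V -> 'M[R]_n) : open U ->
  (forall x, U x -> f x \in unitmx) -> Ck j U f -> Ck j U (fun x => invmx (f x)).
Proof.
move=> oU fU fC.
(* Cramer's formula: the adjugate and the determinant are polynomial in the entries. *)
apply: (Ck_ext (f := fun x => (\det (f x))^-1 *: \adj (f x))) => //.
  by move=> x Ux; rewrite /invmx fU.
apply: Ck_scale => //; first exact: findim_mx.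
  apply: Ck_inv => // [x Ux|]; last exact: Ck_det.
  by have := fU x Ux; rewrite unitmxE unitfE.
apply: Ck_mxP => // i k.
rewrite (_ : (fun x => _) = fun x => (-1) ^+ (k + i) * \det (row' k (col' i (f x)))).
  apply: Ck_mul => //; first exact: Ck_cst.
  apply: Ck_det => //; apply: Ck_mxP => // a b.
  rewrite (_ : (fun x => _) = fun x => f x (lift k a) (lift i b)); first exact: Ck_entry.
  by apply/funext => x; rewrite !mxE.
by apply/funext => x; rewrite mxE.
Qed.

Lemma Ck_fst V W Z j (U : set V) (f : V -> W * Z) : open U ->
  Ck j U f -> Ck j U (fun x => (f x).1).
Proof. by move=> oU; apply: (Ck_lincomp (l := fst)) => // x; exact: cvg_fst. Qed.

Lemma Ck_snd V W Z j (U : set V) (f : V -> W * Z) : open U ->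
  Ck j U f -> Ck j U (fun x => (f x).2).
Proof. by move=> oU; apply: (Ck_lincomp (l := snd)) => // x; exact: cvg_snd. Qed.

Lemma Ck_pair V W Z j (U : set V) (f : V -> W) (g : V -> Z) : findim W -> findim Z ->
  open U -> Ck j U f -> Ck j U g -> Ck j U (fun x => (f x, g x)).
Proof.
move=> [I [e [l [lc le]]]] [I' [e' [l' [lc' le']]]] oU fC gC.
rewrite (_ : (fun x => _) = fun x => \sum_i (l i (f x) : R) *: (e i, 0 : Z) +
    \sum_i (l' i (g x) : R) *: (0 : W, e' i)).
  apply: Ck_add => //; apply: Ck_sum => // i _; apply: Ck_scalel => //; exact: Ck_lincomp.
apply/funext => x.
rewrite sum_scale_pairl sum_scale_pairr -le -le'.
by congr (_, _) => /=; rewrite ?addr0 ?add0r.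
Qed.

End Ck_calculus.

(** * Derivatives along lines and curves; symmetry of mixed second derivatives *)

Section Derivatives.
Context {R : realType}.
Implicit Types V W Z : normedModType R.

Lemma is_derive_line V (y u : V) (s : R) : is_derive s (1 : R) (fun s : R => y + s *: u) u.
Proof.
have d1 : differentiable (fun s : R => y + s *: u) s.
  apply: differentiableD; first exact: differentiable_cst.
  by apply: differentiableZl; exact: ex_diff.
apply: DeriveDef; first exact: diff_derivable.
rewrite deriveD; [|exact: derivable_cst|].
  rewrite derive_cst add0r deriveE; last first.
    by apply: differentiableZl; exact: ex_diff.
  rewrite diffZl; last exact: ex_diff.
  by rewrite -deriveE ?derive_id ?scale1r //; exact: ex_diff.
by apply: diff_derivable; apply: differentiableZl; exact: ex_diff.
Qed.

Lemma smooth_line V (y u : V) (J : set R) : open J -> findim V ->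
  smooth J (fun s : R => y + s *: u).
Proof.
move=> oJ fV j; apply: Ck_add => //; first exact: Ck_cst.
by apply: Ck_scalel => //; exact: Ck_id.
Qed.

Lemma is_derive_curve V W (g : V -> W) (c : R -> V) (t : R) (v : V) :
  is_derive t (1 : R) c v -> differentiable g (c t) ->
  is_derive t (1 : R) (fun t => g (c t)) ('D_v g (c t)).
Proof.
move=> [dc <-] dg; have dct := (derivable1_diffP c t).1 dc.
apply: DeriveDef; first exact/diff_derivable/differentiable_comp.
exact: derive_comp.
Qed.

Lemma MVT_dir V (g : V -> R) (y u : V) (h : R) : 0 < h ->
  (forall s, 0 <= s <= h -> differentiable g (y + s *: u)) ->
  exists2 s, 0 < s < h & g (y + h *: u) - g y = 'D_u g (y + s *: u) * h.
Proof.
move=> h0 dg.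
have D s : 0 <= s <= h ->
    is_derive s (1 : R) (fun s => g (y + s *: u)) ('D_u g (y + s *: u)).
  by move=> /dg ds; apply: is_derive_curve => //; exact: is_derive_line.
have [||s] := @MVT _ (fun s => g (y + s *: u)) (fun s => 'D_u g (y + s *: u)) 0 h h0.
- move=> s; rewrite in_itv /= => /andP[s0 sh]; apply: D.
  by rewrite !ltW.
- apply: derivable_within_continuous => s; rewrite in_itv /= => /D[].
  by [].
rewrite in_itv /= => sh; rewrite subr0 scale0r addr0 => E.
by exists s.
Qed.

Lemma near_ball_norm V (P : set V) x : (\near x, P x) ->
  exists2 e : R, 0 < e & forall y, `|y - x| < e -> P y.
Proof.
move=> /nbhs_ballP[e /= e0 he]; exists e => // y yx; apply: he.
by rewrite -ball_normE /= distrC.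
Qed.

(** The mean value theorem is applied first to the increment of [f] along [v], as a function of the
    position along [u], then to ['D_u f] along [v]. *)
Lemma second_difference V (f : V -> R) (U : set V) x (u v : V) (h : R) : 0 < h ->
  Ck 2 U f -> (forall s t : R, 0 <= s <= h -> 0 <= t <= h -> U (x + s *: u + t *: v)) ->
  exists s t, [/\ 0 <= s <= h, 0 <= t <= h &
    f (x + h *: u + h *: v) - f (x + h *: u) - f (x + h *: v) + f x =
    'D_v (fun y => 'D_u f y) (x + s *: u + t *: v) * h * h].
Proof.
move=> h0 [fd fD] hU.
have hh : 0 <= h <= h by rewrite lexx ltW.
have h00 : (0 : R) <= 0 <= h by rewrite lexx ltW.
pose G s := f (x + h *: v + s *: u) - f (x + s *: u).
have D (s : R) : 0 <= s <= h -> is_derive s (1 : R) G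
    ('D_u f (x + h *: v + s *: u) - 'D_u f (x + s *: u)).
  move=> sh; apply: is_deriveB.
    apply: is_derive_curve; first exact: is_derive_line.
    by apply: fd; rewrite addrAC; exact: hU.
  apply: is_derive_curve; first exact: is_derive_line.
  by apply: fd; have := hU s 0 sh h00; rewrite scale0r addr0.
have [s] : exists2 c : R, c \in `]0, h[%R & G h - G 0 =
    ('D_u f (x + h *: v + c *: u) - 'D_u f (x + c *: u)) * (h - 0).
  apply: (@MVT _ G (fun s => 'D_u f (x + h *: v + s *: u) - 'D_u f (x + s *: u))) => //.
    by move=> s; rewrite in_itv /= => /andP[s0 sh]; apply: D; rewrite !ltW.
  by apply: derivable_within_continuous => s; rewrite in_itv /= => /D[].
rewrite in_itv /= => /andP[s0 sh] E.
have shh : 0 <= s <= h by rewrite !ltW.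
have [|t /andP[t0 th] E2] := @MVT_dir _ (fun y => 'D_u f y) (x + s *: u) v h h0.
  by move=> t th; have [D2 _] := fD u; apply: D2; exact: hU.
exists s, t; split; rewrite ?shh ?(ltW t0) ?(ltW th) //.
rewrite -E2 [x + s *: u + _]addrAC -[X in _ * X](subr0 h) -E /G !scale0r !addr0.
by rewrite [x + h *: u + _]addrAC; ring.
Qed.

Lemma dist_half_le (a b z e : R) : `|a - z| < e / 2 -> `|b - z| < e / 2 -> `|a - b| <= e.
Proof.
move=> az bz; rewrite -(subrKA z) (le_trans (ler_normD _ _)) // (splitr e) lerD ?(ltW az) //.
by rewrite distrC ltW.
Qed.

(** The second difference is symmetric in [u] and [v], so the two mixed derivatives take a common
    value at points of an arbitrarily small parallelogram; continuity concludes. *)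
Lemma derive_swap V (f : V -> R) (U : set V) x (u v : V) : open U -> U x -> Ck 2 U f ->
  'D_u (fun y => 'D_v f y) x = 'D_v (fun y => 'D_u f y) x.
Proof.
move=> oU Ux fC; have [fd fD] := fC.
apply/eqP; rewrite -subr_eq0 -normr_le0; apply/ler_addgt0Pr => e e0; rewrite add0r.
have e20 : 0 < e / 2 by rewrite divr_gt0.
have cont a b : {for x, continuous (fun y => 'D_a (fun y => 'D_b f y) y)}.
  by have [_ D2] := fD b; exact: (D2 a).
have near_F a b : \forall y \near x, `|'D_a ('D_b f) x - 'D_a ('D_b f) y| < e / 2.
  by have /cvgr_dist_lt := cont a b; exact.
have /near_ball_norm[d d0 hd] : \forall y \near x, [/\ U y,
    `|'D_u ('D_v f) x - 'D_u ('D_v f) y| < e / 2 & `|'D_v ('D_u f) x - 'D_v ('D_u f) y| < e / 2].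
  near=> y; split; [exact: (near (open_near oU Ux) y)|exact: (near (near_F u v) y)|].
  exact: (near (near_F v u) y).
(* With this side length the parallelogram spanned by [h *: u] and [h *: v] fits in the ball of
   radius [d]; the 1 covers vanishing [u] and [v]. *)
pose h := d / (1 + `|u| + `|v|).
have N0 : 0 < 1 + `|u| + `|v| by rewrite -addrA ltr_pwDl // addr_ge0.
have h0 : 0 < h by rewrite divr_gt0.
have hball s t : 0 <= s <= h -> 0 <= t <= h -> `|x + s *: u + t *: v - x| < d.
  move=> /andP[s0 sh] /andP[t0 th].
  rewrite addrAC [x + _]addrC addrK (le_lt_trans (ler_normD _ _)) //.
  rewrite !normrZ !ger0_norm //.
  have dE : d = h + (h * `|u| + h * `|v|).
    by rewrite -mulrDr -[X in X + _]mulr1 -mulrDr addrA /h divfK // gt_eqF.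
  by rewrite dE ltr_pwDl // lerD // ler_wpM2r.
have hU1 s t : 0 <= s <= h -> 0 <= t <= h -> U (x + s *: u + t *: v).
  by move=> sh th; have [] := hd _ (hball s t sh th).
have hU2 s t : 0 <= s <= h -> 0 <= t <= h -> U (x + s *: v + t *: u).
  by move=> sh th; rewrite addrAC; exact: hU1.
have [s [t [sh th E1]]] := second_difference h0 fC hU1.
have [s' [t' [sh' th' E2]]] := second_difference h0 fC hU2.
have hn : h != 0 by rewrite gt_eqF.
have E3 : f (x + h *: u + h *: v) - f (x + h *: u) - f (x + h *: v) + f x =
    f (x + h *: v + h *: u) - f (x + h *: v) - f (x + h *: u) + f x.
  by rewrite [x + h *: v + _]addrAC; ring.
have EF : 'D_v ('D_u f) (x + s *: u + t *: v) = 'D_u ('D_v f) (x + s' *: v + t' *: u).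
  by have := E3; rewrite E1 E2 => /(mulIf hn) /(mulIf hn).
have [_ _ b1] := hd _ (hball _ _ sh th).
have [|_ b2 _] := hd (x + s' *: v + t' *: u).
  by rewrite [x + s' *: v + _]addrAC; exact: hball.
by apply: dist_half_le b2 _; rewrite -EF; exact: b1.
Unshelve. all: by end_near. Qed.

Lemma smooth_on_open V W (A : set V) (f : V -> W) : open A -> smooth_on A f -> smooth A f.
Proof.
move=> oA fs j; apply: Ck_local => x Ax; have [U [g [oU Ux gs gf]]] := fs x Ax.
exists (U `&` A), g; split => //; first exact: openI.
  by apply: Ck_sub (gs j); apply: subIsetl.
by move=> y [Uy Ay]; exact: gf.
Qed.

Lemma smooth_smooth_on V W (A : set V) (f : V -> W) : open A -> smooth A f -> smooth_on A f.
Proof. by move=> oA fs a Aa; exists A, f. Qed.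

Lemma smooth_diff V W (A : set V) (f : V -> W) x : smooth A f -> A x -> differentiable f x.
Proof. by move=> fs Ax; have [fd _] := fs 1%N; exact: fd. Qed.

Lemma smooth_cont V W (A : set V) (f : V -> W) x : smooth A f -> A x -> {for x, continuous f}.
Proof. by move=> fs Ax; exact: (fs 0%N). Qed.

Lemma smoothD V W (A : set V) (f : V -> W) v : smooth A f -> smooth A (fun x => 'D_v f x).
Proof. by move=> fs j; have [_ ] := fs j.+1; exact. Qed.

Lemma smooth_derive1 W (A : set R) (c : R -> W) : smooth A c -> smooth A (derive1 c).
Proof.
move=> cs; have -> : derive1 c = fun x => 'D_1 c x by apply/funext => x; rewrite derive1E.
exact: smoothD.
Qed.

Lemma smooth_is_derive W (A : set R) (c : R -> W) t : smooth A c -> A t ->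
  is_derive t (1 : R) c (derive1 c t).
Proof.
move=> cs At; rewrite derive1E; apply: derivableP; apply: diff_derivable.
exact: smooth_diff At.
Qed.

Lemma smooth_sub V W (A B : set V) (f : V -> W) : B `<=` A -> smooth A f -> smooth B f.
Proof. by move=> BA fs j; exact: Ck_sub (fs j). Qed.

Lemma smooth_comp V W Z (U : set V) (U' : set W) (f : V -> W) (g : W -> Z) :
  findim W -> findim Z -> open U -> (forall x, U x -> U' (f x)) ->
  smooth U f -> smooth U' g -> smooth U (fun x => g (f x)).
Proof. by move=> fW fZ oU UU' fs gs j; apply: Ck_comp (fs j) (gs j). Qed.

Lemma smooth_ext V W (U : set V) (f g : V -> W) :
  open U -> (forall x, U x -> f x = g x) -> smooth U f -> smooth U g.
Proof. by move=> oU fg fs j; apply: Ck_ext (fs j). Qed.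

Lemma open_smooth_preimage V W (U : set V) (U' : set W) (f : V -> W) :
  open U -> open U' -> smooth U f -> open (U `&` f @^-1` U').
Proof.
move=> oU oU' fs; rewrite openE => x [Ux fx]; apply: filterI.
  exact: open_near.
have := smooth_cont fs Ux; apply; exact: open_near.
Qed.

Lemma is_derive_unique W (c : R -> W) (t : R) (a b : W) :
  is_derive t (1 : R) c a -> is_derive t (1 : R) c b -> a = b.
Proof. by move=> [_ <-] [_ <-]. Qed.

End Derivatives.

(** * Charts and tangent vectors *)

Section Charts.
Context {R : realType}.
Implicit Types V W Z : normedModType R.

Lemma findim_cV m : findim 'cV[R]_m. Proof. exact: findim_mx. Qed.

Lemma is_derive_dir V W (g : V -> W) (y u : V) : differentiable g y ->
  is_derive (0 : R) (1 : R) (fun t : R => g (y + t *: u)) ('D_u g y).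
Proof.
move=> dg; have := @is_derive_curve _ _ _ g (fun t : R => y + t *: u) 0 u
  (is_derive_line y u 0).
by rewrite scale0r addr0; exact.
Qed.

Lemma chart_smooth V m (S : set V) (Om : set 'cV[R]_m) phi :
  local_param S Om phi -> smooth Om phi.
Proof. by move=> [oOm [phis _ _]]; exact: smooth_on_open. Qed.

Lemma chart_mem V m (S : set V) (Om : set 'cV[R]_m) phi u :
  local_param S Om phi -> Om u -> S (phi u).
Proof.
move=> [_ [_ [Q oQ E] _]] Ou; have : (phi @` Om) (phi u) by exists u.
by rewrite E => -[].
Qed.

(** [diffeo_into] gives an inverse on the image only, smooth in the sense of local extensions. Such
    an extension is restricted to an open set which meets [S] inside the image and which it maps
    into [Om]. *)
Lemma chart_inv V m (S : set V) (Om : set 'cV[R]_m) phi u :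
  local_param S Om phi -> Om u ->
  exists (O : set V) (g : V -> 'cV[R]_m),
  [/\ open O, O (phi u), smooth O g, (forall y, O y -> Om (g y)) &
      (forall y, S y -> O y -> phi (g y) = y) /\
      (forall v, Om v -> O (phi v) -> g (phi v) = v)].
Proof.
move=> [oOm [phis [Q' oO' E] [g gs gK]]] Ou.
have [|U [g' [oU Upu g's g'E]]] := gs (phi u); first by exists u.
have oUO : open (U `&` Q') by exact: openI.
have g'sI : smooth (U `&` Q') g' by apply: smooth_sub g's; exact: subIsetl.
have im v : Om v -> (phi @` Om) (phi v) by move=> Ov; exists v.
exists ((U `&` Q') `&` g' @^-1` Om), g'; split.
- exact: open_smooth_preimage.
- split; first by split => //; have := im _ Ou; rewrite E => -[].
  by rewrite /preimage /= g'E ?gK //; exact: im.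
- by apply: smooth_sub g'sI; exact: subIsetl.
- by move=> y [].
split=> [y Sy [[Uy O'y] _]|v Ov [[Uv _] _]].
  have [a Oa ay] : (phi @` Om) y by rewrite E.
  by move: Uy; rewrite -ay => Uy; rewrite g'E ?gK //; exact: im.
by rewrite g'E ?gK //; exact: im.
Qed.

Lemma chart_inj V m (S : set V) (Om : set 'cV[R]_m) phi u v :
  local_param S Om phi -> Om u -> Om v -> phi u = phi v -> u = v.
Proof. by move=> [_ [_ _ [g _ gK]]] Ou Ov E; rewrite -(gK _ Ou) E gK. Qed.

Lemma chart_inv_derive V m (Om : set 'cV[R]_m) (phi : 'cV[R]_m -> V) u (O : set V) g b :
  open Om -> smooth Om phi -> Om u -> open O -> O (phi u) -> smooth O g ->
  (forall v, Om v -> O (phi v) -> g (phi v) = v) ->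
  'D_('D_b phi u) g (phi u) = b.
Proof.
move=> oOm phis Ou oO Ophiu gs gK.
have dphi := smooth_diff phis Ou; have dg := smooth_diff gs Ophiu.
rewrite -derive_comp //.
rewrite (@near_eq_derive _ _ _ _ (fun x => x)) ?derive_id //.
have nO : \near u, O (phi u).
  by have := smooth_cont phis Ou; apply; exact: open_near.
by near=> v; apply: gK; [exact: (near (open_near oOm Ou) v)|exact: (near nO v)].
Unshelve. all: by end_near. Qed.

Lemma chart_diff_inj V m (S : set V) (Om : set 'cV[R]_m) phi u a b :
  local_param S Om phi -> Om u -> 'D_a phi u = 'D_b phi u -> a = b.
Proof.
move=> lp Ou E; have [Q [g [oO Ou' gs _ [_ gK]]]] := chart_inv lp Ou.
have H := chart_inv_derive _ lp.1 (chart_smooth lp) Ou oO Ou' gs gK.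
by rewrite -(H a) E H.
Qed.

(** The curve is not asked to stay in [S]: a piece of a piecewise smooth curve extends smoothly
    beyond its interval, where nothing keeps it on [S]. *)
Lemma chart_lift V m (S : set V) (Om : set 'cV[R]_m) phi u (J : set R) (c : R -> V) t0 :
  findim V -> local_param S Om phi -> Om u -> open J -> smooth J c -> J t0 -> c t0 = phi u ->
  exists (J' : set R) (v : R -> 'cV[R]_m),
    [/\ open J', J' t0, J' `<=` J, smooth J' v &
    [/\ v t0 = u, forall t, J' t -> Om (v t) & forall t, J' t -> S (c t) -> phi (v t) = c t]].
Proof.
move=> fV lp Ou oJ cs Jt0 E; have [Q [g [oO Ou' gs gO [Sg gK]]]] := chart_inv lp Ou.
exists (J `&` c @^-1` Q), (fun t => g (c t)); split.
- exact: open_smooth_preimage.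
- by split; rewrite /preimage /= ?E.
- by move=> t [].
- apply: (@smooth_comp _ _ _ _ _ Q) => //; first exact: findim_cV.
  + exact: open_smooth_preimage.
  + by move=> t [].
  + by apply: smooth_sub cs => t [].
split; first by rewrite E gK.
  by move=> t [_ Oc]; exact: gO.
by move=> t [_ Oc] Sc; exact: Sg.
Qed.

Lemma chart_curve V m (S : set V) (Om : set 'cV[R]_m) phi u b : findim V ->
  local_param S Om phi -> Om u ->
  curve_through S (phi u) ('D_b phi u) (fun t : R => phi (u + t *: b)).
Proof.
move=> fV lp Ou; have oOm := lp.1; have phis := chart_smooth lp.
have ls : smooth setT (fun t : R => u + t *: b).
  by apply: smooth_line; [exact: openT|exact: findim_cV].
exists (setT `&` (fun t : R => u + t *: b) @^-1` Om); split.
- by apply: open_smooth_preimage => //; exact: openT.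
- by split=> //; rewrite /preimage /= scale0r addr0.
- apply: (@smooth_comp _ _ _ _ _ Om) => //; first exact: findim_cV.
  + by apply: open_smooth_preimage => //; exact: openT.
  + by move=> t [].
  + by apply: smooth_sub ls.
- by move=> t [_ Ot]; exact: chart_mem lp Ot.
split; first by rewrite scale0r addr0.
by rewrite derive1E; have [_ ->] := is_derive_dir b (smooth_diff phis Ou).
Qed.

Lemma curve_chart_velocity V m (S : set V) (Om : set 'cV[R]_m) phi u w (c : R -> V) :
  findim V -> local_param S Om phi -> Om u -> curve_through S (phi u) w c ->
  exists (J : set R) (v : R -> 'cV[R]_m) b,
   [/\ open J, J 0, smooth J v, (forall t, J t -> Om (v t) /\ phi (v t) = c t) &
    [/\ v 0 = u, derive1 v 0 = b & 'D_b phi u = w]].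
Proof.
move=> fV lp Ou [J [oJ J0 cs cS [c0 c'0]]].
have [J' [v [oJ' J'0 J'J vs [v0 vO vc]]]] := chart_lift fV lp Ou oJ cs J0 c0.
exists J', v, (derive1 v 0); split => //.
  by move=> t Jt; split; [exact: vO|apply: vc => //; exact/cS/J'J].
split => //; rewrite -c'0.
have phis := chart_smooth lp.
have H : is_derive 0 (1 : R) (fun t => phi (v t)) ('D_(derive1 v 0) phi (v 0)).
  apply: is_derive_curve; first exact: smooth_is_derive vs J'0.
  by rewrite v0; exact: smooth_diff phis Ou.
move: H; rewrite v0 => H; apply: (is_derive_unique H).
apply: near_eq_is_derive (smooth_is_derive cs J0).
by near=> t; apply/esym/vc; [|apply/cS/J'J]; exact: (near (open_near oJ' J'0) t).
Unshelve. all: by end_near. Qed.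

Lemma tangent_chart V m (S : set V) (Om : set 'cV[R]_m) phi u w :
  findim V -> local_param S Om phi -> Om u ->
  tangent S (phi u) w <-> exists b, w = 'D_b phi u.
Proof.
move=> fV lp Ou; split=> [[c /(curve_chart_velocity fV lp Ou)[J [v [b [_ _ _ _ [_ _ <-]]]]]]|[b ->]].
  by exists b.
by exists (fun t : R => phi (u + t *: b)); exact: (chart_curve b fV lp Ou).
Qed.

(** The value chosen by [tdiff] is independent of the curve: the differential of [phi] is injective,
    so curves with the same velocity have the same velocity in the chart. *)
Lemma tdiff_chart V W m (S : set V) (Om : set 'cV[R]_m) phi u b (G : V -> W) :
  findim V -> local_param S Om phi -> Om u ->
  differentiable (fun v => G (phi v)) u ->
  tdiff S G (phi u) ('D_b phi u) = 'D_b (fun v => G (phi v)) u.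
Proof.
move=> fV lp Ou dG; apply: xget_unique => /=.
  exists (fun t : R => phi (u + t *: b)); first exact: (chart_curve b fV lp Ou).
  exact: (is_derive_dir b dG).
move=> w [c /(curve_chart_velocity fV lp Ou)[J [v [b' [oJ J0 vs vc [v0 v'0 Db]]]]]] Hw.
have E : b' = b by exact: (chart_diff_inj lp Ou Db).
have := @is_derive_curve _ _ _ (fun v => G (phi v)) v 0 b'.
rewrite v0 => /(_ _ dG) H.
have dv : is_derive 0 (1 : R) v b' by rewrite -v'0; exact: smooth_is_derive vs J0.
rewrite -E; apply: (is_derive_unique _ (H dv)).
apply: near_eq_is_derive Hw.
by near=> t; rewrite /= (vc t _).2 //; exact: (near (open_near oJ J0) t).
Unshelve. all: by end_near. Qed.

End Charts.

(** * Uniqueness for ordinary differential equations *)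

Section ODE.
Context {R : realType}.
Implicit Types V W : normedModType R.

(** Continuous induction, by the supremum of the times up to which [P] holds throughout. It serves
    the uniqueness of geodesics and the confinement of short curves to a normal ball. *)
Lemma real_induction (a b : R) (P : R -> Prop) :
  P a ->
  (forall t, a < t <= b -> (forall r, a <= r < t -> P r) -> P t) ->
  (forall t, a <= t < b -> P t ->
     exists2 e : R, 0 < e & forall r, t <= r < t + e -> r <= b -> P r) ->
  forall t, a <= t <= b -> P t.
Proof.
move=> Pa Pc Po t /andP[at_ tb].
pose A : set R := [set t | a <= t <= b /\ forall r, a <= r <= t -> P r].
have Aa : A a.
  split; first by rewrite lexx (le_trans at_).
  by move=> r /andP[ar ra]; have -> : r = a by apply/le_anti; rewrite ra ar.
have hA : has_sup A by split; [exists a|exists b => x [/andP[]]].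
have ub : ubound A (sup A) by exact: sup_upper_bound.
have as_ : a <= sup A by exact: ub.
have sb : sup A <= b by apply: ge_sup; [exists a|move=> x [/andP[]]].
have Plt r : a <= r < sup A -> P r.
  move=> /andP[ar rs].
  have sr : 0 < sup A - r by rewrite subr_gt0.
  have [x [_ Ax] rx] := sup_adherent sr hA.
  by apply: Ax; rewrite ar ltW //; move: rx; rewrite subKr.
have Ps : P (sup A).
  have [->|] := eqVneq (sup A) a; first exact: Pa.
  move=> ns; apply: Pc => //; first by rewrite sb lt_neqAle eq_sym ns as_.
have [->|nb] := eqVneq t (sup A); first exact: Ps.
have [ts|st] := ltP t (sup A); first by apply: Plt; rewrite at_.
have {nb}st : sup A < t by rewrite lt_neqAle eq_sym nb st.
have [|e e0 he] := Po (sup A) _ Ps; first by rewrite as_ (lt_le_trans st tb).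
(* A point beyond the supremum and within the reach of the extension, contradicting maximality. *)
pose s := Num.min b (sup A + e / 2).
have ss : sup A < s by rewrite lt_min (lt_le_trans st tb) /= ltrDl divr_gt0.
suff : A s by move=> /ub; rewrite leNgt ss.
split; first by rewrite (le_trans as_ (ltW ss)) ge_min lexx.
move=> r /andP[ar rs]; have [rA|Ar] := ltP r (sup A); first by apply: Plt; rewrite ar.
apply: he; last by rewrite (le_trans rs) // ge_min lexx.
rewrite Ar /= (le_lt_trans rs) // gt_min ltrD2l orbC.
by rewrite ltr_pdivrMr // mulr_natr mulr2n ltrDl e0.
Qed.

Lemma is_derive_bigsum V W (I : Type) (r : seq I) (h : I -> V -> W) (x v : V) (dh : I -> W) :
  (forall i, is_derive x v (h i) (dh i)) ->
  is_derive x v (fun t => \sum_(i <- r) h i t) (\sum_(i <- r) dh i).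
Proof.
move=> H; have -> : (fun t => \sum_(i <- r) h i t) = \sum_(i <- r) h i.
  by apply/funext => y; rewrite fct_sumE.
by elim/big_ind2 : _ => [|f df g dg|i _]; [exact: is_derive_cst|exact: is_deriveD|exact: H].
Qed.

Lemma MVT_nonpos (h dh : R -> R) (a b : R) : a <= b ->
  (forall t, a <= t <= b -> is_derive t (1 : R) h (dh t) /\ dh t <= 0) -> h b <= h a.
Proof.
move=> ab H; have hd t : t \in `[a, b] -> is_derive t (1 : R) h (dh t).
  by rewrite in_itv /= => /H[].
have hc : {within `[a, b], continuous h}.
  by apply: derivable_within_continuous => t /hd[].
have hd' t : t \in `]a, b[ -> is_derive t (1 : R) h (dh t).
  by move=> tab; apply: hd; apply: subset_itv_oo_cc.
have [c cab E] := MVT_segment ab hd' hc.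
rewrite -subr_le0 E; move: cab; rewrite in_itv /= => /H[_ ?].
by rewrite mulr_le0_ge0 // subr_ge0.
Qed.

(** The mean value theorem on a segment, with the increment expanded over [e]. The bound uses
    coordinates and not the norm because the uniqueness proof below works with a sum of squared
    coordinates. *)
Lemma Ck1_locally_lipschitz W (I : finType) (e : I -> W) (l : I -> {linear W -> R^o})
    (U : set W) (F : W -> R) x0 :
  (forall v, v = \sum_i (l i v : R) *: e i) -> open U -> U x0 -> Ck 1 U F ->
  exists L d : R, [/\ 0 <= L, 0 < d & forall x y, `|x - x0| < d -> `|y - x0| < d ->
    `|F x - F y| <= L * \sum_i `|l i (x - y) : R|].
Proof.
move=> le oU Ux [Fd FD].
pose L := 1 + \sum_i `|'D_(e i) F x0|.
have nD i : \forall y \near x0, `|'D_(e i) F y| <= L.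
  have /cvgr_dist_lt /(_ _ ltr01) : {for x0, continuous (fun y => 'D_(e i) F y)} by exact: (FD (e i)).
  apply: filterS => y hy.
  rewrite -(subrK ('D_(e i) F x0) ('D_(e i) F y)) (le_trans (ler_normD _ _)) //.
  rewrite lerD //; first by rewrite distrC ltW.
  by rewrite (bigD1 i) //= lerDl sumr_ge0.
have /near_ball_norm[d d0 hd] : \forall y \near x0, U y /\ forall i, `|'D_(e i) F y| <= L.
  near=> y; split; first exact: (near (open_near oU Ux) y).
  exact: (near (filter_forall _ nD) y).
have L0 : 0 <= L by rewrite addr_ge0 ?sumr_ge0.
exists L, d; split => // x y hx hy.
have seg s : 0 <= s <= 1 -> `|y + s *: (x - y) - x0| < d.
  move=> /andP[s0 s1].
  have -> : y + s *: (x - y) - x0 = s *: (x - x0) + (1 - s) *: (y - x0).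
    have -> : x - y = x - x0 - (y - x0) by rewrite opprB addrA subrK.
    by rewrite addrAC scalerBr scalerBl scale1r addrCA.
  rewrite (le_lt_trans (ler_normD _ _)) // !normrZ ger0_norm // ger0_norm ?subr_ge0 //.
  have -> : d = s * d + (1 - s) * d by ring.
  have [->|sn0] := eqVneq s 0; first by rewrite !mul0r !add0r subr0 !mul1r.
  by rewrite ltr_leD // ?ltr_pM2l ?lt0r ?sn0 //; apply: ler_wpM2l; rewrite ?subr_ge0 // ltW.
have [|s /andP[s0 s1]] := @MVT_dir _ _ F y (x - y) 1 ltr01.
  by move=> s /seg/hd[Us _]; exact: Fd.
rewrite scale1r subrKC mulr1 => ->.
have ss : 0 <= s <= 1 by rewrite !ltW.
have [Us Ds] := hd _ (seg s ss).
move: (y + s *: (x - y)) Us Ds => p Us Ds.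
rewrite {1}(le (x - y)) derive_lincomb; last exact: Fd.
rewrite (le_trans (ler_norm_sum _ _ _)) // mulr_sumr ler_sum // => i _.
by rewrite normrM mulrC ler_wpM2r.
Unshelve. all: by end_near. Qed.

(** Gronwall's argument: the sum [E] of the squared coordinates of [X - Y] satisfies [E' <= K E], so
    [E] times [expR (- K t)] does not increase from its value 0 at [t0]. *)
Lemma ode_unique W (U : set W) (F : W -> W) (J : set R) (X Y : R -> W) t0 :
  findim W -> open U -> Ck 1 U F -> open J -> J t0 ->
  (forall t, J t -> U (X t) /\ is_derive t (1 : R) X (F (X t))) ->
  (forall t, J t -> U (Y t) /\ is_derive t (1 : R) Y (F (Y t))) ->
  X t0 = Y t0 ->
  exists2 e : R, 0 < e & forall t, t0 <= t < t0 + e -> X t = Y t.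
Proof.
move=> [I [e [l [lc le]]]] oU FC oJ Jt0 hX hY E0.
have FlC i : Ck 1 U (fun x => l i (F x) : R) by apply: Ck_lincomp.
have [L [d hL]] : exists L d : I -> R, forall i, [/\ 0 <= L i, 0 < d i &
    forall x y, `|x - X t0| < d i -> `|y - X t0| < d i ->
    `|(l i (F x) : R) - l i (F y)| <= L i * \sum_j `|l j (x - y) : R|].
  have h i := Ck1_locally_lipschitz le oU (hX t0 Jt0).1 (FlC i).
  have [L hL] := choice h; have [d hd] := choice hL.
  by exists L, d.
pose z t i : R := l i (X t - Y t).
(* The factor 2 comes from differentiating a square, and each product of two coordinates of [X - Y]
   is at most [E]. *)
pose K := 2 * \sum_i \sum_(j in I) L i.
pose E t := \sum_i z t i ^+ 2.
pose E' t := \sum_i 2 * (z t i * (l i (F (X t) - F (Y t)) : R)).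
have dz t i : J t -> is_derive t (1 : R) (fun t => z t i) (l i (F (X t) - F (Y t)) : R).
  move=> Jt; have [_ dX] := hX t Jt; have [_ dY] := hY t Jt.
  have dl y : differentiable (l i) y by exact: linear_differentiable.
  have dXY : is_derive t (1 : R) (fun t => X t - Y t) (F (X t) - F (Y t)) by exact: is_deriveB.
  have := is_derive_curve dXY (dl _).
  by rewrite deriveE // diff_lin.
have dE t : J t -> is_derive t (1 : R) E (E' t).
  move=> Jt; rewrite /E /E'.
  apply: is_derive_bigsum => i; have dzi := dz t i Jt.
  apply: is_derive_eq.
  by rewrite /GRing.scale /=; ring.
have K0 : 0 <= K by rewrite mulr_ge0 // sumr_ge0 // => i _; rewrite sumr_ge0 // => j _; have [] := hL i.
have /near_ball_norm[r r0 hr] : \forall t \near t0, J t /\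
    forall i, `|X t - X t0| < d i /\ `|Y t - X t0| < d i.
  have cX : {for t0, continuous X}.
    by apply: differentiable_continuous; apply/derivable1_diffP; have [_ []] := hX t0 Jt0.
  have cY : {for t0, continuous Y}.
    by apply: differentiable_continuous; apply/derivable1_diffP; have [_ []] := hY t0 Jt0.
  have nX i : \forall t \near t0, `|X t - X t0| < d i.
    have [_ di _] := hL i; have /cvgr_dist_lt /(_ _ di) := cX.
    by apply: filterS => t; rewrite distrC.
  have nY i : \forall t \near t0, `|Y t - X t0| < d i.
    have [_ di _] := hL i; have /cvgr_dist_lt /(_ _ di) := cY.
    by apply: filterS => t; rewrite distrC E0.
  near=> t; split; first exact: (near (open_near oJ Jt0) t).
  by move=> i; split; [exact: (near (filter_forall _ nX) t)|exact: (near (filter_forall _ nY) t)].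
have bound t : J t -> (forall i, `|X t - X t0| < d i /\ `|Y t - X t0| < d i) ->
    E' t <= K * E t.
  move=> Jt hd; rewrite /E' -mulr_sumr /K -mulrA ler_wpM2l // mulr_suml ler_sum // => i _.
  have [Li _ hLi] := hL i; have [hx hy] := hd i.
  have hLi2 := hLi _ _ hx hy.
  rewrite (le_trans (ler_norm _)) // normrM linearB /=.
  have zi : `|z t i| * (L i * \sum_j `|z t j|) <= \sum_(j in I) L i * E t.
    rewrite mulrCA -mulr_sumr ler_wpM2l // mulr_sumr ler_sum // => j _.
    have zE k : `|z t k| ^+ 2 <= E t.
      rewrite real_normK ?num_real // /E (bigD1 k) //= lerDl sumr_ge0 // => ? _.
      exact: sqr_ge0.
    have := zE i; have := zE j; set p := `|z t i|; set q := `|z t j| => qE pE.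
    have := sqr_ge0 (p - q); nra.
  rewrite mulr_suml; apply: le_trans zi; rewrite ler_wpM2l //.
exists r => // t /andP[t0t te].
have near_t s : t0 <= s <= t -> J s /\ forall i, `|X s - X t0| < d i /\ `|Y s - X t0| < d i.
  move=> /andP[ts st]; apply: hr; rewrite ger0_norm ?subr_ge0 //.
  by rewrite ltrBlDl (le_lt_trans st).
have Et : E t * expR (- K * t) <= E t0 * expR (- K * t0).
  apply: (@MVT_nonpos (fun s => E s * expR (- K * s))
     (fun s => (E' s - K * E s) * expR (- K * s))) => // s /near_t[Js hs].
  split; last first.
    by rewrite mulr_le0_ge0 ?expR_ge0 // subr_le0; exact: bound.
  have dEs := dE s Js.
  have dexp : is_derive s (1 : R) (fun s => expR (- K * s)) (- K * expR (- K * s)).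
    have dl : is_derive s (1 : R) (fun s : R => - K * s) (- K).
      have := @is_deriveZ _ _ _ id (- K) s (1 : R) (1 : R) (is_derive_id _ _).
      by rewrite /GRing.scale /= mulr1.
    have := is_derive1_comp (is_derive_expR (- K * s)) dl.
    by rewrite mulrC.
  apply: is_derive_eq.
  by rewrite /GRing.scale /=; ring.
move: Et; have -> : E t0 = 0.
  by rewrite /E big1 // => i _; rewrite /z E0 subrr linear0 expr0n.
rewrite mul0r pmulr_lle0 ?expR_gt0 // => Et0.
have {}Et0 : E t = 0 by apply/le_anti; rewrite Et0 sumr_ge0 // => i _; exact: sqr_ge0.
apply/eqP; rewrite -subr_eq0; apply/eqP; rewrite (le (X t - Y t)) big1 // => i _.
move: Et0 => /eqP; rewrite psumr_eq0 => [/allP/(_ i)|? _]; last exact: sqr_ge0.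
by rewrite mem_index_enum => /(_ isT); rewrite sqrf_eq0 /z => /eqP ->; rewrite scale0r.
Unshelve. all: by end_near. Qed.
End ODE.

(** * Geodesics *)

Section Geodesics.
Context {R : realType}.
Implicit Types V W : normedModType R.

(** The form lives on the ambient space but is definite only on tangent vectors: the Sasaki metric
    sees an operator only through its compression. Smoothness is asked of Gram matrices only, so
    nothing is required of the form off [S]. *)
Definition metric_on V (S : set V) (met : V -> V -> V -> R) : Prop :=
  [/\ forall w a D D' X, met w (a *: D + D') X = a * met w D X + met w D' X,
      forall w D X, met w D X = met w X D,
      forall w D, 0 <= met w D D,
      forall w D, S w -> tangent S w D -> met w D D = 0 -> D = 0 &
      forall m (Om : set 'cV[R]_m) phi, local_param S Om phi ->
        forall i j, smooth Om (fun u => gram met phi u i j)].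

Lemma linear_suml V (B : V -> R) (I : finType) (c : I -> R) (D : I -> V) :
  (forall a x y, B (a *: x + y) = a * B x + B y) ->
  B (\sum_i c i *: D i) = \sum_i c i * B (D i).
Proof.
move=> ml.
have m0 : B 0 = 0.
  have := ml 1 0 0; rewrite scale1r addr0 mul1r => /eqP.
  by rewrite -subr_eq0 opprD addNKr oppr_eq0 => /eqP.
have mD x y : B (x + y) = B x + B y by rewrite -[x]scale1r ml mul1r scale1r.
have mZ a x : B (a *: x) = a * B x by rewrite -[a *: x]addr0 ml m0 addr0.
by elim/big_rec2 : _ => [|i y x _ <-]; rewrite ?m0 // mD mZ.
Qed.

Lemma met_suml V (S : set V) met w (I : finType) (c : I -> R) (D : I -> V) X :
  metric_on S met -> met w (\sum_i c i *: D i) X = \sum_i c i * met w (D i) X.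
Proof.
move=> [ml _ _ _ _]; apply: (linear_suml (B := fun D => met w D X)) => a x y.
exact: ml.
Qed.

Lemma cV_sum_basis m (u : 'cV[R]_m) : u = \sum_i u i 0 *: basis_vec R i.
Proof.
rewrite {1}(matrix_sum_delta u); apply: eq_bigr => i _.
by rewrite big_ord1.
Qed.

Lemma derive_basis m W (phi : 'cV[R]_m -> W) u b : differentiable phi u ->
  'D_b phi u = \sum_i b i 0 *: 'D_(basis_vec R i) phi u.
Proof. by move=> dphi; rewrite {1}(cV_sum_basis b) derive_lincomb. Qed.

Lemma gram_form V (S : set V) met m (phi : 'cV[R]_m -> V) u a b :
  metric_on S met -> differentiable phi u ->
  met (phi u) ('D_a phi u) ('D_b phi u) =
  \sum_i \sum_j gram met phi u i j * a i 0 * b j 0.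
Proof.
move=> hm dphi; have [_ ms _ _ _] := hm.
rewrite (derive_basis a dphi) (met_suml _ _ _ _ hm); apply: eq_bigr => i _.
rewrite (derive_basis b dphi) ms (met_suml _ _ _ _ hm) mulr_sumr; apply: eq_bigr => j _.
by rewrite ms mxE; ring.
Qed.

(** A kernel vector is the coordinate vector of a tangent vector of length 0. *)
Lemma gram_unit V (S : set V) met m (Om : set 'cV[R]_m) phi u : findim V ->
  metric_on S met -> local_param S Om phi -> Om u -> gram met phi u \in unitmx.
Proof.
move=> fV hm lp Ou; have dphi := smooth_diff (chart_smooth lp) Ou.
rewrite -row_free_unit; apply/row_freeP; apply: contrapT => nfree.
have : kermx (gram met phi u) != 0.
  apply/eqP => k0; apply: nfree; apply/row_freeP.
  by rewrite -kermx_eq0 k0.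
case/rowV0Pn => a /sub_kermxP aG a0.
have E : met (phi u) ('D_(a^T) phi u) ('D_(a^T) phi u) = 0.
  rewrite (gram_form _ _ hm dphi) exchange_big big1 //= => j _.
  transitivity ((a *m gram met phi u) 0 j * a 0 j).
    by rewrite [in RHS]mxE mulr_suml; apply: eq_bigr => i _; rewrite [a^T i 0]mxE [a^T j 0]mxE; ring.
  by rewrite aG mxE mul0r.
have [_ _ _ mp _] := hm.
have T : tangent S (phi u) ('D_(a^T) phi u) by apply/(tangent_chart _ fV lp Ou); exists a^T.
have D0 := mp _ _ (chart_mem lp Ou) T E.
have : a^T = 0 by apply: (chart_diff_inj lp Ou); rewrite D0 derive0.
by move/(congr1 trmx); rewrite trmxK trmx0 => /eqP; apply/negP.
Qed.

Lemma christoffel_Ck V (S : set V) met m (Om : set 'cV[R]_m) phi l i j k : findim V ->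
  metric_on S met -> local_param S Om phi ->
  Ck k Om (fun u => christoffel met phi u l i j).
Proof.
move=> fV hm lp; have oOm := lp.1; have [_ _ _ _ gs] := hm.
have G n : Ck n Om (gram met phi).
  by apply: Ck_mxP => // a b; exact: (gs _ _ _ lp a b n).
apply: Ck_mul => //; first exact: Ck_cst.
apply: Ck_sum => // p _; apply: Ck_mul => //.
  apply: Ck_entry => //; apply: Ck_invmx => // u Ou; exact: (gram_unit fV hm lp Ou).
have Dg v a b : Ck k Om (fun u => 'D_v (fun v => gram met phi v a b) u).
  by have [_] := gs _ _ _ lp a b k.+1; exact.
by apply: Ck_sub_fun => //; apply: Ck_add.
Qed.

Lemma is_derive_pair V W (f : R -> V) (g : R -> W) t a b :
  is_derive t (1 : R) f a -> is_derive t (1 : R) g b ->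
  is_derive t (1 : R) (fun t => (f t, g t)) (a, b).
Proof.
move=> [/derivable1_diffP df <-] [/derivable1_diffP dg <-].
have dfg : differentiable (fun t => (f t, g t)) t by exact: differentiable_pair.
apply: DeriveDef; first exact/diff_derivable.
by rewrite deriveE // diff_pair // -!deriveE.
Qed.

Lemma lift_velocity V m (S : set V) (Om : set 'cV[R]_m) phi (J : set R) v (c : R -> V) t :
  local_param S Om phi -> open J -> J t -> smooth J v -> smooth J c ->
  (forall t, J t -> Om (v t) /\ phi (v t) = c t) ->
  'D_(derive1 v t) phi (v t) = derive1 c t.
Proof.
move=> lp oJ Jt vs cs vc.
apply: (@is_derive_unique _ _ c t); last exact: smooth_is_derive cs Jt.
apply: (@near_eq_is_derive _ _ _ (fun t => phi (v t))).
  by apply: filterS (open_near oJ Jt) => r /vc[].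
apply: is_derive_curve; first exact: smooth_is_derive vs Jt.
by apply: smooth_diff (chart_smooth lp) _; have [] := vc t Jt.
Qed.

Definition geodesic_field V met m (phi : 'cV[R]_m -> V) (X : 'cV[R]_m * 'cV[R]_m) :
    'cV[R]_m * 'cV[R]_m :=
  (X.2, \col_l (- \sum_(i < m) \sum_(j < m)
    christoffel met phi X.1 l i j * X.2 i 0 * X.2 j 0)).

Lemma geodesic_field_Ck V (S : set V) met m (Om : set 'cV[R]_m) phi n : findim V ->
  metric_on S met -> local_param S Om phi ->
  Ck n (fst @^-1` Om) (geodesic_field met phi).
Proof.
move=> fV hm lp; have oOm := lp.1.
have oU : open ((fst : 'cV[R]_m * 'cV[R]_m -> _) @^-1` Om).
  by apply: open_comp => // x _; exact: cvg_fst.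
have idC : Ck n (fst @^-1` Om) (fun X : 'cV[R]_m * 'cV[R]_m => X) by exact: Ck_id.
have fstC := Ck_fst oU idC; have sndC := Ck_snd oU idC.
apply: (Ck_pair (findim_cV m) (findim_cV m) oU sndC).
apply: Ck_mxP => // l k.
rewrite (_ : (fun X => _) = fun X : 'cV[R]_m * 'cV[R]_m => - \sum_(i < m) \sum_(j < m)
    christoffel met phi X.1 l i j * X.2 i 0 * X.2 j 0); last first.
  by apply/funext => X; rewrite mxE.
apply: Ck_opp => //; apply: Ck_sum => // i _; apply: Ck_sum => // j _.
apply: Ck_mul => //; last exact: Ck_entry.
apply: Ck_mul => //; last exact: Ck_entry.
have fO : forall X, (fst @^-1` Om) X -> Om (fst (X : 'cV[R]_m * 'cV[R]_m)) by [].
exact: (Ck_comp (findim_cV m) (findim_R (R := R)) oU fO fstC (christoffel_Ck l i j n fV hm lp)).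
Qed.

Lemma geodesic_eq_field V met m (phi : 'cV[R]_m -> V) (J : set R) u t :
  open J -> J t -> smooth J u -> geodesic_eq met phi u t ->
  is_derive t (1 : R) (fun t => (u t, derive1 u t)) (geodesic_field met phi (u t, derive1 u t)).
Proof.
move=> oJ Jt us ge; apply: is_derive_pair; first exact: smooth_is_derive us Jt.
have := smooth_is_derive (smooth_derive1 us) Jt; congr is_derive.
apply/colP => l; rewrite mxE; apply/eqP; rewrite -addr_eq0; apply/eqP.
exact: ge l.
Qed.

(** Agreement of position and velocity propagates by [real_induction]: it passes to left limits by
    continuity, and to the right by uniqueness for the first-order system in a chart around the
    common point. The chart may change along the way. *)
Lemma geodesic_unique V (S : set V) met m J1 J2 (c1 c2 : R -> V) s : findim V ->
  metric_on S met -> submanifold m S ->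
  geodesic S met J1 c1 -> geodesic S met J2 c2 ->
  (forall t, 0 <= t <= s -> J1 t /\ J2 t) ->
  c1 0 = c2 0 -> derive1 c1 0 = derive1 c2 0 ->
  forall t, 0 <= t <= s -> c1 t = c2 t /\ derive1 c1 t = derive1 c2 t.
Proof.
move=> fV hm subS [oJ1 c1s c1S g1] [oJ2 c2s c2S g2] sJ E E'.
apply: real_induction => //.
  move=> t /andP[t0 ts] IH.
  have [|J1t J2t] := sJ t; first by rewrite (ltW t0).
  have lim_eq (W : normedModType R) (f g : R -> W) : {for t, continuous f} -> {for t, continuous g} ->
      (forall r, 0 <= r < t -> f r = g r) -> f t = g t.
    move=> fc gc fg; apply: (@cvg_unique _ _ (f x @[x --> t^'-])).
    - exact: norm_hausdorff.
    - by apply: cvg_at_left_filter.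
    - have gl : g x @[x --> t^'-] --> g t by exact: cvg_at_left_filter.
      apply: cvg_trans gl; apply: near_eq_cvg.
      near=> r; apply/esym/fg; apply/andP; split; last by near: r; exact: nbhs_left_lt.
      by near: r; exact: nbhs_left_ge.
  split.
    by apply: lim_eq => [||r /IH[]//]; [exact: smooth_cont c1s J1t|exact: smooth_cont c2s J2t].
  apply: lim_eq => [||r /IH[]//].
    exact: smooth_cont (smooth_derive1 c1s) J1t.
  exact: smooth_cont (smooth_derive1 c2s) J2t.
move=> t /andP[t0 ts] [Et Et'].
have [|J1t J2t] := sJ t; first by rewrite t0 ltW.
have [Om [phi [lp [u Ou phiu]]]] := subS (c1 t) (c1S t J1t).
have [K1 [v1 [oK1 K1t KJ1 v1s [v1t v1O v1c]]]] := chart_lift fV lp Ou oJ1 c1s J1t (esym phiu).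
have c2u : c2 t = phi u by rewrite -Et.
have [K2 [v2 [oK2 K2t KJ2 v2s [v2t v2O v2c]]]] := chart_lift fV lp Ou oJ2 c2s J2t c2u.
have h1 r : K1 r -> Om (v1 r) /\ phi (v1 r) = c1 r.
  by move=> Kr; split; [exact: v1O|apply: v1c => //; exact/c1S/KJ1].
have h2 r : K2 r -> Om (v2 r) /\ phi (v2 r) = c2 r.
  by move=> Kr; split; [exact: v2O|apply: v2c => //; exact/c2S/KJ2].
have vel1 := lift_velocity lp oK1 K1t v1s (smooth_sub KJ1 c1s) h1.
have vel2 := lift_velocity lp oK2 K2t v2s (smooth_sub KJ2 c2s) h2.
have Ev : derive1 v1 t = derive1 v2 t.
  by apply: (chart_diff_inj lp Ou); rewrite -{1}v1t vel1 -v2t vel2.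
pose K := K1 `&` K2.
have oK : open K by exact: openI.
have oU : open ((fst : 'cV[R]_m * 'cV[R]_m -> _) @^-1` Om).
  by apply: open_comp lp.1 => x _; exact: cvg_fst.
have hX r : K r -> (fst @^-1` Om) (v1 r, derive1 v1 r) /\
    is_derive r (1 : R) (fun t => (v1 t, derive1 v1 t)) (geodesic_field met phi (v1 r, derive1 v1 r)).
  move=> [K1r K2r]; split; first exact: v1O.
  exact: (geodesic_eq_field oK1 K1r v1s (g1 _ _ _ K1 v1 lp oK1 KJ1 v1s h1 r K1r)).
have hY r : K r -> (fst @^-1` Om) (v2 r, derive1 v2 r) /\
    is_derive r (1 : R) (fun t => (v2 t, derive1 v2 t)) (geodesic_field met phi (v2 r, derive1 v2 r)).
  move=> [K1r K2r]; split; first exact: v2O.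
  exact: (geodesic_eq_field oK2 K2r v2s (g2 _ _ _ K2 v2 lp oK2 KJ2 v2s h2 r K2r)).
have XY : (v1 t, derive1 v1 t) = (v2 t, derive1 v2 t) by rewrite v1t v2t Ev.
have [e e0 he] := ode_unique (findim_prod (findim_cV m) (findim_cV m)) oU
  (geodesic_field_Ck 1 fV hm lp) oK (conj K1t K2t) hX hY XY.
have /near_ball_norm[d d0 hd] := open_near oK (conj K1t K2t).
exists (Num.min e d); first by rewrite lt_min e0.
move=> r /andP[tr re] rs.
have Ec x : t <= x < t + Num.min e d -> c1 x = c2 x.
  move=> /andP[tx xe].
  have [K1x K2x] : K x.
    apply: hd; rewrite ger0_norm ?subr_ge0 // ltrBlDl (lt_le_trans xe) //.
    by rewrite lerD2l ge_min lexx orbT.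
  have [] : (v1 x, derive1 v1 x) = (v2 x, derive1 v2 x).
    by apply: he; rewrite tx (lt_le_trans xe) // lerD2l ge_min lexx.
  by move=> E12 _; rewrite -(h1 _ K1x).2 -(h2 _ K2x).2 E12.
split; first by apply: Ec; rewrite tr.
(* At [t] the velocities agree already; at [r > t] the two curves coincide on a whole neighbourhood,
   hence so do their derivatives. *)
have [->//|nrt] := eqVneq r t.
have tr' : t < r by rewrite lt_neqAle eq_sym nrt.
rewrite !derive1E; apply: near_eq_derive; near=> x; apply: Ec.
apply/andP; split; first by rewrite ltW //; near: x; exact: lt_nbhsr.
by near: x; exact: lt_nbhsl.
Unshelve. all: by end_near. Qed.

Lemma is_derive_rescale W (J : set R) (u : R -> W) (a r : R) :
  smooth J u -> J (a * r) ->
  is_derive r (1 : R) (fun r => u (a * r)) (a *: derive1 u (a * r)).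
Proof.
move=> us Jr; have du := smooth_diff us Jr.
have dl : is_derive r (1 : R) (fun r : R => a * r) (a : R).
  have := is_derive_line 0 a r; congr is_derive; apply/funext => x.
  by rewrite add0r mulrC.
have := is_derive_curve dl du; congr is_derive.
rewrite -[X in 'D_X _ _]mulr1 [X in 'D_X _ _](_ : _ = a *: (1 : R)) //.
by rewrite deriveE // linearZ /= -deriveE // -derive1E.
Qed.

Lemma derive1_rescale W (J : set R) (u : R -> W) (a r : R) :
  smooth J u -> J (a * r) -> derive1 (fun r => u (a * r)) r = a *: derive1 u (a * r).
Proof. by move=> us Jr; rewrite derive1E; have [_] := is_derive_rescale us Jr. Qed.

(** Rescaling by [a^-1] turns a coordinate curve of the new curve into one of [c], and both terms of
    the geodesic equation are multiplied by the same square. *)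
Lemma geodesic_rescale V (S : set V) met J (c : R -> V) a : findim V -> a != 0 ->
  geodesic S met J c -> geodesic S met [set r | J (a * r)] (fun r => c (a * r)).
Proof.
move=> fV a0 [oJ cs cS cg].
have mulc (b : R) : smooth setT (fun r : R => b * r).
  have := @smooth_line _ _ 0 b setT openT (@findim_R R).
  by congr smooth; apply/funext => r; rewrite add0r mulrC.
have opre b (K : set R) : open K -> open [set r : R | K (b * r)].
  move=> oK; have := open_smooth_preimage openT oK (mulc b).
  by rewrite setTI.
have sres (W : normedModType R) b (K : set R) (u : R -> W) : open K -> smooth K u ->
    findim W -> smooth [set r | K (b * r)] (fun r => u (b * r)).
  move=> oK us fW; apply: (@smooth_comp _ _ _ _ _ K) => //; first exact: findim_R.
    exact: opre.
  by apply: smooth_sub (mulc b).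
split.
- exact: opre.
- exact: sres.
- by move=> t; exact: cS.
move=> m Om phi J' u lp oJ' J'J us uc t Jt l.
have ba r : a^-1 * (a * r) = r by rewrite mulKf.
have ub : smooth [set r | J' (a^-1 * r)] (fun r => u (a^-1 * r)).
  by apply: sres => //; exact: findim_cV.
have sub : [set r | J' (a^-1 * r)] `<=` J.
  by move=> r /J'J /=; rewrite mulVKf.
have Jat : J' (a^-1 * (a * t)) by rewrite ba.
have := cg m Om phi [set r | J' (a^-1 * r)] (fun r => u (a^-1 * r)) lp (opre _ _ oJ') sub ub _ (a * t) Jat l.
have uc' r : J' (a^-1 * r) -> Om (u (a^-1 * r)) /\ phi (u (a^-1 * r)) = c r.
  by move=> /uc; rewrite mulVKf.
move=> /(_ uc'); rewrite /geodesic_eq /derive1n /=.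
rewrite (derive1_rescale us Jat) ba.
have -> : derive1 (derive1 (fun r => u (a^-1 * r))) (a * t) = (a^-1 * a^-1) *: derive1 (derive1 u) t.
  rewrite [LHS]derive1E (@near_eq_derive _ _ _ _ (fun r => a^-1 *: derive1 u (a^-1 * r))); last first.
    near=> r; apply: derive1_rescale us _.
    by near: r; exact: (open_near (opre _ _ oJ') Jat).
  have H := is_derive_rescale (smooth_derive1 us) Jat.
  have [_] := is_deriveZ a^-1 H.
  by rewrite ba scalerA; apply: etrans.
move=> H; apply: (mulfI (_ : a^-1 * a^-1 != 0)); first by rewrite mulf_neq0 ?invr_eq0.
rewrite mulr0; apply: etrans H; rewrite mulrDr; congr (_ + _); first by rewrite mxE.
rewrite mulr_sumr; apply: eq_bigr => i _; rewrite mulr_sumr; apply: eq_bigr => j _.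
have sE k : (a^-1 *: derive1 u t) k 0 = a^-1 * derive1 u t k 0 by rewrite mxE.
by rewrite !sE; ring.
Unshelve. all: by end_near. Qed.

(** Covers the factor 0, which [geodesic_rescale] excludes. *)
Lemma geodesic_cst V (S : set V) met w : S w -> geodesic S met setT (fun _ : R => w).
Proof.
move=> Sw; split => [||//|]; first exact: openT.
  by move=> j; exact: Ck_cst.
move=> m Om phi J' u lp oJ' _ us uc t Jt l.
have uE r : J' r -> u r = u t.
  by move=> Jr; have [Or pr] := uc r Jr; have [Ot pt] := uc t Jt;
    apply: (chart_inj lp Or Ot); rewrite pr pt.
have d1 r : J' r -> derive1 u r = 0.
  move=> Jr; rewrite derive1E (@near_eq_derive _ _ _ _ (cst (u t))) ?derive_cst //.
  by apply: filterS (open_near oJ' Jr) => x; exact: uE.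
have d2 : derive1 (derive1 u) t = 0.
  rewrite [LHS]derive1E (@near_eq_derive _ _ _ _ (cst 0)) ?derive_cst //.
  by apply: filterS (open_near oJ' Jt) => x; exact: d1.
rewrite /derive1n /= d2 mxE add0r big1 // => i _; rewrite big1 // => j _.
have z k : (0 : 'cV[R]_m) k 0 = 0 by rewrite mxE.
by rewrite (d1 t Jt) !z mulr0.
Qed.

(* Rescaling a geodesic issued from [w] with velocity [D] gives the geodesic with
   velocity [t *: D], so by uniqueness the choice made in [Exp] follows [c]. *)
Lemma Exp_radial V (S : set V) met m J (c : R -> V) D t : findim V ->
  metric_on S met -> submanifold m S -> geodesic S met J c -> `[0, 1] `<=` J ->
  derive1 c 0 = D -> 0 <= t <= 1 -> Exp S met (c 0) (t *: D) = c t.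
Proof.
move=> fV hm subS cg J01 c'0 t01.
have J0 : J 0 by apply: J01; rewrite /= in_itv /= lexx ler01.
have Jt : J t by apply: J01; rewrite /= in_itv.
have [oJ cs cS _] := cg.
have ug J1 c1 J2 c2 : geodesic S met J1 c1 -> geodesic S met J2 c2 ->
    `[0, 1] `<=` J1 -> `[0, 1] `<=` J2 -> c1 0 = c2 0 -> derive1 c1 0 = derive1 c2 0 -> c1 1 = c2 1.
  move=> g1 g2 j1 j2 e0 e1.
  have j12 r : 0 <= r <= 1 -> J1 r /\ J2 r by move=> r01; split; [apply: j1|apply: j2]; rewrite /= in_itv.
  have [|-> //] := geodesic_unique fV hm subS g1 g2 j12 e0 e1 (t := 1).
  by rewrite lexx ler01.
have [J1 [c1 [g1 j1 c10 c1' c11]]] : exists J1 c1, [/\ geodesic S met J1 c1, `[0, 1] `<=` J1,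
    c1 0 = c 0, derive1 c1 0 = t *: D & c1 1 = c t].
  have [->|t0] := eqVneq t 0.
    exists setT, (fun=> c 0); split => //; first exact/geodesic_cst/cS.
    by rewrite scale0r derive1_cst.
  exists [set r | J (t * r)], (fun r => c (t * r)); split.
  - exact: geodesic_rescale.
  - move=> r; rewrite /= in_itv /= => /andP[r0 r1]; move: t01 => /andP[t0' t1].
    by apply: J01; rewrite /= in_itv /= mulr_ge0 //= mulr_ile1.
  - by rewrite mulr0.
  - by rewrite (derive1_rescale cs) ?mulr0 ?c'0.
  - by rewrite mulr1.
apply: xget_unique; first by exists J1, c1.
move=> y [J2 [c2 [g2 j2 c20 c2' <-]]]; rewrite -c11.
by apply: (ug _ _ _ _ g2 g1) => //; rewrite ?c20 ?c2' ?c10 ?c1'.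
Qed.

End Geodesics.

(** * The Gauss lemma *)

Section Gauss.
Context {R : realType}.
Implicit Types V W : normedModType R.

Lemma eq_right_limit W (f g : R -> W) (a b : R) : a < b -> {for a, continuous f} ->
  {for a, continuous g} -> (forall r, a < r < b -> f r = g r) -> f a = g a.
Proof.
move=> ab fc gc fg; apply: (@cvg_unique _ _ (f x @[x --> a^'+])).
- exact: norm_hausdorff.
- by apply: cvg_at_right_filter.
- have gl : g x @[x --> a^'+] --> g a by exact: cvg_at_right_filter.
  apply: cvg_trans gl; apply: near_eq_cvg.
  near=> r; apply/esym/fg; apply/andP; split; near: r; first exact: nbhs_right_gt.
  exact: nbhs_right_lt.
Unshelve. all: by end_near. Qed.

Definition sqnorm m (u : 'cV[R]_m) : R := \sum_i u i 0 ^+ 2.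

Lemma fnorm_sqr m (u : 'cV[R]_m) : fnorm u ^+ 2 = sqnorm u.
Proof.
have E : inner u u = sqnorm u.
  rewrite /inner /mxtrace big_ord1 mxE; apply: eq_bigr => i _.
  by rewrite mxE expr2.
by rewrite sqr_sqrtr E // sumr_ge0 // => i _; exact: sqr_ge0.
Qed.

Lemma fnormE m (u : 'cV[R]_m) : fnorm u = Num.sqrt (sqnorm u).
Proof. by rewrite -fnorm_sqr sqrtr_sqr ger0_norm // sqrtr_ge0. Qed.

Lemma fnorm_ge0 m n (A : 'M[R]_(m, n)) : 0 <= fnorm A.
Proof. exact: sqrtr_ge0. Qed.

Lemma fnorm_lt m (u : 'cV[R]_m) r : 0 < r -> (fnorm u < r) = (sqnorm u < r ^+ 2).
Proof. by move=> r0; rewrite -fnorm_sqr ltr_pXn2r ?nnegrE ?fnorm_ge0 // ltW. Qed.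

Lemma fnormZ_cV m a (u : 'cV[R]_m) : fnorm (a *: u) = `|a| * fnorm u.
Proof.
rewrite !fnormE -sqrtr_sqr -sqrtrM ?sqr_ge0 //; congr Num.sqrt.
by rewrite /sqnorm mulr_sumr; apply: eq_bigr => i _; rewrite mxE exprMn.
Qed.

Lemma sqnorm_Ck m n : Ck n setT (@sqnorm m).
Proof.
apply: Ck_sum => [|i _]; first exact: openT.
rewrite (_ : (fun x : 'cV[R]_m => _) = fun x => x i 0 * x i 0); last first.
  by apply/funext => x; rewrite expr2.
by apply: Ck_mul; [exact: openT|apply: Ck_entry; [exact: openT|exact: Ck_id]..].
Qed.

Lemma open_fball m (r : R) : 0 < r -> open [set u : 'cV[R]_m | fnorm u < r].
Proof.
move=> r0; rewrite (_ : [set u | _] = setT `&` @sqnorm m @^-1` [set x | x < r ^+ 2]).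
  apply: open_smooth_preimage; [exact: openT|exact: open_lt|].
  by move=> n; exact: sqnorm_Ck.
by apply/seteqP; split => u /=; rewrite fnorm_lt // => -[].
Qed.

Lemma MVT_const (h dh : R -> R) : (forall t : R, 0 <= t <= 1 -> is_derive t (1 : R) h (dh t)) ->
  (forall t : R, 0 < t < 1 -> dh t = 0) -> h 1 = h 0.
Proof.
move=> hd h0.
have hc : {within `[0, 1], continuous h}.
  by apply: derivable_within_continuous => t; rewrite in_itv /= => /hd[].
have hd' (t : R) : t \in `]0, 1[ -> is_derive t (1 : R) h (dh t).
  by rewrite in_itv /= => /andP[a b]; apply: hd; rewrite !ltW.
have [c] := MVT ltr01 hd' hc.
by rewrite in_itv /= => /h0 -> ; rewrite mul0r => /eqP; rewrite subr_eq0 => /eqP.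
Qed.

(** * The Gauss lemma for a metric matrix whose rays through 0 are geodesics *)

Section RadialGeodesics.
Variables (m : nat) (r1 : R) (g : 'cV[R]_m -> 'M[R]_m).
Let Om := [set u : 'cV[R]_m | fnorm u < r1].
Let dg (x : 'cV[R]_m) (p i j : 'I_m) : R := 'D_(basis_vec R p) (fun v => g v i j) x.
Hypothesis r10 : 0 < r1.
Hypothesis gs : forall i j, smooth Om (fun u => g u i j).
Hypothesis g0 : forall i j, g 0 i j = (i == j)%:R.
Hypothesis gsym : forall u i j, g u i j = g u j i.
(** Twice the Christoffel symbols of the first kind, contracted twice with [x]: the geodesic
    equation of the ray through [x], with its index lowered. *)
Hypothesis radial : forall x p, Om x ->
  \sum_i \sum_j (dg x i p j + dg x j p i - dg x p i j) * x i 0 * x j 0 = 0.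

Let oOm : open Om. Proof. exact: open_fball. Qed.

Let gdiff i j x : Om x -> differentiable (fun u => g u i j) x.
Proof. by move=> Ox; exact: smooth_diff (gs i j) Ox. Qed.

Let D_dg x i j (y : 'cV[R]_m) : Om x ->
  'D_y (fun v => g v i j) x = \sum_p dg x p i j * y p 0.
Proof.
move=> Ox; rewrite derive_basis; last exact: gdiff.
by apply: eq_bigr => p _; rewrite /GRing.scale /= mulrC.
Qed.

(** The first two terms of [radial] become equal after exchanging the summation indices. *)
Let radial2 x p : Om x ->
  2 * \sum_j 'D_x (fun v => g v p j) x * x j 0 = \sum_i \sum_j dg x p i j * x i 0 * x j 0.
Proof.
move=> Ox; have /eqP := radial p Ox.
rewrite (eq_bigr (fun i => \sum_j (dg x i p j * x i 0 * x j 0) +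
   \sum_j (dg x j p i * x i 0 * x j 0) - \sum_j dg x p i j * x i 0 * x j 0)); last first.
  move=> i _; rewrite -big_split -sumrB; apply: eq_bigr => j _ /=; ring.
rewrite sumrB big_split /= [X in _ + X - _]exchange_big /= subr_eq0 => /eqP <-.
have E : \sum_j 'D_x (fun v => g v p j) x * x j 0 = \sum_i \sum_j dg x i p j * x i 0 * x j 0.
  by rewrite exchange_big; apply: eq_bigr => j _; rewrite D_dg // mulr_suml.
rewrite E mulrDl mul1r; congr (_ + _); apply: eq_bigr => i _; apply: eq_bigr => j _; ring.
Qed.

(** Contracting [radial2] with [x] makes its left side twice the sum in question and its right side
    the sum itself. *)
Let radial3 x : Om x ->
  \sum_i \sum_j 'D_x (fun v => g v i j) x * x i 0 * x j 0 = 0.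
Proof.
move=> Ox; set s := LHS.
have E1 : \sum_p (2 * \sum_j 'D_x (fun v => g v p j) x * x j 0) * x p 0 = 2 * s.
  rewrite /s mulr_sumr; apply: eq_bigr => p _; rewrite -mulrA; congr (_ * _).
  by rewrite mulr_suml; apply: eq_bigr => j _; ring.
have E2 : \sum_p (2 * \sum_j 'D_x (fun v => g v p j) x * x j 0) * x p 0 = s.
  rewrite (eq_bigr (fun p => \sum_i \sum_j dg x p i j * x p 0 * x i 0 * x j 0)); last first.
    move=> p _; rewrite radial2 // mulr_suml; apply: eq_bigr => i _.
    by rewrite mulr_suml; apply: eq_bigr => j _; ring.
  rewrite exchange_big /=; apply: eq_bigr => i _; rewrite exchange_big /=.
  by apply: eq_bigr => j _; rewrite D_dg // !mulr_suml.
by have := E1; rewrite E2; lra.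
Qed.

Let Om_scale x t : Om x -> 0 <= t <= 1 -> Om (t *: x).
Proof.
move=> Ox /andP[t0 t1]; rewrite /Om /= fnormZ_cV ger0_norm // (le_lt_trans _ Ox) //.
by rewrite ler_piMl // fnorm_ge0.
Qed.

Let dg_line i j u (t : R) : Om u -> 0 <= t <= 1 ->
  is_derive t (1 : R) (fun t => g (t *: u) i j) ('D_u (fun v => g v i j) (t *: u)).
Proof.
move=> Ou t01; have := is_derive_line 0 u t.
have -> : (fun s : R => 0 + s *: u) = (fun s => s *: u) by apply/funext => s; rewrite add0r.
by move=> dl; apply: (is_derive_curve dl (g := fun v => g v i j)); exact/gdiff/Om_scale.
Qed.

(** By [radial3] the form [g (t x)] evaluated on [x] is constant in [t], and at [t = 0] the matrix
    is the identity. *)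
Lemma radial_speed x : Om x -> \sum_i \sum_j g x i j * x i 0 * x j 0 = sqnorm x.
Proof.
move=> Ox.
pose h t := \sum_i \sum_j g (t *: x) i j * x i 0 * x j 0.
suff : h 1 = h 0.
  rewrite /h scale1r scale0r => ->; apply: eq_bigr => i _.
  rewrite (bigD1 i) //= big1 => [|j ji]; first by rewrite g0 eqxx addr0 mul1r expr2.
  by rewrite g0 eq_sym (negPf ji) !mul0r.
apply: (@MVT_const h (fun t => \sum_i \sum_j 'D_x (fun v => g v i j) (t *: x) * x i 0 * x j 0)).
  move=> t t01; apply: is_derive_bigsum => i; apply: is_derive_bigsum => j.
  have := dg_line i j Ox t01 => H.
  apply: is_derive_eq.
  by rewrite /GRing.scale /=; ring.
move=> t /andP[t0 t1]; have Otx : Om (t *: x) by apply: Om_scale => //; rewrite !ltW.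
have := radial3 Otx => E.
(* [radial3] at [t *: x] contains [x] three times, once as the direction of derivation; hence the
   factor [t ^+ 3]. *)
apply: (mulfI (_ : t ^+ 3 != 0)); first by rewrite expf_neq0 // gt_eqF.
rewrite mulr0; apply: etrans E; rewrite mulr_sumr; apply: eq_bigr => i _.
rewrite mulr_sumr; apply: eq_bigr => j _.
have -> : 'D_(t *: x) (fun v => g v i j) (t *: x) = t * 'D_x (fun v => g v i j) (t *: x).
  by rewrite deriveE ?linearZ /= -?deriveE //; exact: gdiff.
by rewrite [(t *: x) i 0]mxE [(t *: x) j 0]mxE; ring.
Qed.

(** The partial derivative of index [p] of both sides of [radial_speed]. *)
Let speed_derive x p : Om x ->
  \sum_i \sum_j dg x p i j * x i 0 * x j 0 + 2 * \sum_j g x p j * x j 0 = 2 * x p 0.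
Proof.
move=> Ox; pose e := basis_vec R p.
have dl k : is_derive 0 (1 : R) (fun s : R => (x + s *: e) k 0) ((k == p)%:R : R).
  have -> : (fun s : R => (x + s *: e) k 0) = fun s => x k 0 + s *: ((k == p)%:R : R).
    by apply/funext => s; rewrite !mxE eqxx andbT.
  exact: is_derive_line.
have H1 : is_derive 0 (1 : R) (fun s : R => \sum_i \sum_j g (x + s *: e) i j * (x + s *: e) i 0 * (x + s *: e) j 0)
   (\sum_i \sum_j (dg x p i j * x i 0 * x j 0 + g x i j * (i == p)%:R * x j 0 + g x i j * x i 0 * (j == p)%:R)).
  apply: is_derive_bigsum => i; apply: is_derive_bigsum => j.
  have d1 := is_derive_dir e (gdiff i j Ox); have d2 := dl i; have d3 := dl j.
  apply: is_derive_eq.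
  by rewrite !scale0r !addr0 /dg -/e /GRing.scale /=; ring.
have H2 : is_derive 0 (1 : R) (fun s : R => sqnorm (x + s *: e)) (2 * x p 0).
  have -> : 2 * x p 0 = \sum_i 2 * x i 0 * (i == p)%:R.
    rewrite (bigD1 p) //= big1 => [|i /negPf ->]; last by rewrite mulr0.
    by rewrite eqxx addr0 mulr1.
  apply: is_derive_bigsum => i; have d2 := dl i.
  apply: is_derive_eq.
  by rewrite !scale0r !addr0 /GRing.scale /=; ring.
have <- : \sum_i \sum_j (dg x p i j * x i 0 * x j 0 + g x i j * (i == p)%:R * x j 0 + g x i j * x i 0 * (j == p)%:R)
    = 2 * x p 0.
  apply: is_derive_unique H1 _; apply: near_eq_is_derive H2.
  have : \forall s \near (0 : R), Om (x + s *: e).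
    have := smooth_cont (smooth_line x e openT (findim_cV m)) (I : setT (0 : R)).
    apply; rewrite scale0r addr0; exact: (open_near oOm Ox).
  by apply: filterS => s Os; rewrite radial_speed.
rewrite [RHS](eq_bigr (fun i => \sum_j dg x p i j * x i 0 * x j 0 +
  \sum_j g x i j * (i == p)%:R * x j 0 + \sum_j g x i j * x i 0 * (j == p)%:R)); last first.
  by move=> i _; rewrite big_split /= big_split.
rewrite [RHS]big_split /= [X in _ = X + _]big_split /= -addrA; congr (_ + _).
rewrite mulrDl mul1r; congr (_ + _).
  rewrite [RHS](bigD1 p) //= [X in _ = _ + X]big1 ?addr0 => [|i /negPf ->].
    by apply: eq_bigr => j _; rewrite eqxx mulr1.
  by rewrite big1 // => j _; rewrite mulr0 mul0r.
apply: eq_bigr => i _; rewrite (bigD1 p) //= big1 ?addr0 => [|j /negPf ->]; last by rewrite mulr0.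
by rewrite eqxx mulr1 gsym.
Qed.

(* The function [t |-> t * (g (t x) x - x)] is constant: by [radial2] and [speed_derive]
   its derivative vanishes. *)
Lemma gauss x p : Om x -> \sum_j g x p j * x j 0 = x p 0.
Proof.
move=> Ox; apply/eqP; rewrite -subr_eq0; apply/eqP.
pose h t := (\sum_j g (t *: x) p j * x j 0 - x p 0) * t.
suff : h 1 = h 0 by rewrite /h scale1r mulr1 mulr0.
apply: (@MVT_const h (fun t => (\sum_j 'D_x (fun v => g v p j) (t *: x) * x j 0) * t +
   (\sum_j g (t *: x) p j * x j 0 - x p 0))).
  move=> t t01.
  have H : is_derive t (1 : R) (fun t => \sum_j g (t *: x) p j * x j 0 - x p 0)
      (\sum_j 'D_x (fun v => g v p j) (t *: x) * x j 0).
    have H : is_derive t (1 : R) (fun t => \sum_j g (t *: x) p j * x j 0)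
      (\sum_j 'D_x (fun v => g v p j) (t *: x) * x j 0).
      apply: is_derive_bigsum => j; have := dg_line p j Ox t01 => H.
      apply: is_derive_eq.
      by rewrite /GRing.scale /=; ring.
    apply: is_derive_eq.
    by rewrite subr0.
  apply: is_derive_eq.
  by rewrite /GRing.scale /=; ring.
move=> t /andP[t0 t1]; have Otx : Om (t *: x) by apply: Om_scale => //; rewrite !ltW.
have E1 := radial2 p Otx; have E2 := speed_derive p Otx.
rewrite -E1 in E2.
have {}E2 : \sum_j 'D_(t *: x) (fun v => g v p j) (t *: x) * (t *: x) j 0 +
  \sum_j g (t *: x) p j * (t *: x) j 0 = (t *: x) p 0 by lra.
apply: (mulfI (_ : t != 0)); first by rewrite gt_eqF.
rewrite mulr0 mulr_suml mulrDr mulrBr !mulr_sumr.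
have -> : t * x p 0 = (t *: x) p 0 by rewrite mxE.
apply/eqP; rewrite addrA subr_eq0 -E2; apply/eqP; congr (_ + _); apply: eq_bigr => j _.
  rewrite [X in _ = X * _](_ : _ = t * 'D_x (fun v => g v p j) (t *: x)).
    by rewrite [(t *: x) j 0]mxE; ring.
  by rewrite deriveE ?linearZ /= -?deriveE //; exact: gdiff.
by rewrite [(t *: x) j 0]mxE; ring.
Qed.

End RadialGeodesics.
End Gauss.

(** * Square roots of positive functions *)

Section Sqrt.
Context {R : realType}.
Implicit Types V W : normedModType R.

Lemma is_derive_sqrt_comp V (a : V -> R) x v : differentiable a x -> 0 < a x ->
  differentiable (fun x => Num.sqrt (a x)) x /\
  'D_v (fun x => Num.sqrt (a x)) x = 'D_v a x * (2 * Num.sqrt (a x))^-1.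
Proof.
move=> da a0; have [sd sE] := is_derive1_sqrt a0.
have ds : differentiable Num.sqrt (a x) by apply/derivable1_diffP.
split; first exact: (differentiable_comp da ds).
rewrite (derive_comp v da ds) -[X in 'D_X _ _]mulr1 [X in 'D_X _ _](_ : _ = 'D_v a x *: (1 : R)) //.
by rewrite deriveE // linearZ /= -deriveE // sE.
Qed.

Lemma Ck_sqrt V j (U : set V) (a : V -> R) : open U -> (forall x, U x -> 0 < a x) ->
  Ck j U a -> Ck j U (fun x => Num.sqrt (a x)).
Proof.
move=> oU a0; elim: j a a0 => [|j IH] a a0.
  move=> aC x Ux; apply: continuous_comp; first exact: aC.
  exact: sqrt_continuous.
move=> aC; have [ad aD] := aC.
split=> [x Ux|v]; first by have [] := is_derive_sqrt_comp 0 (ad x Ux) (a0 x Ux).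
apply: (derive_eqP (df := fun x => 'D_v a x * (2 * Num.sqrt (a x))^-1)) => //.
  by move=> x Ux; have [_] := is_derive_sqrt_comp v (ad x Ux) (a0 x Ux).
apply: Ck_mul => //; first exact: aD.
apply: Ck_inv => // [x Ux|]; first by rewrite mulf_neq0 // gt_eqF // sqrtr_gt0 a0.
by apply: Ck_mul => //; [exact: Ck_cst|apply: IH => //; exact: Ck_pred].
Qed.

End Sqrt.

(** * Integrals over intervals and the fundamental theorem as an inequality *)

Section IntervalIntegrals.
Context {R : realType}.
Notation mu := (@lebesgue_measure R).

Lemma ge0_integral_split (f : R -> \bar R) (a b t r : R) : (forall x, (0 <= f x)%E) ->
  measurable_fun `[a, b] f -> a <= t -> t <= r -> r <= b ->
  (\int[mu]_(x in `[a, r]) f x =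
   \int[mu]_(x in `[a, t]) f x + \int[mu]_(x in `]t, r[) f x)%E.
Proof.
move=> f0 mf t0 tr r1.
have sub0 : `[a, r] `<=` `[a, b].
  by move=> x; rewrite /= !in_itv /= => /andP[-> xr]; rewrite (le_trans xr).
have E : `[a, r]%classic = `[a, t]%classic `|` `]t, r]%classic :> set R.
  by rewrite (@itv_bndbnd_setU _ _ _ (BRight t)) // bnd_simp.
have mf' : measurable_fun `[a, r] f by apply: measurable_funS mf.
rewrite {1}E ge0_integral_setU //; last first.
  apply/disj_set2P; apply/seteqP; split => // x /=; rewrite !in_itv /= => -[/andP[_ xt] /andP[tx _]].
  by move: xt; rewrite leNgt tx.
  by rewrite -E.
congr (_ + _)%E; rewrite integral_itv_bndoo //.
apply: measurable_funS mf => // x; rewrite /= !in_itv /= => /andP[tx xr].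
by rewrite (le_trans t0 (ltW tx)) (le_trans (ltW xr)).
Qed.

(** Only measurability of [s] is assumed. An infinite integral makes the bound trivial; otherwise
    [s] is integrable and dominates the continuous derivative of [F]. *)
Lemma FTC_le_integral (J : set R) (F s : R -> R) (t r : R) : t < r -> open J ->
  (forall x, t <= x <= r -> J x) -> smooth J F -> (forall x, 0 <= s x) ->
  measurable_fun `]t, r[ (fun x => (s x)%:E) ->
  (forall x, t < x < r -> derive1 F x <= s x) ->
  ((F r - F t)%:E <= \int[mu]_(x in `]t, r[) (s x)%:E)%E.
Proof.
move=> tr oJ Jtr Fs s0 ms Fle.
have F's := smooth_derive1 Fs.
have cF' : {within `[t, r], continuous (derive1 F)}.
  apply: continuous_in_subspaceT => x; rewrite inE /= in_itv /= => /Jtr Jx.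
  exact: smooth_cont F's Jx.
have cFx x : t <= x <= r -> {for x, continuous F} by move=> /Jtr; exact: smooth_cont.
have dF x : t <= x <= r -> derivable F x 1.
  by move=> /Jtr Jx; apply/derivable1_diffP; exact: smooth_diff Fs Jx.
have LR : derivable_oo_LRcontinuous F t r.
  split.
  - by move=> x; rewrite in_itv /= => /andP[a b]; apply: dF; rewrite !ltW.
  - by apply: cvg_at_right_filter; apply: cFx; rewrite lexx ltW.
  - by apply: cvg_at_left_filter; apply: cFx; rewrite lexx andbT ltW.
have FTC : (\int[mu]_(x in `]t, r[) (derive1 F x)%:E = (F r - F t)%:E)%E.
  rewrite -(@integral_itv_bndoo _ _ _ _ true false); last first.
    apply/measurable_EFinP; apply: measurable_funS (subspace_continuous_measurable_fun _ cF') => //.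
    exact: subset_itv_oo_cc.
  by rewrite EFinB; apply: continuous_FTC2.
rewrite -FTC; have [->|fin] := eqVneq (\int[mu]_(x in `]t, r[) (s x)%:E)%E +oo%E.
  by rewrite leey.
have int1 : mu.-integrable `[t, r] (EFin \o derive1 F).
  by apply: continuous_compact_integrable => //; exact: segment_compact.
apply: le_integral => //.
- by apply: (integrableS _ _ _ int1) => //; exact: subset_itv_oo_cc.
- apply/integrableP; split; first exact: ms.
  have <- : (\int[mu]_(x in `]t, r[) (s x)%:E = \int[mu]_(x in `]t, r[) `|(s x)%:E|)%E.
    by apply: eq_integral => x _; rewrite gee0_abs // lee_fin.
  by rewrite ltey.
by move=> x; rewrite inE /= in_itv /= lee_fin => /Fle.
Qed.

End IntervalIntegrals.

Lemma compact_fball (R : realType) p (rho : R) : compact [set v : 'cV[R]_p | fnorm v <= rho].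
Proof.
have [r0|r0] := ltP rho 0.
  rewrite (_ : [set v | _] = set0); first exact: compact0.
  by apply/seteqP; split => // v /=; rewrite leNgt (lt_le_trans r0) // fnorm_ge0.
have fcont : continuous (@sqnorm R p) by move=> v; exact: (@sqnorm_Ck R p 0).
have tcont m n : continuous (@trmx R m n).
  have : Ck 0 setT (@trmx R m n).
    by apply: Ck_trmx; [exact: openT|exact: Ck_id].
  by move=> h v; exact: h.
pose K := [set v : 'rV[R]_p | sqnorm v^T <= rho ^+ 2].
have KE : [set v : 'cV[R]_p | fnorm v <= rho] = trmx @` K.
  have fE (v : 'cV[R]_p) : (fnorm v <= rho) = (sqnorm v <= rho ^+ 2).
    by rewrite -fnorm_sqr ler_pXn2r ?nnegrE ?fnorm_ge0.
  apply/seteqP; split => v /=.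
    by rewrite fE => h; exists v^T; rewrite /K /= trmxK.
  by move=> [u + <-]; rewrite /K /= fE.
rewrite KE; apply: continuous_compact; first exact/continuous_subspaceT/tcont.
apply: bounded_closed_compact.
  exists rho; split; first exact: num_real.
  move=> M rM v Kv /=; rewrite [leLHS]/Num.Def.normr /= mx_normrE; apply: bigmax_le.
    by rewrite (le_trans r0) // ltW.
  move=> [i j] _ /=; apply: le_trans (ltW rM).
  rewrite -(ler_pXn2r (n := 2)) ?nnegrE // real_normK ?num_real //; apply: le_trans Kv.
  by rewrite /sqnorm (bigD1 j) //= mxE ord1 lerDl sumr_ge0 // => k _; exact: sqr_ge0.
have -> : K = (fun v : 'rV[R]_p => sqnorm v^T) @^-1` [set x | x <= rho ^+ 2] by [].
apply: closed_comp; last exact: closed_le.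
by move=> v _; apply: continuous_comp; [exact: tcont|exact: fcont].
Qed.

(** * Normal coordinates and distance *)

Section NormalChart.
Context {R : realType} {V : normedModType R}.
Variables (S : set V) (met : V -> V -> V -> R) (m : nat) (w : V) (p : nat) (b : 'I_p -> V) (r1 : R).
Hypothesis fV : findim V.
Hypothesis hm : metric_on S met.
Hypothesis subS : submanifold m S.
Hypothesis Sw : S w.
Hypothesis bT : forall u : 'cV[R]_p, tangent S w (\sum_i u i 0 *: b i).
Hypothesis bO : forall i j, met w (b i) (b j) = (i == j)%:R.
Hypothesis bC : forall D, tangent S w D -> D = \sum_i met w D (b i) *: b i.
Hypothesis r10 : 0 < r1.
Hypothesis Edef : forall D, tangent S w D -> met_norm met w D < r1 -> exp_graph S met w D !=set0.
Hypothesis Ediff : diffeo_into S [set D | tangent S w D /\ met_norm met w D < r1] (Exp S met w).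

(** Linear isometry from coordinates onto the tangent space at [w]. The size [p] of the orthonormal
    basis is kept apart from the dimension [m]; parametrizations and the geodesic equation allow
    charts of any size. *)
Definition tframe (u : 'cV[R]_p) : V := \sum_i u i 0 *: b i.
Definition tcoord (D : V) : 'cV[R]_p := \col_i met w D (b i).
Definition normal_chart (u : 'cV[R]_p) : V := Exp S met w (tframe u).
Definition normal_ball : set 'cV[R]_p := [set u | fnorm u < r1].

Lemma tcoordK D : tangent S w D -> tframe (tcoord D) = D.
Proof. by move=> TD; rewrite {2}(bC TD); apply: eq_bigr => i _; rewrite mxE. Qed.

Lemma tframeK u : tcoord (tframe u) = u.
Proof.
apply/colP => i; rewrite mxE (met_suml _ _ _ _ hm) (bigD1 i) //= big1 => [|j ji].
  by rewrite bO eqxx mulr1 addr0.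
by rewrite bO (negPf ji) mulr0.
Qed.

Lemma met_norm_tframe u : met_norm met w (tframe u) = fnorm u.
Proof.
have [_ ms _ _ _] := hm.
rewrite fnormE; congr Num.sqrt; rewrite (met_suml _ _ _ _ hm); apply: eq_bigr => i _.
rewrite ms (met_suml _ _ _ _ hm) (bigD1 i) //= big1 => [|j ji].
  by rewrite bO eqxx mulr1 addr0 expr2.
by rewrite bO (negPf ji) mulr0.
Qed.

Lemma tframeZ a u : tframe (a *: u) = a *: tframe u.
Proof. by rewrite /tframe scaler_sumr; apply: eq_bigr => i _; rewrite mxE scalerA. Qed.

Lemma normal_ball_image : normal_chart @` normal_ball =
  Exp S met w @` [set D | tangent S w D /\ met_norm met w D < r1].
Proof.
apply/seteqP; split => y /=.
  by move=> [u Ou <-]; exists (tframe u) => //; split; [exact: bT|rewrite met_norm_tframe].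
move=> [D [TD nD] <-]; exists (tcoord D); last by rewrite /normal_chart tcoordK.
by rewrite /normal_ball /= -met_norm_tframe tcoordK.
Qed.

Lemma smooth_tframe : smooth setT tframe.
Proof.
move=> j; apply: Ck_sum => [|i _]; first exact: openT.
by apply: Ck_scalel; [exact: openT|apply: Ck_entry; [exact: openT|exact: Ck_id]].
Qed.

Lemma smooth_tcoord : smooth setT tcoord.
Proof.
move=> j; have [I [e [l [lc le]]]] := fV.
apply: Ck_mxP => [|i k]; first exact: openT.
rewrite (_ : (fun x => _) = fun D => \sum_a (l a D : R) * met w (e a) (b i)); last first.
  by apply/funext => D; rewrite mxE {1}(le D) (met_suml _ _ _ _ hm).
apply: Ck_sum => [|a _]; first exact: openT.
by apply: Ck_mul; [exact: openT|exact: (@Ck_lin _ _ _ j setT (l a))|exact: Ck_cst].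
Qed.

Lemma normal_chartP : local_param S normal_ball normal_chart.
Proof.
split; first exact: open_fball.
have [Es Eo [g gs gK]] := Ediff.
split.
- move=> u Ou; have Au : [set D | tangent S w D /\ met_norm met w D < r1] (tframe u).
    by split; [exact: bT|rewrite met_norm_tframe].
  have [U [h [oU Uu hs hE]]] := Es _ Au.
  exists (setT `&` tframe @^-1` U), (fun v => h (tframe v)); split => //.
  + apply: open_smooth_preimage => //; [exact: openT|exact: smooth_tframe].
  + apply: (@smooth_comp _ _ _ _ _ U) => //.
      by apply: open_smooth_preimage => //; [exact: openT|exact: smooth_tframe].
    by move=> x [].
    by apply: smooth_sub smooth_tframe.
  + move=> v Ov [_ Uv]; apply: hE => //.
    by split; [exact: bT|rewrite met_norm_tframe].
- by rewrite normal_ball_image.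
exists (fun y => tcoord (g y)); last first.
  move=> u Ou; rewrite /normal_chart gK ?tframeK //.
  by split; [exact: bT|rewrite met_norm_tframe].
rewrite normal_ball_image => y yE; have [U [h [oU Uy hs hE]]] := gs y yE.
exists U, (fun z => tcoord (h z)); split => //.
  apply: (smooth_comp fV (findim_cV p) oU _ hs smooth_tcoord) => //.
by move=> z zE Uz; rewrite hE.
Qed.

(** By [Exp_radial] the geodesic that defines the exponential of [tframe u] follows the image of the
    segment from 0 to [u]. *)
Lemma radial_witness u : normal_ball u -> exists (J : set R) (c : R -> V),
  [/\ geodesic S met J c, `[0, 1] `<=` J, derive1 c 0 = tframe u, c 0 = w &
      forall t : R, 0 <= t <= 1 -> c t = normal_chart (t *: u)].
Proof.
move=> Ou; have [|w' [J [c [cg J01 c0 c'0 c1]]]] := Edef (bT u).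
  by rewrite -/(tframe u) met_norm_tframe.
exists J, c; split => // t t01.
by rewrite /normal_chart tframeZ -c0; apply/esym/(Exp_radial fV hm subS cg J01 c'0 t01).
Qed.

Lemma normal_ball0 : normal_ball 0.
Proof.
rewrite /normal_ball /= fnormE /sqnorm big1 ?sqrtr0 // => i _.
by rewrite mxE expr0n.
Qed.

Lemma normal_chart0 : normal_chart 0 = w.
Proof.
have [J [c [_ _ _ <- cE]]] := radial_witness normal_ball0.
by rewrite -[0 in LHS](scale0r 0) -cE // lexx ler01.
Qed.

Lemma normal_ball_scale u : exists2 a : R, 0 < a & normal_ball (a *: u).
Proof.
pose a := r1 / (1 + fnorm u).
have f0 : 0 < 1 + fnorm u by rewrite ltr_pwDl // fnorm_ge0.
have a0 : 0 < a by rewrite divr_gt0.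
exists a => //; rewrite /normal_ball /= fnormZ_cV gtr0_norm // /a mulrAC ltr_pdivrMr //.
by rewrite ltr_pM2l // ltrDr.
Qed.

(** The differential of the exponential map at 0 is the identity. The geodesic matches the image of
    the ray only on [[0, 1]], so the velocities at 0 are compared as limits from the right. *)
Lemma derive_normal_chart0 u : 'D_u normal_chart 0 = tframe u.
Proof.
have dPhi := smooth_diff (chart_smooth normal_chartP) normal_ball0.
have small v : normal_ball v -> 'D_v normal_chart 0 = tframe v.
  move=> Ov; have [J [c [[oJ cs _ _] J01 <- c0 cE]]] := radial_witness Ov.
  have J0 : J 0 by apply: J01; rewrite /= in_itv /= lexx ler01.
  have [K [oK K0 Ks]] : exists K : set R, [/\ open K, K 0 & smooth K (fun t : R => normal_chart (0 + t *: v))].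
    have ls := smooth_line 0 v openT (findim_cV p).
    exists (setT `&` (fun t : R => 0 + t *: v) @^-1` normal_ball); split.
    - exact: open_smooth_preimage openT normal_chartP.1 ls.
    - by split => //; rewrite /preimage /= scale0r addr0; exact: normal_ball0.
    - apply: (smooth_comp (findim_cV p) fV _ _ _ (chart_smooth normal_chartP)).
      + exact: open_smooth_preimage openT normal_chartP.1 ls.
      + by move=> t [].
      + by apply: smooth_sub ls.
  have -> : 'D_v normal_chart 0 = derive1 (fun t : R => normal_chart (0 + t *: v)) 0.
    by rewrite derive1E; have [_ ->] := is_derive_dir v dPhi.
  apply: (eq_right_limit (b := 1) ltr01).
  - exact: smooth_cont (smooth_derive1 Ks) K0.
  - exact: smooth_cont (smooth_derive1 cs) J0.
  move=> r /andP[r0 r1']; rewrite !derive1E; apply: near_eq_derive.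
  near=> x; rewrite add0r -cE //; apply/andP; split; apply: ltW; near: x.
    exact: lt_nbhsr.
  exact: lt_nbhsl.
(* Geodesics are available for vectors of the ball only; linearity of the differential gives the
   others. *)
have [a a0 Oa] := normal_ball_scale u.
have := small _ Oa; rewrite tframeZ deriveE // linearZ /= -deriveE //.
by apply: scalerI; rewrite gt_eqF.
Unshelve. all: by end_near. Qed.

Lemma gram_normal_chart0 i j : gram met normal_chart 0 i j = (i == j)%:R.
Proof.
have te k : tframe (basis_vec R k) = b k.
  rewrite /tframe (bigD1 k) //= big1 => [|l lk].
    by rewrite mxE !eqxx scale1r addr0.
  by rewrite mxE (negPf lk) scale0r.
by rewrite mxE normal_chart0 !derive_normal_chart0 !te bO.
Qed.

(** The ray [s *: u] has zero second derivative, so its geodesic equation reduces to the quadratic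
    term. *)
Lemma christoffel_radial x l : normal_ball x ->
  \sum_i \sum_j christoffel met normal_chart x l i j * x i 0 * x j 0 = 0.
Proof.
move=> Ox.
(* The midpoint of [fnorm x / r1] and 1: then [x = t *: u] with [u] still in the ball and
   [0 < t < 1], so that [x] is inside the open time interval used for the geodesic equation. *)
pose t : R := (fnorm x + r1) / (2 * r1).
have fx0 := fnorm_ge0 x.
have r20 : 0 < 2 * r1 by rewrite mulr_gt0.
have t0 : 0 < t by rewrite divr_gt0 // ltr_wpDl.
have t1 : t < 1 by rewrite /t ltr_pdivrMr // mul1r mulrDl mul1r ltrD2r.
pose u := t^-1 *: x.
have xE : x = t *: u by rewrite scalerA divff ?scale1r // gt_eqF.
have Ou : normal_ball u.
  rewrite /normal_ball /= fnormZ_cV gtr0_norm ?invr_gt0 // mulrC ltr_pdivrMr // /t.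
  rewrite mulrA ltr_pdivlMr //; move: Ox; rewrite /normal_ball /= => Ox.
  nra.
have [J [c [[oJ cs cS cg] J01 _ _ cE]]] := radial_witness Ou.
pose J' : set R := `]0, 1[%classic.
have us : smooth J' (fun s : R => s *: u).
  have := smooth_line 0 u openT (findim_cV p); have -> : (fun s : R => 0 + s *: u) = (fun s => s *: u).
    by apply/funext => s; rewrite add0r.
  by apply: smooth_sub.
have oJ' : open J' by exact: interval_open.
have J'J : J' `<=` J by move=> s Js; apply: J01; apply: subset_itv_oo_cc.
have uc s : J' s -> normal_ball (s *: u) /\ normal_chart (s *: u) = c s.
  rewrite /J' /= in_itv /= => /andP[s0 s1]; split; last by rewrite cE // !ltW.
  rewrite /normal_ball /= fnormZ_cV gtr0_norm // (le_lt_trans _ Ou) //.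
  by rewrite ler_piMl ?fnorm_ge0 // ltW.
have Jt : J' t by rewrite /J' /= in_itv /= t0 t1.
have := cg _ _ _ J' (fun s => s *: u) normal_chartP oJ' J'J us uc t Jt l.
have d1 s : derive1 (fun s : R => s *: u) s = u.
  rewrite derive1E; have [_] := is_derive_line 0 u s.
  by have -> : (fun s : R => 0 + s *: u) = (fun s => s *: u) by apply/funext => r; rewrite add0r.
have d2 : derive1 (derive1 (fun s : R => s *: u)) t = 0.
  by have -> : derive1 (fun s : R => s *: u) = cst u by [apply/funext => s; exact: d1]; rewrite derive1_cst.
rewrite /geodesic_eq /derive1n /= d2 d1 -xE.
have -> : (0 : 'cV[R]_p) l 0 = 0 by rewrite mxE.
rewrite add0r => H.
have uE k : x k 0 = t * u k 0 by rewrite {1}xE mxE.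
transitivity (t * t * 0); last by rewrite mulr0.
rewrite -[in RHS]H mulr_sumr; apply: eq_bigr => i _; rewrite mulr_sumr; apply: eq_bigr => j _.
by rewrite !uE; ring.
Qed.

(** Lowers the index: up to the factor 1/2, [christoffel_radial] is the inverse Gram matrix applied
    to the vector in question. *)
Lemma normal_chart_lowered x q : normal_ball x ->
  let dg (x : 'cV[R]_p) (k i j : 'I_p) :=
    'D_(basis_vec R k) (fun v => gram met normal_chart v i j) x in
  \sum_i \sum_j (dg x i q j + dg x j q i - dg x q i j) * x i 0 * x j 0 = 0.
Proof.
move=> Ox dg.
pose B k := \sum_i \sum_j (dg x i k j + dg x j k i - dg x k i j) * x i 0 * x j 0.
have Gu := gram_unit fV hm normal_chartP Ox.
suff : \col_k B k = 0 by move/colP/(_ q); rewrite !mxE.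
suff : invmx (gram met normal_chart x) *m \col_k B k = 0.
  by move=> E; rewrite -[LHS](mulKVmx Gu) E mulmx0.
apply/colP => l; rewrite [RHS]mxE mxE.
have := christoffel_radial l Ox => H.
apply: (mulfI (_ : 2^-1 != 0 :> R)); first by rewrite invr_eq0.
rewrite mulr0; apply: etrans H; rewrite mulr_sumr.
rewrite (eq_bigr (fun k => \sum_i \sum_j 2^-1 * (invmx (gram met normal_chart x) l k *
   (dg x i k j + dg x j k i - dg x k i j) * x i 0 * x j 0))); last first.
  move=> k _; rewrite [(\col_k _) _ _]mxE /B !mulr_sumr; apply: eq_bigr => i _.
  by rewrite !mulr_sumr; apply: eq_bigr => j _; ring.
rewrite exchange_big /=; apply: eq_bigr => i _; rewrite exchange_big /=; apply: eq_bigr => j _.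
rewrite /christoffel mulr_sumr !mulr_suml; apply: eq_bigr => k _.
by rewrite /dg; ring.
Qed.

Lemma gauss_normal_chart x q : normal_ball x ->
  \sum_j gram met normal_chart x q j * x j 0 = x q 0.
Proof.
have [_ ms _ _ gs] := hm.
apply: (gauss r10); [exact: gs normal_chartP|exact: gram_normal_chart0| |exact: normal_chart_lowered].
by move=> u i j; rewrite [LHS]mxE [RHS]mxE; exact: ms.
Qed.

Lemma radial_speed_normal_chart x : normal_ball x ->
  met_norm met (normal_chart x) ('D_x normal_chart x) = fnorm x.
Proof.
move=> Ox; rewrite fnormE; congr Num.sqrt.
rewrite (gram_form _ _ hm (smooth_diff (chart_smooth normal_chartP) Ox)).
apply: eq_bigr => i _.
transitivity (x i 0 * \sum_j gram met normal_chart x i j * x j 0).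
  by rewrite mulr_sumr; apply: eq_bigr => j _; ring.
by rewrite gauss_normal_chart // expr2.
Qed.

Lemma met_cauchy_schwarz v X Y : met v X Y <= met_norm met v X * met_norm met v Y.
Proof.
have [ml ms m0 _ _] := hm.
have mr a D D' Z : met v Z (a *: D + D') = a * met v Z D + met v Z D' by rewrite ms ml ms [met v D' Z]ms.
set a := met v X X; set c := met v Y Y; set d := met v X Y.
have quad s : 0 <= s ^+ 2 * a + 2 * s * d + c.
  have := m0 v (s *: X + Y); rewrite ml mr mr -/a -/c [met v Y X]ms -/d => H.
  by apply: (le_trans H); rewrite le_eqVlt; apply/orP; left; apply/eqP; ring.
have a0 : 0 <= a by exact: m0. have c0 : 0 <= c by exact: m0.
rewrite /met_norm -/a -/c -sqrtrM // (le_trans (ler_norm d)) // -sqrtr_sqr ler_sqrt ?mulr_ge0 //.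
have [a00|an0] := eqVneq a 0; last first.
  have ap : 0 < a by rewrite lt_def an0.
  have := quad (- d / a); rewrite -subr_ge0 -(pmulr_rge0 _ ap).
  have -> : a * ((- d / a) ^+ 2 * a + 2 * (- d / a) * d + c - 0) = a * c - d ^+ 2 by field.
  by rewrite subr_ge0.
suff -> : d = 0 by rewrite expr0n mulr_ge0.
apply/eqP; apply: contraT => dn0.
(* If [met v X X = 0], the quadratic is affine in [s]; this value of [s] would make it [-1]. *)
have := quad (- (c + 1) / (2 * d)); rewrite a00.
have -> : (- (c + 1) / (2 * d)) ^+ 2 * 0 + 2 * (- (c + 1) / (2 * d)) * d + c = -1 by field.
by rewrite lerNr oppr0 ler10.
Qed.

(* Cauchy-Schwarz with the radial field and the Gauss lemma: the radial coordinate grows at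
   most as fast as the length. *)
Lemma normal_chart_expands (x y : 'cV[R]_p) : normal_ball x ->
  \sum_i x i 0 * y i 0 <= fnorm x * met_norm met (normal_chart x) ('D_y normal_chart x).
Proof.
move=> Ox; have dPhi := smooth_diff (chart_smooth normal_chartP) Ox.
rewrite -(radial_speed_normal_chart Ox); apply: le_trans (met_cauchy_schwarz _ _ _).
have [_ ms _ _ _] := hm.
rewrite ms (gram_form _ _ hm dPhi) le_eqVlt; apply/orP; left; apply/eqP.
apply: eq_bigr => i _; rewrite -(gauss_normal_chart i Ox) mulr_suml.
by apply: eq_bigr => j _; ring.
Qed.

Let speed (c : R -> V) (r : R) : R := met_norm met (c r) (derive1 c r).

(** [met] is known to be regular only through Gram matrices, so the speed is expressed in a chart
    around [c t]. *)
Lemma speed_continuous (J : set R) (c : R -> V) t : open J -> smooth J c ->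
  (forall r, J r -> S (c r)) -> J t -> {for t, continuous (speed c)}.
Proof.
move=> oJ cs cS Jt; have [_ _ _ _ gs] := hm.
have [Om [phi [lp [u Ou phiu]]]] := subS (cS t Jt).
have [K [v [oK Kt KJ vs [vt vO vc]]]] := chart_lift fV lp Ou oJ cs Jt (esym phiu).
have vcK r : K r -> Om (v r) /\ phi (v r) = c r.
  by move=> Kr; split; [exact: vO|apply: vc => //; exact/cS/KJ].
pose G r := \sum_i \sum_j gram met phi (v r) i j * derive1 v r i 0 * derive1 v r j 0.
have GC : Ck 0 K G.
  have v'C : Ck 0 K (derive1 v) by exact: smooth_derive1.
  apply: Ck_sum => // i _; apply: Ck_sum => // j _; apply: Ck_mul => //; last exact: Ck_entry.
  apply: Ck_mul => //; last exact: Ck_entry.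
  exact: (Ck_comp (findim_cV m) (findim_R (R := R)) oK vO (vs 0%N) (gs _ _ _ lp i j 0%N)).
apply: (@continuous_near_eq _ _ _ (fun r => Num.sqrt (G r))).
  apply: filterS (open_near oK Kt) => r Kr; rewrite /speed /met_norm; congr Num.sqrt.
  have [Or <-] := vcK r Kr.
  rewrite -(lift_velocity lp oK Kr vs (smooth_sub KJ cs) vcK) (gram_form _ _ hm) //.
  exact: smooth_diff (chart_smooth lp) Or.
by apply: continuous_comp; [exact: GC|exact: sqrt_continuous].
Qed.

Lemma locate_piece (s : nat -> R) N t : s 0%N <= t < s N ->
  exists2 i, (i < N)%N & s i <= t < s i.+1.
Proof.
elim: N => [|N IH] /andP[st ts]; first by move: (le_lt_trans st ts); rewrite ltxx.
have [tN|Nt] := ltP t (s N); last by exists N => //; rewrite Nt.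
by have [|i iN ti] := IH; [rewrite st|exists i => //; exact: ltnW].
Qed.

Lemma locate_piece_left (s : nat -> R) N t : s 0%N < t <= s N ->
  exists2 i, (i < N)%N & s i < t <= s i.+1.
Proof.
elim: N => [|N IH] /andP[st ts]; first by move: (lt_le_trans st ts); rewrite ltxx.
have [tN|Nt] := leP t (s N); last by exists N => //; rewrite Nt.
by have [|i iN ti] := IH; [rewrite st|exists i => //; exact: ltnW].
Qed.

Lemma partition_mono (s : nat -> R) N i j :
  (forall i, (i < N)%N -> s i < s i.+1) -> (i <= j)%N -> (j <= N)%N -> s i <= s j.
Proof.
move=> sinc; elim: j => [|j IH]; first by rewrite leqn0 => /eqP ->.
rewrite leq_eqVlt => /predU1P[-> //|ij] jN.
by rewrite (le_trans (IH ij (ltnW jN))) // ltW // sinc.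
Qed.

Lemma piece_right (c : R -> V) t : piecewise_smooth S c -> 0 <= t < 1 ->
  exists (J : set R) (h : R -> V) (t1 : R), [/\ t < t1 <= 1, open J, smooth J h &
    forall r, t <= r <= t1 -> J r /\ h r = c r].
Proof.
move=> [cS [N [s [s0 sN sinc pieces]]]]; rewrite -s0 -sN => /locate_piece[i iN /andP[it ti]].
have [J [h [oJ J_ hs hc]]] := pieces i iN.
exists J, h, (s i.+1); split => //; first by rewrite ti (partition_mono sinc).
by move=> r /andP[tr rs]; split; [apply: J_|apply: hc]; rewrite rs (le_trans it).
Qed.

Lemma piece_left (c : R -> V) t : piecewise_smooth S c -> 0 < t <= 1 ->
  exists (J : set R) (h : R -> V) (t0 : R), [/\ 0 <= t0 < t, open J, smooth J h &
    forall r, t0 <= r <= t -> J r /\ h r = c r].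
Proof.
move=> [cS [N [s [s0 sN sinc pieces]]]]; rewrite -s0 -sN => /locate_piece_left[i iN /andP[it ti]].
have [J [h [oJ J_ hs hc]]] := pieces i iN.
exists J, h, (s i); split => //; first by rewrite it (partition_mono sinc _ (ltnW iN)).
by move=> r /andP[tr rs]; split; [apply: J_|apply: hc]; rewrite tr (le_trans rs).
Qed.

Lemma measurable_speed (c : R -> V) : piecewise_smooth S c ->
  measurable_fun `[0 : R, 1] (fun r => (speed c r)%:E).
Proof.
move=> [cS [N [s [s0 sN sinc pieces]]]].
suff H i : (i <= N)%N -> measurable_fun `[s 0%N, s i] (fun r => (speed c r)%:E).
  by rewrite -s0 -sN; exact: H.
elim: i => [|i IH] iN; first by rewrite set_itv1; exact: measurable_fun_set1.
rewrite (@itv_bndbnd_setU _ _ _ (BRight (s i))); last 2 first.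
- by rewrite bnd_simp (partition_mono sinc _ (ltnW iN)).
- by rewrite bnd_simp ltW // sinc.
apply/measurable_funU => //; split; first exact: IH (ltnW iN).
(* The endpoint [s i.+1] is removed, as [c] may have a corner there; inside the piece the speed is
   continuous. *)
apply/emeasurable_fun_itv_bndo_bndcP/measurable_EFinP.
have [J [h [oJ J_ hs hc]]] := pieces i iN.
have oI : open (`]s i, s i.+1[%classic : set R) by exact: interval_open.
have IJ : `]s i, s i.+1[ `<=` J.
  by move=> r; rewrite /= in_itv /= => /andP[a b']; apply: J_; rewrite !ltW.
have cI : smooth `]s i, s i.+1[%classic c.
  apply: (smooth_ext oI _ (smooth_sub IJ hs)) => r; rewrite /= in_itv /= => /andP[a b'].
  by apply: hc; rewrite !ltW.
have i0 : 0 <= s i by rewrite -s0 (partition_mono sinc _ (ltnW iN)).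
have i1 : s i.+1 <= 1 by rewrite -sN (partition_mono sinc).
have SI r : `]s i, s i.+1[%classic r -> S (c r).
  rewrite /= in_itv /= => /andP[a b']; apply: cS.
  by rewrite (le_trans i0 (ltW a)) (le_trans (ltW b')).
apply: open_continuous_measurable_fun => // r; rewrite inE => Ir.
exact: speed_continuous oI cI SI Ir.
Qed.

Lemma met_norm_ge0 v D : 0 <= met_norm met v D. Proof. exact: sqrtr_ge0. Qed.

Lemma riem_dist_normal_chart u : normal_ball u ->
  (riem_dist S met w (normal_chart u) <= (fnorm u)%:E)%E.
Proof.
move=> Ou; have [J [c [[oJ cs cS _] J01 _ c0 cE]]] := radial_witness Ou.
have J_ r : 0 <= r <= 1 -> J r by move=> r01; apply: J01; rewrite /= in_itv.
have cpw : piecewise_smooth S c.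
  split=> [t /J_|]; first exact: cS.
  exists 1%N, (fun i => i%:R); split => // [i|i]; rewrite ltnS leqn0 => /eqP ->.
    exact: ltr01.
  by exists J, c; split => // t; exact: J_.
(* At [r *: u], [radial_speed_normal_chart] reads [r] times the speed equals [r * fnorm u], by
   linearity of the derivative in its direction. *)
have sp r : 0 < r < 1 -> speed c r = fnorm u.
  move=> /andP[r0 r1'].
  have Oru : normal_ball (r *: u).
    rewrite /normal_ball /= fnormZ_cV gtr0_norm // (le_lt_trans _ Ou) //.
    by rewrite ler_piMl ?fnorm_ge0 // ltW.
  have dPhi := smooth_diff (chart_smooth normal_chartP) Oru.
  have dc : derive1 c r = 'D_u normal_chart (r *: u).
    have dl : is_derive r (1 : R) (fun s : R => s *: u) u.
      have := is_derive_line 0 u r.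
      by have -> : (fun s : R => 0 + s *: u) = (fun s => s *: u) by apply/funext => x; rewrite add0r.
    have [_ <-] := is_derive_curve dl dPhi; rewrite derive1E; apply: near_eq_derive.
    near=> x; apply: cE; apply/andP; split; apply: ltW; near: x.
      exact: lt_nbhsr.
    exact: lt_nbhsl.
  have := radial_speed_normal_chart Oru; rewrite fnormZ_cV (gtr0_norm r0).
  rewrite deriveE // linearZ /= -deriveE // -dc -cE ?(ltW r0) ?(ltW r1') //.
  have [ml ms _ _ _] := hm.
  rewrite /speed /met_norm => H.
  have mZ a X Y : met (c r) (a *: X) Y = a * met (c r) X Y.
    by have := met_suml (c r) (fun _ : 'I_1 => a) (fun _ => X) Y hm; rewrite !big_ord1.
  move: H; rewrite mZ ms mZ mulrA -expr2 sqrtrM ?sqr_ge0 // sqrtr_sqr gtr0_norm //.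
  by move/mulfI; apply; rewrite gt_eqF.
apply: (@le_trans _ _ (curve_length met c)).
  apply: ereal_inf_lbound; exists c => //; split => //.
  by rewrite cE ?scale1r // ler01 lexx.
(* The speed has been computed only at interior times, near which [c] coincides with the image of
   the ray; the endpoints have measure zero. *)
rewrite /curve_length -/(speed c) integral_itv_bndoo; last first.
  apply: measurable_funS (measurable_speed cpw) => //; exact: subset_itv_oo_cc.
rewrite (eq_integral (cst (fnorm u)%:E)); last first.
  by move=> r; rewrite inE /= in_itv /= => /sp; rewrite /speed => ->.
rewrite integral_cst //= lebesgue_measure_itv /= lte_fin ltr01 -EFinB subr0 mule1.
exact: lexx.
Unshelve. all: by end_near. Qed.

(** The curve lifts to the normal chart for a short time, during which [normal_chart_expands] bounds
    the growth of the radius by the speed. *)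
Lemma normal_chart_step (c : R -> V) (h : R -> V) (J : set R) t t1 u : piecewise_smooth S c ->
  0 <= t -> t < t1 -> t1 <= 1 -> open J -> smooth J h ->
  (forall r, t <= r <= t1 -> J r /\ h r = c r) -> normal_ball u -> c t = normal_chart u ->
  exists2 e : R, 0 < e & forall r, t <= r < t + e -> r <= t1 ->
    exists2 v, normal_ball v /\ c r = normal_chart v &
      ((fnorm v)%:E <= (fnorm u)%:E + \int[lebesgue_measure]_(x in `]t, r[) (speed c x)%:E)%E.
Proof.
move=> cpw t0 tt1 t11 oJ hs hc Ou ct.
have [tJ htc] : J t /\ h t = c t by apply: hc; rewrite lexx ltW.
have hct : h t = normal_chart u by rewrite htc.
have [K [v [oK Kt KJ vs [vt vO vc]]]] := chart_lift fV normal_chartP Ou oJ hs tJ hct.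
have /near_ball_norm[e e0 he] := open_near oK Kt.
exists e => // r /andP[tr re] rt1.
have Kx x : t <= x <= r -> K x.
  move=> /andP[tx xr]; apply: he; rewrite ger0_norm ?subr_ge0 // ltrBlDl.
  by rewrite (le_lt_trans xr).
have Sh x : t <= x <= r -> S (h x).
  move=> /andP[tx xr]; have [|_ ->] := hc x; first by rewrite tx (le_trans xr).
  by apply: cpw.1; rewrite (le_trans t0 tx) (le_trans xr (le_trans rt1 t11)).
have Kr : K r by apply: Kx; rewrite tr lexx.
have cr : c r = normal_chart (v r).
  have [|_ <-] := hc r; first by rewrite tr rt1.
  by rewrite vc //; apply: Sh; rewrite tr lexx.
exists (v r); first by split; [exact: vO|].
have [Etr|ntr] := eqVneq r t.
  by rewrite Etr vt set_itvoo0 integral_set0 adde0.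
have {ntr}tr' : t < r by rewrite lt_neqAle eq_sym ntr tr.
apply/lee_addgt0Pr => d d0.
(* A smooth substitute for the norm, which is not differentiable at 0. *)
pose F x := Num.sqrt (sqnorm (v x) + d ^+ 2).
have sq0 x : 0 <= sqnorm (v x) by rewrite -fnorm_sqr sqr_ge0.
have arg0 x : 0 < sqnorm (v x) + d ^+ 2 by rewrite ltr_wpDl // exprn_gt0.
have fF x : fnorm (v x) <= F x by rewrite fnormE ler_wsqrtr // lerDl sqr_ge0.
have argC : smooth K (fun x => sqnorm (v x) + d ^+ 2).
  move=> j; apply: Ck_add => //; last exact: Ck_cst.
  by apply: (Ck_comp (findim_cV p) (findim_R (R := R)) oK _ (vs j) (@sqnorm_Ck R p j)).
have FC : smooth K F by move=> j; apply: Ck_sqrt => // ; exact: argC.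
have F'le x : t < x < r -> derive1 F x <= speed c x.
  move=> /andP[tx xr]; have Kx' : K x by apply: Kx; rewrite !ltW.
  have argD : is_derive x (1 : R) (fun x => sqnorm (v x) + d ^+ 2) (2 * \sum_i v x i 0 * derive1 v x i 0).
    have D1 : is_derive x (1 : R) (fun x => sqnorm (v x)) (2 * \sum_i v x i 0 * derive1 v x i 0).
      rewrite mulr_sumr; apply: is_derive_bigsum => i.
      have dv := smooth_is_derive vs Kx'.
      have dvi : is_derive x (1 : R) (fun x => v x i 0) (derive1 v x i 0).
        have dl : differentiable (@mxcoord R p 1 i 0) (v x).
          by apply: linear_differentiable; exact: coord_continuous.
        have := is_derive_curve dv dl; rewrite deriveE // diff_lin //.
        exact: coord_continuous.
      apply: is_derive_eq.
      by rewrite /GRing.scale /=; ring.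
    have D2 : is_derive x (1 : R) (fun _ : R => d ^+ 2) 0 by exact: is_derive_cst.
    by have := is_deriveD D1 D2; rewrite addr0.
  have [_ E] := is_derive_sqrt_comp (1 : R) (smooth_diff argC Kx') (arg0 x).
  have -> : derive1 F x = (2 * \sum_i v x i 0 * derive1 v x i 0) * (2 * F x)^-1.
    by rewrite derive1E; apply: (etrans E); have [_ ->] := argD.
  have F0 : 0 < F x by rewrite sqrtr_gt0.
  (* The derivative of [F] is the product of [v] with its velocity, divided by [F]. The Gauss lemma
     bounds the product by [fnorm (v x)] times the speed, and [fnorm (v x) <= F x]. *)
  rewrite ler_pdivrMr ?mulr_gt0 // mulrCA ler_pM2l // mulrC.
  have Ovx : normal_ball (v x) by exact: vO.
  apply: (le_trans (normal_chart_expands _ Ovx)).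
  have vE : 'D_(derive1 v x) normal_chart (v x) = derive1 c x.
    have dPhi := smooth_diff (chart_smooth normal_chartP) Ovx.
    have [_ <-] := is_derive_curve (smooth_is_derive vs Kx') dPhi.
    rewrite derive1E; apply: near_eq_derive; near=> y.
    have ty : t <= y <= r.
      by apply/andP; split; apply: ltW; near: y; [exact: lt_nbhsr|exact: lt_nbhsl].
    have [|_ <-] := hc y; last by rewrite vc //; [exact: Kx|exact: Sh].
    by case/andP: ty => -> /le_trans; apply.
  have cx : c x = normal_chart (v x).
    have [|_ <-] := hc x; first by rewrite (ltW tx) (le_trans (ltW xr)).
    by rewrite vc //; apply: Sh; rewrite !ltW.
  by rewrite vE -cx /speed ler_wpM2r ?met_norm_ge0.
have ms : measurable_fun `]t, r[ (fun x => (speed c x)%:E).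
  apply: measurable_funS (measurable_speed cpw) => // x; rewrite /= !in_itv /= => /andP[tx xr].
  by rewrite (le_trans t0 (ltW tx)) (le_trans (ltW xr) (le_trans rt1 t11)).
have := FTC_le_integral tr' oK Kx FC (fun x => met_norm_ge0 _ _) ms F'le.
move=> H; apply: (@le_trans _ _ (F r)%:E); first by rewrite lee_fin.
have -> : (F r)%:E = ((F t)%:E + (F r - F t)%:E)%E by rewrite -EFinD addrC subrK.
rewrite addeAC; apply: leeD => //.
(* At the left end [F t <= fnorm u + d], checked on squares. *)
rewrite -EFinD lee_fin /F vt.
rewrite -(ler_pXn2r (n := 2)) ?nnegrE ?sqrtr_ge0 ?addr_ge0 ?fnorm_ge0 ?(ltW d0) //.
rewrite sqr_sqrtr ?addr_ge0 ?sqr_ge0 // -?fnorm_sqr ?sqr_ge0 // sqrrD -addrA lerD2l lerDr.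
by rewrite mulrn_wge0 // mulr_ge0 ?fnorm_ge0 // ltW.
Unshelve. all: by end_near. Qed.

(** Continuous induction on [c t] lying in the image of the closed ball of radius [rho t], the
    initial radius plus the length up to [t]. Left limits are kept because this image is compact,
    hence closed; [normal_chart_step] extends to the right; the bound on the length keeps [rho t]
    below [r1]. *)
Lemma curve_stays_in_normal_chart (c : R -> V) u : piecewise_smooth S c -> normal_ball u ->
  c 0 = normal_chart u -> (curve_length met c < (r1 - fnorm u)%:E)%E ->
  exists2 v, normal_ball v /\ c 1 = normal_chart v &
    ((fnorm v)%:E <= (fnorm u)%:E + curve_length met c)%E.
Proof.
move=> cpw Ou c0 len.
have sp0 x : (0 <= (speed c x)%:E)%E by rewrite lee_fin met_norm_ge0.
have msp := measurable_speed cpw.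
pose I t := (\int[lebesgue_measure]_(x in `[0%R, t]) (speed c x)%:E)%E.
have I1 : I 1 = curve_length met c by [].
have Iadd t r : 0 <= t -> t <= r -> r <= 1 ->
    I r = (I t + \int[lebesgue_measure]_(x in `]t, r[) (speed c x)%:E)%E.
  by move=> t0 tr r1'; exact: ge0_integral_split msp t0 tr r1'.
have I0 t : (0 <= I t)%E by apply: integral_ge0 => x _; exact: sp0.
have Imon t r : 0 <= t -> t <= r -> r <= 1 -> (I t <= I r)%E.
  move=> t0 tr r1'; rewrite (Iadd _ _ t0 tr r1') leeDl //.
  by apply: integral_ge0 => x _; exact: sp0.
have Ifin t : 0 <= t <= 1 -> I t \is a fin_num.
  move=> /andP[t0 t1]; rewrite ge0_fin_numE // (le_lt_trans (Imon _ _ t0 t1 (lexx 1))) //.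
  by rewrite I1 (lt_trans len) // ltry.
pose rho t := fnorm u + fine (I t).
have rho_lt t : 0 <= t <= 1 -> rho t < r1.
  move=> /andP[t0 t1]; rewrite /rho -ltrBrDl -lte_fin fineK; last by apply: Ifin; rewrite t0.
  by rewrite (le_lt_trans (Imon _ _ t0 t1 (lexx 1))).
pose P t := exists2 v, fnorm v <= rho t & c t = normal_chart v.
have ballP t v : 0 <= t <= 1 -> fnorm v <= rho t -> normal_ball v.
  by move=> t01 vt; rewrite /normal_ball /= (le_lt_trans vt) // rho_lt.
suff : P 1.
  have h1 : (0 : R) <= (1 : R) <= (1 : R) by rewrite ler01 lexx.
  move=> [v v1 cv]; exists v; first by split => //; exact: ballP v1.
  by rewrite -I1 -(fineK (Ifin 1 h1)) -EFinD lee_fin.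
apply: (real_induction (a := 0) (b := 1)); last by rewrite ler01 lexx.
- by exists u => //; rewrite /rho lerDl fine_ge0.
- move=> t /andP[t0 t1] IH; have t01 : 0 <= t <= 1 by rewrite (ltW t0).
  have t01' : 0 < t <= 1 by rewrite t0.
  have [J [h [s [/andP[s0 st] oJ hs hc]]]] := piece_left cpw t01'.
  pose K := [set v : 'cV[R]_p | fnorm v <= rho t].
  have KO v : K v -> normal_ball v by exact: ballP t01.
  have cK : compact (normal_chart @` K).
    apply: continuous_compact; last exact: compact_fball.
    apply: continuous_in_subspaceT => v; rewrite inE => /KO.
    exact: smooth_cont (chart_smooth normal_chartP).
  have clK : closed (normal_chart @` K).
    by apply: compact_closed cK; exact: norm_hausdorff.
  have [Jt htc] : J t /\ h t = c t by apply: hc; rewrite lexx ltW.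
  rewrite /P -htc; have hcont : h x @[x --> t^'-] --> h t.
    by apply: cvg_at_left_filter; exact: smooth_cont hs Jt.
  suff : (normal_chart @` K) (h t) by move=> [v Kv <-]; exists v.
  apply: (closed_cvg (normal_chart @` K) clK _ _ hcont); near=> x.
  have sx : s <= x by near: x; exact: nbhs_left_ge.
  have xt : x < t by near: x; exact: nbhs_left_lt.
  have [|_ ->] := hc x; first by rewrite sx ltW.
  have [|v vx ->] := IH x; first by rewrite xt (le_trans s0).
  exists v => //; apply: (le_trans vx); rewrite lerD2l fine_le //.
  + by apply: Ifin; rewrite (le_trans s0 sx) (le_trans (ltW xt)).
  + exact: Ifin.
  + exact: (Imon _ _ (le_trans s0 sx) (ltW xt) t1).
move=> t /andP[t0 t1] [v vt cv]; have t01 : 0 <= t <= 1 by rewrite t0 ltW.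
have [|J [h [t2 [/andP[tt2 t21] oJ hs hc]]]] := piece_right cpw (t := t); first by rewrite t0.
have Ov := ballP _ _ t01 vt.
have [e e0 he] := normal_chart_step cpw t0 tt2 t21 oJ hs hc Ov cv.
exists (Num.min e (t2 - t)); first by rewrite lt_min e0 subr_gt0.
move=> r /andP[tr re] rle1.
have [||x [Ox cx] xr] := he r.
- by rewrite tr (lt_le_trans re) // lerD2l ge_min lexx.
- by rewrite ltW // (lt_le_trans re) // -lerBrDl ge_min lexx orbT.
have r01 : 0 <= r <= 1 by rewrite (le_trans t0 tr).
exists x => //; rewrite -lee_fin (le_trans xr) // /rho EFinD fineK ?Ifin // (Iadd _ _ t0 tr rle1).
rewrite (addeA (fnorm u)%:E (I t)); apply: leeD; last exact: lexx.
by rewrite -(fineK (Ifin t t01)) -EFinD lee_fin.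
Unshelve. all: by end_near. Qed.

End NormalChart.

(** * Orthonormal bases and projectors *)

Section OrthonormalBasis.
Context {R : realType}.
Implicit Types V W : normedModType R.

(* The coordinates of a vector in an orthonormal family of maximal size leave no residue. *)
Lemma orthonormal_basis V (T : set V) (B : V -> V -> R) : findim V -> T 0 ->
  (forall a x y, T x -> T y -> T (a *: x + y)) ->
  (forall a x y z, B (a *: x + y) z = a * B x z + B y z) ->
  (forall x y, B x y = B y x) -> (forall x, T x -> 0 <= B x x) ->
  (forall x, T x -> B x x = 0 -> x = 0) ->
  exists p (b : 'I_p -> V), [/\ forall i, T (b i), forall i j, B (b i) (b j) = (i == j)%:R &
    forall x, T x -> x = \sum_i B x (b i) *: b i].
Proof.
move=> [I [e [l [lc le]]]] T0 Tlin Bl Bsym B0 Bpos.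
have Bsum (J : finType) (c : J -> R) (D : J -> V) z :
    B (\sum_i c i *: D i) z = \sum_i c i * B (D i) z.
  exact: (linear_suml (B := fun x => B x z)).
have Tsum (J : finType) (c : J -> R) (D : J -> V) : (forall i, T (D i)) -> T (\sum_i c i *: D i).
  by move=> TD; elim/big_rec : _ => // i x _ Tx; exact: Tlin.
pose ortho p := `[< exists b : 'I_p -> V, (forall i, T (b i)) /\
   forall i j, B (b i) (b j) = (i == j)%:R >].
have ex0 : exists p, ortho p.
  by exists 0%N; apply/asboolP; exists (fun=> 0); split => [//|[]].
have bound p : ortho p -> (p <= #|I|)%N.
  move=> /asboolP[b [Tb bO]].
  (* An orthonormal family is free, so its coordinate matrix has independent rows and at most [#|I|]
     of them. *)
  pose A : 'M[R]_(p, #|I|) := \matrix_(i, a) (l (enum_val a) (b i) : R).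
  suff : row_free A by rewrite /row_free => /eqP <-; exact: rank_leq_col.
  rewrite -kermx_eq0; apply/eqP/row_matrixP => i; rewrite row0.
  apply/rowP => j; rewrite [RHS]mxE.
  have : row i (kermx A) *m A = 0 by apply/sub_kermxP; exact: row_sub.
  move: (row i (kermx A)) => x xA.
  have : \sum_k x 0 k *: b k = 0.
    rewrite [LHS]le big1 // => a _; rewrite linear_sum.
    have := congr1 (fun M : 'rV_ _ => M 0 (enum_rank a)) xA; rewrite !mxE => E.
    rewrite (_ : \sum_(k < p) _ = 0) ?scale0r // -[RHS]E; apply: eq_bigr => k _.
    by rewrite linearZ /= mxE enum_rankK.
  move=> /(congr1 (fun y => B y (b j))); rewrite Bsum (bigD1 j) //= bO eqxx mulr1.
  rewrite big1 => [|k kj]; last by rewrite bO (negPf kj) mulr0.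
  rewrite addr0 => ->.
  by have := Bl 1 0 0 (b j); rewrite scale1r addr0 mul1r => /eqP; rewrite -subr_eq0 opprD addNKr oppr_eq0 => /eqP.
case: (ex_maxnP ex0 bound) => p /asboolP[b [Tb bO]] pmax.
exists p, b; split => // x Tx; apply: contrapT => xn.
pose r := x - \sum_i B x (b i) *: b i.
have Tr : T r.
  rewrite /r -[- _]scaleN1r addrC; apply: Tlin => //; exact: Tsum.
have r0 : r != 0 by apply/eqP => /eqP; rewrite subr_eq0 => /eqP.
have rb j : B r (b j) = 0.
  have -> : r = - 1 *: (\sum_i B x (b i) *: b i) + x by rewrite scaleN1r addrC.
  rewrite Bl Bsum (bigD1 j) //= big1 => [|i ij]; last by rewrite bO (negPf ij) mulr0.
  by rewrite bO eqxx mulr1 addr0 mulN1r addNr.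
have Brr : 0 < B r r.
  by rewrite lt_def B0 // andbT; apply: contra r0 => /eqP /(Bpos _ Tr) ->.
pose a := (Num.sqrt (B r r))^-1.
have BZ c y z : B (c *: y) z = c * B y z.
  have := Bl c y 0 z; rewrite addr0 => ->.
  by have := Bl 1 0 0 z; rewrite scale1r addr0 mul1r => /eqP; rewrite -subr_eq0 opprD addNKr oppr_eq0 => /eqP ->; rewrite addr0.
have ee : B (a *: r) (a *: r) = 1.
  have s0 : Num.sqrt (B r r) != 0 by rewrite gt_eqF // sqrtr_gt0.
  by rewrite BZ Bsym BZ mulrA -[X in _ * X = _](sqr_sqrtr (ltW Brr)) /a; field.
have eb j : B (a *: r) (b j) = 0 by rewrite BZ rb mulr0.
have : ortho p.+1.
  apply/asboolP; exists (fun i => if unlift ord_max i is Some j then b j else a *: r).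
  split => [i|i j].
    case: unliftP => [j _|_] //.
    by rewrite -[a *: r]addr0; exact: Tlin.
  case: (unliftP ord_max i) => [i' ->|->]; case: (unliftP ord_max j) => [j' ->|->].
  - by rewrite bO (inj_eq (@lift_inj _ _)).
  - by rewrite Bsym eb eq_sym (negPf (neq_lift _ _)).
  - by rewrite eb (negPf (neq_lift _ _)).
  - by rewrite ee eqxx.
by move/pmax; rewrite ltnn.
Qed.

End OrthonormalBasis.

Section Projectors.
Context {R : realType}.

Lemma innerC m n (A B : 'M[R]_(m, n)) : inner A B = inner B A.
Proof. by rewrite /inner -mxtrace_tr trmx_mul trmxK. Qed.

Lemma innerDl m n a (A A' B : 'M[R]_(m, n)) : inner (a *: A + A') B = a * inner A B + inner A' B.
Proof.
by rewrite /inner !linearD /= !linearZ /= mulmxDl linearD /= -scalemxAl linearZ.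
Qed.

Lemma innerE m n (A B : 'M[R]_(m, n)) : inner A B = \sum_j \sum_i A i j * B i j.
Proof.
rewrite /inner /mxtrace; apply: eq_bigr => j _; rewrite mxE.
by apply: eq_bigr => i _; rewrite mxE.
Qed.

Lemma inner_ge0 m n (A : 'M[R]_(m, n)) : 0 <= inner A A.
Proof.
rewrite innerE; apply: sumr_ge0 => j _; apply: sumr_ge0 => i _.
by rewrite -expr2 sqr_ge0.
Qed.

Lemma inner_eq0 m n (A : 'M[R]_(m, n)) : inner A A = 0 -> A = 0.
Proof.
rewrite innerE => /eqP; rewrite psumr_eq0 => [/allP H|j _]; last first.
  by apply: sumr_ge0 => i _; rewrite -expr2 sqr_ge0.
apply/matrixP => i j; rewrite mxE.
have := H j (mem_index_enum _); rewrite psumr_eq0 => [/allP/(_ i (mem_index_enum _))|i' _].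
  by rewrite -expr2 sqrf_eq0 => /eqP.
by rewrite -expr2 sqr_ge0.
Qed.

Lemma inner_mulmx m n p (A : 'M[R]_(m, n)) (x : 'M[R]_(n, p)) y :
  inner (A *m x) y = inner x (A^T *m y).
Proof. by rewrite /inner trmx_mul mulmxA. Qed.

(** Ensures that [frame] does not return its default. The basis found has some size [p], identified
    with [k] by comparing ranks. *)
Lemma frame_exists n k (Q : 'M[R]_n) : Q^T = Q -> Q *m Q = Q -> \rank Q = k ->
  exists V : 'M[R]_(n, k), V^T *m V = 1%:M /\ Q = V *m V^T.
Proof.
move=> Qs QQ Qk; pose T : set 'cV[R]_n := [set v | Q *m v = v].
have [p [b [Tb bO bC]]] : exists p (b : 'I_p -> 'cV[R]_n), [/\ forall i, T (b i),
    forall i j, inner (b i) (b j) = (i == j)%:R &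
    forall x, T x -> x = \sum_i inner x (b i) *: b i].
  apply: (orthonormal_basis (findim_cV n)).
  - by rewrite /T /= mulmx0.
  - by move=> a x y; rewrite /T /= mulmxDr -scalemxAr => -> ->.
  - by move=> a x y z; exact: innerDl.
  - by move=> x y; exact: innerC.
  - by move=> x _; exact: inner_ge0.
  - by move=> x _; exact: inner_eq0.
pose V : 'M[R]_(n, p) := \matrix_(i, j) b j i 0.
have VV : V^T *m V = 1%:M.
  apply/matrixP => i j; rewrite !mxE -bO innerE big_ord1.
  by apply: eq_bigr => l _; rewrite !mxE.
have QV : Q *m V = V.
  apply/matrixP => i j; have := congr1 (fun M : 'cV_n => M i 0) (Tb j).
  by rewrite !mxE => E; rewrite -[RHS]E; apply: eq_bigr => l _; rewrite !mxE.
have VQ : V *m (V^T *m Q) = Q.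
  apply/matrixP => i j.
  have Tc : T (col j Q).
    rewrite /T /=; apply/colP => l; rewrite !mxE -[in RHS]QQ mxE.
    by apply: eq_bigr => q _; rewrite !mxE.
  have := congr1 (fun M : 'cV_n => M i 0) (bC _ Tc); rewrite mxE => ->.
  rewrite mxE summxE; apply: eq_bigr => q _; rewrite !mxE mulrC innerE big_ord1; congr (_ * _).
  by apply: eq_bigr => l _; rewrite !mxE mulrC.
have QVV : Q = V *m V^T.
  have : V^T *m Q = V^T by rewrite -[in RHS]QV trmx_mul Qs.
  by move=> E; rewrite -[LHS]VQ E.
have pk : p = k.
  apply/eqP; rewrite eqn_leq -Qk; apply/andP; split.
    rewrite -[leqLHS](mxrank1 R) -VV.
    by rewrite -[in leqLHS]QV mulmxA (leq_trans (mxrankM_maxl _ _)) // mxrankM_maxr.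
  by rewrite QVV (leq_trans (mxrankM_maxr _ _)) // rank_leq_row.
by subst p; exists V.
Qed.

(** Orthogonal projector onto the column space of [B] when the columns are independent. It is
    rational in the entries, so smooth families of frames give smooth families of projectors without
    orthonormalization. *)
Definition pj n k (B : 'M[R]_(n, k)) : 'M[R]_n := B *m invmx (B^T *m B) *m B^T.

Section pj.
Variables (n k : nat) (B : 'M[R]_(n, k)).
Hypothesis BU : B^T *m B \in unitmx.

Lemma pj_sym : (pj B)^T = pj B.
Proof. by rewrite /pj !trmx_mul trmx_inv trmx_mul !trmxK mulmxA. Qed.

Lemma pj_mul : pj B *m B = B.
Proof. by rewrite /pj -mulmxA -mulmxA mulVmx // mulmx1. Qed.

Lemma pj_idem : pj B *m pj B = pj B.
Proof. by rewrite {2}/pj !mulmxA pj_mul. Qed.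

Lemma pj_rank : \rank (pj B) = k.
Proof.
have Bk : \rank B = k.
  apply/eqP; rewrite eqn_leq rank_leq_col /= -{1}(mxrank_unit BU).
  by rewrite mxrankM_maxr.
apply/eqP; rewrite eqn_leq; apply/andP; split.
  by rewrite /pj -mulmxA (leq_trans (mxrankM_maxl _ _)) // rank_leq_col.
by rewrite -{1}Bk -{1}pj_mul mxrankM_maxl.
Qed.

Lemma pj_range (v : 'cV[R]_n) : pj B *m v = v <-> exists c, v = B *m c.
Proof.
split=> [<-|[c ->]]; last by rewrite mulmxA pj_mul.
by exists (invmx (B^T *m B) *m B^T *m v); rewrite /pj !mulmxA.
Qed.

End pj.

Lemma mulmx_inj_unit n k (B : 'M[R]_(n, k)) :
  (forall c : 'cV[R]_k, B *m c = 0 -> c = 0) -> B^T *m B \in unitmx.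
Proof.
move=> Binj; rewrite -row_free_unit -kermx_eq0; apply/eqP/row_matrixP => i; rewrite row0.
have : row i (kermx (B^T *m B)) *m (B^T *m B) = 0 by apply/sub_kermxP; exact: row_sub.
move: (row i _) => x xB; apply: trmx_inj; rewrite trmx0; apply: Binj; apply: inner_eq0.
by rewrite /inner trmx_mul trmxK -mulmxA [in X in \tr X]mulmxA mulmxA -[x *m _ *m _]mulmxA xB mul0mx linear0.
Qed.

Lemma unit_mulmx_inj n k (B : 'M[R]_(n, k)) p (c c' : 'M[R]_(k, p)) :
  B^T *m B \in unitmx -> B *m c = B *m c' -> c = c'.
Proof.
by move=> BU E; rewrite -[c](mulKmx BU) -[c'](mulKmx BU) -!mulmxA E.
Qed.

Lemma orthoproj_unique n (T : set 'cV[R]_n) (P P' : 'M[R]_n) :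
  is_orthoproj T P -> is_orthoproj T P' -> P = P'.
Proof.
have fixes (Q Q' : 'M[R]_n) : is_orthoproj T Q -> is_orthoproj T Q' -> Q *m Q' = Q'.
  move=> [_ _ QT] [_ Q'Q' Q'T]; apply/matrixP => i j.
  have : T (col j Q').
    by apply/Q'T; apply/colP => l; rewrite !mxE -[in RHS]Q'Q' mxE; apply: eq_bigr => q _; rewrite !mxE.
  move/QT/(congr1 (fun M : 'cV_n => M i 0)); rewrite !mxE => E; rewrite -[RHS]E.
  by apply: eq_bigr => q _; rewrite !mxE.
move=> hP hP'; have [Ps _ _] := hP; have [P's _ _] := hP'.
rewrite -(fixes _ _ hP' hP) -[in LHS]P's -[in LHS]Ps -trmx_mul (fixes _ _ hP hP').
exact: P's.
Qed.

Lemma pj_orthoproj n k (B : 'M[R]_(n, k)) : B^T *m B \in unitmx ->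
  is_orthoproj [set v | exists c, v = B *m c] (pj B).
Proof.
move=> BU; split; [exact: pj_sym|exact: pj_idem|].
by move=> v /=; split => /pj_range; apply.
Qed.

Lemma Ck_pj (V : normedModType R) j (U : set V) n k (B : V -> 'M[R]_(n, k)) : open U ->
  (forall x, U x -> (B x)^T *m B x \in unitmx) -> Ck j U B -> Ck j U (fun x => pj (B x)).
Proof.
move=> oU BU BC; have BtC := Ck_trmx oU BC.
apply: Ck_mulmx => //; apply: Ck_mulmx => //.
by apply: Ck_invmx => //; exact: Ck_mulmx.
Qed.

End Projectors.

(** * Tangent projector, gradient and Hessian *)

Section Submanifolds.
Context {R : realType}.
Implicit Types V W : normedModType R.

Lemma rel_open_local V (S I : set V) : I `<=` S ->
  (forall s, I s -> exists O : set V, [/\ open O, O s & S `&` O `<=` I]) -> rel_open S I.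
Proof.
move=> IS H; exists (\bigcup_(O in [set O | open O /\ S `&` O `<=` I]) O).
  by apply: bigcup_open => O [].
apply/seteqP; split => s.
  by move=> Is; split; [exact: IS|]; have [Q [oQ Qs QI]] := H s Is; exists Q.
by move=> [Ss [Q [oQ QI] Qs]]; exact: QI.
Qed.

Lemma local_paramI V m (S : set V) (Om : set 'cV[R]_m) (phi : 'cV[R]_m -> V) :
  open Om -> smooth Om phi -> (forall u, Om u -> S (phi u)) ->
  (forall u, Om u -> exists (O : set V) (G : V -> 'cV[R]_m),
    [/\ open O, O (phi u), smooth O G,
        (forall y, S y -> O y -> Om (G y) /\ phi (G y) = y) &
        forall v, Om v -> O (phi v) -> G (phi v) = v]) ->
  local_param S Om phi.
Proof.
move=> oOm phis phiS H; split => //.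
have inj u v : Om u -> Om v -> phi u = phi v -> u = v.
  move=> Ou Ov E; have [Q [G [_ Qu _ _ GK]]] := H u Ou.
  by rewrite -(GK u) // E GK // -E.
pose g y := xget 0 [set u | Om u /\ phi u = y].
have gK u : Om u -> g (phi u) = u.
  by move=> Ou; apply: xget_unique => // v [Ov E]; exact: inj.
split; first exact: smooth_smooth_on.
  apply: rel_open_local => [_ [u Ou <-]|_ [u Ou <-]]; first exact: phiS.
  have [Q [G [oQ Qu Gs GQ GK]]] := H u Ou.
  by exists Q; split => // y [Sy Qy]; have [OG E] := GQ y Sy Qy; exists (G y).
exists g => //; move=> _ [u Ou <-]; have [Q [G [oQ Qu Gs GQ GK]]] := H u Ou.
exists Q, G; split => // _ [v Ov <-] Qv.
by rewrite GK // gK.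
Qed.

Lemma is_derive_mx V m n (A : V -> 'M[R]_(m, n)) (dA : 'M[R]_(m, n)) x v :
  (forall i j, is_derive x v (fun y => A y i j) (dA i j)) -> is_derive x v A dA.
Proof.
move=> H; have dAx : derivable A x v by apply/derivable_mxP => i j; have [] := H i j.
apply: DeriveDef => //; rewrite derive_mx //; apply/matrixP => i j; rewrite mxE.
by have [_] := H i j.
Qed.

Lemma is_derive_entry V m n (A : V -> 'M[R]_(m, n)) dA x v i j :
  is_derive x v A dA -> is_derive x v (fun y => A y i j) (dA i j).
Proof.
move=> [dAx <-]; apply: DeriveDef; first by move/derivable_mxP : dAx.
by rewrite derive_mx // mxE.
Qed.

Lemma is_derive_mulmx V m n p (A : V -> 'M[R]_(m, n)) (B : V -> 'M[R]_(n, p)) dA dB x v :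
  is_derive x v A dA -> is_derive x v B dB ->
  is_derive x v (fun y => A y *m B y) (dA *m B x + A x *m dB).
Proof.
move=> HA HB; apply: is_derive_mx => i j.
have -> : (fun y => (A y *m B y) i j) = fun y => \sum_k A y i k * B y k j.
  by apply/funext => y; rewrite mxE.
have -> : (dA *m B x + A x *m dB) i j = \sum_k (dA i k * B x k j + A x i k * dB k j).
  by rewrite !mxE big_split.
apply: is_derive_bigsum => k.
have HAk := is_derive_entry i k HA; have HBk := is_derive_entry k j HB.
apply: is_derive_eq.
by rewrite /GRing.scale /=; ring.
Qed.

Lemma is_derive_trmx V m n (A : V -> 'M[R]_(m, n)) dA x v :
  is_derive x v A dA -> is_derive x v (fun y => (A y)^T) dA^T.
Proof.
move=> HA; apply: is_derive_mx => i j; rewrite mxE.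
have -> : (fun y => (A y)^T i j) = fun y => A y j i by apply/funext => y; rewrite mxE.
exact: is_derive_entry.
Qed.

Lemma is_derive_inner V m n (A B : V -> 'M[R]_(m, n)) dA dB x v :
  is_derive x v A dA -> is_derive x v B dB ->
  is_derive x v (fun y => inner (A y) (B y)) (inner dA (B x) + inner (A x) dB).
Proof.
move=> HA HB.
have -> : (fun y => inner (A y) (B y)) = fun y => \sum_j \sum_i A y i j * B y i j.
  by apply/funext => y; rewrite innerE.
have -> : inner dA (B x) + inner (A x) dB = \sum_j \sum_i (dA i j * B x i j + A x i j * dB i j).
  by rewrite !innerE -big_split; apply: eq_bigr => j _; rewrite -big_split.
apply: is_derive_bigsum => j; apply: is_derive_bigsum => i.
have HAk := is_derive_entry i j HA; have HBk := is_derive_entry i j HB.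
apply: is_derive_eq.
by rewrite /GRing.scale /=; ring.
Qed.

Definition jac m n (phi : 'cV[R]_m -> 'cV[R]_n) (u : 'cV[R]_m) : 'M[R]_(n, m) :=
  \matrix_(i, j) 'D_(basis_vec R j) phi u i 0.

Lemma jacE m n (phi : 'cV[R]_m -> 'cV[R]_n) u b : differentiable phi u ->
  jac phi u *m b = 'D_b phi u.
Proof.
move=> dphi; rewrite (derive_basis b dphi); apply/colP => i.
by rewrite mxE summxE; apply: eq_bigr => j _; rewrite !mxE mulrC.
Qed.

Lemma smooth_jac m n (Om : set 'cV[R]_m) (phi : 'cV[R]_m -> 'cV[R]_n) : open Om ->
  smooth Om phi -> smooth Om (jac phi).
Proof.
move=> oOm phis j; apply: Ck_mxP => // i k.
rewrite (_ : (fun x => _) = fun x => 'D_(basis_vec R k) phi x i 0); last first.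
  by apply/funext => x; rewrite mxE.
by apply: Ck_entry => //; exact: smoothD.
Qed.

Section Chart.
Variables (n d : nat) (M : set 'cV[R]_n) (Om : set 'cV[R]_d) (phi : 'cV[R]_d -> 'cV[R]_n).
Hypothesis lp : local_param M Om phi.

Let oOm : open Om := lp.1.
Let phis : smooth Om phi := chart_smooth lp.
Let dphi u (Ou : Om u) : differentiable phi u := smooth_diff phis Ou.

Lemma jac_unit u : Om u -> (jac phi u)^T *m jac phi u \in unitmx.
Proof.
move=> Ou; apply: mulmx_inj_unit => c; rewrite jacE; last exact: dphi.
by rewrite -(derive0 phi u); exact: chart_diff_inj lp Ou.
Qed.

Lemma tangent_jac u v : Om u -> tangent M (phi u) v <-> exists c, v = jac phi u *m c.
Proof.
move=> Ou; rewrite (tangent_chart v (findim_cV n) lp Ou).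
by split => -[c ->]; exists c; rewrite jacE //; exact: dphi.
Qed.

Lemma pj_jac u : Om u -> is_orthoproj (tangent M (phi u)) (pj (jac phi u)).
Proof.
move=> Ou; have [a b c] := pj_orthoproj (jac_unit Ou); split => // v.
exact: iff_trans (tangent_jac v Ou) (c v).
Qed.

Lemma projT_chart u : Om u -> projT M (phi u) = pj (jac phi u).
Proof.
move=> Ou; apply: xget_unique; first exact: pj_jac.
by move=> P /= hP; apply: orthoproj_unique hP (pj_jac Ou).
Qed.

Lemma smooth_projT_chart : smooth Om (fun u => projT M (phi u)).
Proof.
apply: (smooth_ext oOm (f := fun u => pj (jac phi u))) => [u Ou|j]; first by rewrite projT_chart.
by apply: Ck_pj => //; [exact: jac_unit|exact: smooth_jac].
Qed.

Variable f : 'cV[R]_n -> R.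
Hypothesis f2 : Ck 2 setT f.

Let F u := f (phi u).

Let FC : Ck 2 Om F.
Proof.
exact: (Ck_comp (findim_cV n) (findim_R (R := R)) oOm (fun _ _ => I) (phis 2%N) f2).
Qed.

Let df y : differentiable f y.
Proof. by have [h _] := f2; exact: h. Qed.

Definition coord_grad u : 'cV[R]_d := \col_j 'D_(basis_vec R j) F u.

Lemma rgrad_spec u : Om u -> let g := jac phi u *m invmx ((jac phi u)^T *m jac phi u) *m coord_grad u in
  tangent M (phi u) g /\ forall v, tangent M (phi u) v -> inner g v = 'D_v f (phi u).
Proof.
move=> Ou g; split; first by apply/(tangent_jac _ Ou); exists (invmx ((jac phi u)^T *m jac phi u) *m coord_grad u); rewrite /g mulmxA.
move=> v /(tangent_jac _ Ou)[c ->].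
rewrite jacE; last exact: dphi.
rewrite -derive_comp; [|exact: dphi|exact: df].
rewrite -jacE; last exact: dphi.
rewrite innerC inner_mulmx /g !mulmxA mulmxV ?jac_unit // mul1mx.
rewrite innerE big_ord1 derive_basis; last by have [h _] := FC; exact: h.
by apply: eq_bigr => i _; rewrite mxE.
Qed.

Lemma rgrad_chart u : Om u ->
  rgrad M f (phi u) = jac phi u *m invmx ((jac phi u)^T *m jac phi u) *m coord_grad u.
Proof.
move=> Ou; have [gT gE] := rgrad_spec Ou; apply: xget_unique => //= g' [g'T g'E].
apply/eqP; rewrite -subr_eq0; apply/eqP; apply: inner_eq0.
set g := _ *m coord_grad u in gT gE *.
have T : tangent M (phi u) (g' - g).
  have /(tangent_jac _ Ou)[c ->] := g'T; have /(tangent_jac _ Ou)[c' ->] := gT.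
  by apply/(tangent_jac _ Ou); exists (c - c'); rewrite mulmxBr.
have -> : g' - g = - 1 *: g + g' by rewrite scaleN1r addrC.
have -> : - 1 *: g + g' = g' - g by rewrite scaleN1r addrC.
have := innerDl (- 1) g g' (g' - g); rewrite scaleN1r addrC => ->.
by rewrite (gE _ T) (g'E _ T) mulN1r addNr.
Qed.

Let coord_rgrad_Ck k : Ck k.+1 Om F ->
  Ck k Om (fun u => jac phi u *m invmx ((jac phi u)^T *m jac phi u) *m coord_grad u).
Proof.
move=> [_ FD]; have jC : Ck k Om (jac phi) by exact: smooth_jac.
apply: Ck_mulmx => //.
  apply: Ck_mulmx => //; apply: Ck_invmx => //; first by move=> u Ou; exact: jac_unit.
  by apply: Ck_mulmx => //; exact: Ck_trmx.
apply: Ck_mxP => // i l.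
rewrite (_ : (fun x => _) = fun x => 'D_(basis_vec R i) F x); last first.
  by apply/funext => x; rewrite mxE.
exact: FD.
Qed.

Lemma rgrad_chart_Ck1 : Ck 1 Om (fun u => rgrad M f (phi u)).
Proof.
apply: (Ck_ext oOm _ (coord_rgrad_Ck FC)).
by move=> u Ou; rewrite rgrad_chart.
Qed.

(** Differentiating the identity that pairs ['D_c phi] with the gradient to give ['D_c F] expresses
    the form as a second derivative of [F] minus a term in the second derivatives of [phi];
    [derive_swap] makes both symmetric. *)
Lemma hess_form_sym u a b : Om u ->
  inner ('D_a phi u) ('D_b (fun v => rgrad M f (phi v)) u) =
  inner ('D_b phi u) ('D_a (fun v => rgrad M f (phi v)) u).
Proof.
move=> Ou; set rg := fun v => rgrad M f (phi v).
have drg : differentiable rg u by have [h _] := rgrad_chart_Ck1; exact: h.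
have rgT c v : Om v -> inner ('D_c phi v) (rg v) = 'D_c F v.
  move=> Ov; have [_ H] := rgrad_spec Ov.
  rewrite innerC /rg rgrad_chart // H.
    by rewrite -derive_comp //; exact: dphi.
  by apply/(tangent_jac _ Ov); exists c; rewrite jacE //; exact: dphi.
have E c c' : 'D_c' (fun v => 'D_c F v) u =
   inner ('D_c' (fun v => 'D_c phi v) u) (rg u) + inner ('D_c phi u) ('D_c' rg u).
  have H1 : is_derive u c' (fun v => 'D_c phi v) ('D_c' (fun v => 'D_c phi v) u).
    by apply: derivableP; apply: diff_derivable; apply: smooth_diff (smoothD c phis) Ou.
  have H2 : is_derive u c' rg ('D_c' rg u) by apply: derivableP; exact: diff_derivable.
  have [_ <-] := is_derive_inner H1 H2; apply: near_eq_derive.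
  by apply: filterS (open_near oOm Ou) => v Ov; rewrite rgT.
have swap : 'D_b (fun v => 'D_a phi v) u = 'D_a (fun v => 'D_b phi v) u.
  have comp c c' i : ('D_c' (fun v => 'D_c phi v) u) i 0 = 'D_c' (fun v => 'D_c (fun z => phi z i 0) v) u.
    rewrite derive_mx; last by apply: diff_derivable; apply: smooth_diff (smoothD c phis) Ou.
    rewrite mxE; apply: near_eq_derive; apply: filterS (open_near oOm Ou) => v Ov.
    by rewrite derive_mx ?mxE //; apply: diff_derivable; exact: dphi.
  apply/colP => i.
  apply: (etrans (comp a b i)); apply: (etrans _ (esym (comp b a i))).
  have h : Ck 2 Om (fun z => phi z i 0) := Ck_entry i 0 oOm (phis 2%N).
  exact: (derive_swap b a oOm Ou h).
have H1 := E a b; have H2 := E b a.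
have H3 := derive_swap b a oOm Ou FC.
have fin (X X' Y Z D1 D2 : R) : D1 = X + Y -> D2 = X' + Z -> D1 = D2 -> X = X' -> Y = Z.
  by move=> -> -> E12 XX; move: E12; rewrite XX => /addrI.
exact: (fin _ _ _ _ _ _ H1 H2 H3 (congr1 (fun y => inner y (rg u)) swap)).
Qed.

Lemma rhess_sym_chart u : Om u -> (rhess M f (phi u))^T = rhess M f (phi u).
Proof.
move=> Ou; set J := jac phi u; set P := projT M (phi u).
have PE : P = pj J by exact: projT_chart.
have Psym : P^T = P by rewrite PE pj_sym.
have drg : differentiable (fun v => rgrad M f (phi v)) u by have [h _] := rgrad_chart_Ck1; exact: h.
(* Coordinates in the chart of the projection of the basis vector [j] onto the tangent space. *)
pose c j := invmx (J^T *m J) *m J^T *m basis_vec R j.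
have Pe j : P *m basis_vec R j = 'D_(c j) phi u.
  by rewrite -jacE ?PE /pj /c ?mulmxA //; exact: dphi.
have E i j : rhess M f (phi u) i j =
    inner ('D_(c i) phi u) ('D_(c j) (fun v => rgrad M f (phi v)) u).
  rewrite mxE -/P Pe (tdiff_chart _ (findim_cV n) lp Ou drg) -Pe inner_mulmx Psym.
  have be l : basis_vec R i l 0 = (l == i)%:R by rewrite mxE eqxx andbT.
  rewrite innerE big_ord1 (bigD1 i) //= big1 => [|l li].
    by rewrite be eqxx mul1r addr0.
  by rewrite be (negPf li) mul0r.
by apply/matrixP => i j; rewrite [LHS]mxE (E j i) (E i j); exact: hess_form_sym.
Qed.

End Chart.

Section Manifold.
Variables (n d : nat) (M : set 'cV[R]_n).
Hypothesis subM : submanifold d M.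

Lemma projTP x : M x -> is_orthoproj (tangent M x) (projT M x).
Proof.
move=> /subM[Om [phi [lp [u Ou <-]]]]; rewrite (projT_chart lp Ou).
exact: (pj_jac lp Ou).
Qed.

Lemma projT_sym x : M x -> (projT M x)^T = projT M x.
Proof. by move=> /projTP[]. Qed.

Lemma projT_idem x : M x -> projT M x *m projT M x = projT M x.
Proof. by move=> /projTP[]. Qed.

Lemma tangentP x v : M x -> tangent M x v <-> projT M x *m v = v.
Proof. by move=> /projTP[]. Qed.

Lemma projT_smooth x : M x -> exists (O : set 'cV[R]_n) (P : 'cV[R]_n -> 'M[R]_n),
  [/\ open O, O x, smooth O P & forall y, M y -> O y -> projT M y = P y].
Proof.
move=> /subM[Om [phi [lp [u Ou <-]]]].
have [Q [g [oQ Qu gs gO [gE _]]]] := chart_inv lp Ou.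
exists Q, (fun y => projT M (phi (g y))); split => //.
  exact: (smooth_comp (findim_cV d) (findim_mx n n) oQ gO gs (smooth_projT_chart lp)).
by move=> y My Qy; rewrite gE.
Qed.

Lemma rhess_sym f x : Ck 2 setT f -> M x -> (rhess M f x)^T = rhess M f x.
Proof.
by move=> f2 /subM[Om [phi [lp [u Ou <-]]]]; exact: (rhess_sym_chart lp f2 Ou).
Qed.

Lemma rgrad_tangent f x : Ck 2 setT f -> M x -> tangent M x (rgrad M f x).
Proof.
move=> f2 /subM[Om [phi [lp [u Ou <-]]]].
by rewrite (rgrad_chart lp f2 Ou); have [] := rgrad_spec lp f2 Ou.
Qed.

Lemma projT_rhess f x : M x -> projT M x *m rhess M f x = rhess M f x.
Proof.
move=> Mx; apply/matrixP => i j.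
have E : rhess M f x i j = (projT M x *m (projT M x *m tdiff M (rgrad M f) x (projT M x *m basis_vec R j))) i 0.
  by rewrite mulmxA projT_idem // mxE.
rewrite E [LHS]mxE [RHS]mxE; apply: eq_bigr => l _; congr (_ * _).
by rewrite mxE.
Qed.

End Manifold.
End Submanifolds.

(** * The Grassmann bundle *)

Lemma open_neq0 (R : realType) : open [set y : R | y != 0].
Proof.
rewrite (_ : [set y : R | y != 0] = ~` [set 0]); last by apply/seteqP; split => y /= /eqP.
by apply: closed_openC; exact: closed_eq.
Qed.

Section GrassmannBundle.
Context {R : realType}.

Lemma is_derive_fst (V W : normedModType R) (c : R -> V * W) (t : R) D :
  is_derive t (1 : R) c D -> is_derive t (1 : R) (fun t => (c t).1) D.1.
Proof.
move=> H; have fc : continuous (fst : V * W -> V) by move=> x; exact: cvg_fst.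
have df : differentiable (fst : V * W -> V) (c t) by exact: linear_differentiable.
have := is_derive_curve H df; rewrite deriveE // diff_lin //.
Qed.

Lemma is_derive_snd (V W : normedModType R) (c : R -> V * W) (t : R) D :
  is_derive t (1 : R) c D -> is_derive t (1 : R) (fun t => (c t).2) D.2.
Proof.
move=> H; have fc : continuous (snd : V * W -> W) by move=> x; exact: cvg_snd.
have df : differentiable (snd : V * W -> W) (c t) by exact: linear_differentiable.
have := is_derive_curve H df; rewrite deriveE // diff_lin //.
Qed.

Variables (n d k : nat) (M : set 'cV[R]_n).
Hypothesis subM : submanifold d M.
Notation S := (grass_bundle k M).

Lemma grass_projT w : S w -> projT M w.1 *m w.2 = w.2.
Proof.
move=> [Mx [_ _ _ PT]]; apply/matrixP => i j.
have /(tangentP subM _ Mx)/(congr1 (fun A : 'cV_n => A i 0)) := PT (basis_vec R j).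
have E (A : 'M[R]_n) : (A *m basis_vec R j) i 0 = A i j.
  by rewrite mxE (bigD1 j) //= big1 => [|l lj]; rewrite mxE ?eqxx ?mulr1 ?addr0 // (negPf lj) mulr0.
by rewrite mulmxA !E.
Qed.

Lemma grass_projTr w : S w -> w.2 *m projT M w.1 = w.2.
Proof.
move=> Sw; have [Mx [Ps _ _ _]] := Sw.
by rewrite -[LHS]trmxK trmx_mul (projT_sym subM Mx) Ps grass_projT.
Qed.

Lemma compress_linear x a (A B : 'M[R]_n) :
  compress M x (a *: A + B) = a *: compress M x A + compress M x B.
Proof. by rewrite /compress mulmxDr mulmxDl -scalemxAr -scalemxAl. Qed.

(* A tangent vector with zero horizontal part moves [P] with a stationary tangent projector
   [Pi]; differentiating [P = Pi P Pi] shows that its vertical part equals its compression. *)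
Lemma sasaki_pos w D : S w -> tangent S w D -> sasaki M w D D = 0 -> D = 0.
Proof.
move=> Sw [c [J [oJ J0 cs cS [c0 c'0]]]] /eqP.
rewrite paddr_eq0 ?inner_ge0 // => /andP[/eqP/inner_eq0 D1 /eqP/inner_eq0 D2].
have cD : is_derive 0 (1 : R) c D by rewrite -c'0; exact: smooth_is_derive cs J0.
have d1 := is_derive_fst cD; have d2 := is_derive_snd cD.
have [Mx _] := Sw; have [Om [phi [lp [u Ou phiu]]]] := subM Mx.
have c1 : curve_through M (phi u) 0 (fun t => (c t).1).
  exists J; split => //; first by move=> j; apply: Ck_fst => //; exact: cs.
    by move=> t /cS[].
  split; first by rewrite c0 -phiu.
  by rewrite -D1 derive1E; have [_] := d1.
have [K [v [b [oK K0 vs vc [v0 v'0 Db]]]]] := curve_chart_velocity (findim_cV n) lp Ou c1.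
have b0 : b = 0 by apply: (chart_diff_inj lp Ou); rewrite Db derive0.
have dP : is_derive 0 (1 : R) (fun t => projT M (c t).1) 0.
  have vD : is_derive 0 (1 : R) v b by rewrite -v'0; exact: smooth_is_derive vs K0.
  have dp : differentiable (fun u => projT M (phi u)) (v 0).
    by rewrite v0; exact: smooth_diff (smooth_projT_chart lp) Ou.
  have := is_derive_curve vD dp; rewrite b0 derive0.
  by apply: near_eq_is_derive; apply: filterS (open_near oK K0) => t /vc[_ ->].
have := is_derive_mulmx (is_derive_mulmx dP d2) dP.
rewrite c0 mul0mx add0r mulmx0 addr0 -/(compress M w.1 D.2) D2 => dPP.
have D20 : D.2 = 0.
  apply: (is_derive_unique d2); apply: near_eq_is_derive dPP.
  apply: filterS (open_near oJ J0) => t Jt.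
  by rewrite grass_projT ?grass_projTr //; exact: cS.
by rewrite [D]surjective_pairing D1 D20.
Qed.

Lemma smooth_projT_comp (V : normedModType R) (U : set V) (f : V -> 'cV[R]_n) : open U ->
  smooth U f -> (forall u, U u -> M (f u)) -> smooth U (fun u => projT M (f u)).
Proof.
move=> oU fs fM j; apply: Ck_local => x Ux.
have [Q [P [oQ Qx Ps PE]]] := projT_smooth subM (fM x Ux).
exists (U `&` f @^-1` Q), (fun y => P (f y)); split => //.
- exact: open_smooth_preimage.
- have oI : open (U `&` f @^-1` Q) by exact: open_smooth_preimage.
  apply: (Ck_comp (findim_cV n) (findim_mx n n) oI (U' := Q)) (Ps j); first by move=> y [].
  by apply: Ck_sub (fs j); exact: subIsetl.
- by move=> y [Uy Qy]; rewrite PE //; exact: fM.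
Qed.

Lemma Ck_inner (V : normedModType R) j (U : set V) p q (A B : V -> 'M[R]_(p, q)) : open U ->
  Ck j U A -> Ck j U B -> Ck j U (fun x => inner (A x) (B x)).
Proof.
move=> oU AC BC.
rewrite (_ : (fun x => _) = fun x => \sum_l \sum_i A x i l * B x i l); last first.
  by apply/funext => x; rewrite innerE.
by apply: Ck_sum => // l _; apply: Ck_sum => // i _; apply: Ck_mul => //; exact: Ck_entry.
Qed.

Lemma sasaki_metric : metric_on S (sasaki M).
Proof.
split.
- move=> w a D D' X; rewrite /sasaki /= compress_linear !innerDl; ring.
- by move=> w D X; rewrite /sasaki innerC [inner (compress _ _ _) _]innerC.
- by move=> w D; rewrite addr_ge0 // inner_ge0.
- exact: sasaki_pos.
move=> m Om phi lp i j; have oOm := lp.1; have phis := chart_smooth lp.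
have Ps : smooth Om (fun u => projT M (phi u).1).
  apply: smooth_projT_comp => //; first by move=> l; apply: Ck_fst => //; exact: phis.
  by move=> u Ou; have [] := chart_mem lp Ou.
move=> l; rewrite (_ : (fun u => _) = fun u => sasaki M (phi u) ('D_(basis_vec R i) phi u) ('D_(basis_vec R j) phi u)); last first.
  by apply/funext => u; rewrite mxE.
have D1 a : Ck l Om (fun u => ('D_(basis_vec R a) phi u).1) by apply: Ck_fst => //; exact: smoothD.
have D2 a : Ck l Om (fun u => ('D_(basis_vec R a) phi u).2) by apply: Ck_snd => //; exact: smoothD.
have C a : Ck l Om (fun u => compress M (phi u).1 ('D_(basis_vec R a) phi u).2).
  by apply: Ck_mulmx => //; apply: Ck_mulmx.
by apply: Ck_add => //; apply: Ck_inner.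
Qed.

Lemma sum_col_outer (A : 'M[R]_n) (V : 'M[R]_(n, k)) :
  \sum_(l < k) (A *m col l V) *m (col l V)^T = A *m (V *m V^T).
Proof.
apply/matrixP => i j; rewrite summxE mulmxA [RHS]mxE; apply: eq_bigr => l _.
rewrite [LHS]mxE big_ord1 [(col l V)^T _ _]mxE [col l V _ _]mxE [V^T _ _]mxE; congr (_ * _).
by rewrite !mxE; apply: eq_bigr => q _; rewrite mxE.
Qed.

Lemma frameP w : S w -> (frame k w.2)^T *m frame k w.2 = 1%:M /\ w.2 = frame k w.2 *m (frame k w.2)^T.
Proof.
move=> [_ [Ps PP Pk _]]; have [V hV] := frame_exists Ps PP Pk.
exact: (@xgetPex _ 0 [set V : 'M[R]_(n, k) | V^T *m V = 1%:M /\ w.2 = V *m V^T] (ex_intro _ V hV)).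
Qed.

(** The frame enters only through [V *m V^T], which is the projector itself, so the choice made by
    [frame] disappears. *)
Lemma IIhatE w de : S w -> IIhat k M w.1 de w.2 =
  tdiff M (projT M) w.1 de *m w.2 + (tdiff M (projT M) w.1 de *m w.2)^T.
Proof.
move=> Sw; have [_ PV] := frameP Sw; rewrite /IIhat /II sum_col_outer -PV; congr (_ + _).
rewrite [in RHS]PV -sum_col_outer raddf_sum; apply: eq_bigr => l _ /=.
by rewrite [RHS]trmx_mul trmxK.
Qed.

Lemma pj_orthonormal (V : 'M[R]_(n, k)) : V^T *m V = 1%:M -> pj V = V *m V^T.
Proof. by move=> VV; rewrite /pj VV invmx1 mulmx1. Qed.

Lemma pj_grassmann x (B : 'M[R]_(n, k)) : M x -> B^T *m B \in unitmx ->
  projT M x *m B = B -> S (x, pj B).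
Proof.
move=> Mx BU PB; split => //=; split; [exact: pj_sym|exact: pj_idem|exact: pj_rank|].
move=> v; apply/(tangentP subM _ Mx); rewrite mulmxA; congr (_ *m _).
by rewrite /pj !mulmxA PB.
Qed.

(* With [phi] a chart, [phi u = x], [D_b phi u = h1] and [P = V V^T], the field is the velocity
   at 0 of the curve of base point [phi (u + t b)] whose second component projects onto the
   range of [Pi(phi (u + t b)) (P - t H) V]. *)
Lemma hfield_tangent f w : Ck 2 setT f -> S w -> gtangent k M w (hfield k M f w).
Proof.
move=> f2 Sw; have [Mx [Ps PP Pk PT]] := Sw.
set P := w.2; set x := w.1; set H := rhess M f x; set V := frame k P.
have [VV PV] := frameP Sw; rewrite -/P -/V in VV PV.
have Hs : H^T = H by exact: (rhess_sym subM f2 Mx).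
have PiH : projT M x *m H = H by exact: (projT_rhess subM f Mx).
have PiP : projT M x *m P = P by exact: grass_projT.
have PPi : P *m projT M x = P by exact: grass_projTr.
have hT : tangent M x (h1 M f w).
  apply/(tangentP subM _ Mx); rewrite /h1 /reflection mulmxN mulmxBr -scalemxAr mulmxA PiP.
  by have /(tangentP subM _ Mx) -> := rgrad_tangent subM f2 Mx.
have [Om [phi [lp [u Ou phiu]]]] := subM Mx.
have [b hb] : exists b, h1 M f w = 'D_b phi u by apply/(tangent_chart _ (findim_cV n) lp Ou); rewrite phiu.
have ls := smooth_line u b openT (findim_cV d).
pose J1 : set R := setT `&` (fun t : R => u + t *: b) @^-1` Om.
have oJ1 : open J1 by exact: open_smooth_preimage openT lp.1 ls.
have J10 : J1 0 by split => //; rewrite /preimage /= scale0r addr0.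
pose ga (t : R) := phi (u + t *: b).
pose Pi (t : R) := projT M (ga t).
pose Bt (t : R) := Pi t *m ((P - t *: H) *m V).
have gaC : smooth J1 ga.
  apply: (smooth_comp (findim_cV d) (findim_cV n) oJ1 (U' := Om)); first by move=> t [].
    by apply: smooth_sub ls.
  exact: chart_smooth lp.
have gaM t : J1 t -> M (ga t) by move=> [_ Ot]; exact: chart_mem lp Ot.
have PiC : smooth J1 Pi by exact: smooth_projT_comp.
have lineC : smooth J1 (fun t : R => (P - t *: H) *m V).
  move=> j; apply: Ck_mulmx => //; last exact: Ck_cst.
  by apply: Ck_sub_fun => //; [exact: Ck_cst|apply: Ck_scalel => //; exact: Ck_id].
have BtC : smooth J1 Bt by move=> j; apply: Ck_mulmx.
have detC : smooth J1 (fun t => \det ((Bt t)^T *m Bt t)).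
  by move=> j; apply: Ck_det => //; apply: Ck_mulmx => //; apply: Ck_trmx.
(* The times at which [Bt] has full rank, so that [pj (Bt t)] is a projector of rank [k]. *)
pose J : set R := J1 `&` (fun t => \det ((Bt t)^T *m Bt t)) @^-1` [set y : R | y != 0].
have oJ : open J.
  exact: (open_smooth_preimage oJ1 (@open_neq0 R) detC).
have ga0 : ga 0 = x by rewrite /ga scale0r addr0 phiu.
have PiV : projT M x *m V = V.
  have PV' : P *m V = V by rewrite PV -mulmxA VV mulmx1.
  by rewrite -PV' mulmxA PiP.
have PVV : P *m V = V by rewrite PV -mulmxA VV mulmx1.
have Bt0 : Bt 0 = V by rewrite /Bt /Pi ga0 scale0r subr0 PVV PiV.
have J0 : J 0 by split => //; rewrite /preimage /= Bt0 VV det1 oner_neq0.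
have BtU t : J t -> (Bt t)^T *m Bt t \in unitmx.
  by move=> [_ h]; rewrite unitmxE unitfE.
have JJ1 : J `<=` J1 by apply: subIsetl.
have cC : smooth J (fun t => (ga t, pj (Bt t))).
  move=> j; apply: Ck_pair => //; [exact: findim_cV|exact: findim_mx|exact: (Ck_sub JJ1 (gaC j))|].
  by apply: Ck_pj => //; exact: (Ck_sub JJ1 (BtC j)).
exists (fun t => (ga t, pj (Bt t))), J; split => //.
  move=> t Jt; apply: pj_grassmann; [exact/gaM/JJ1|exact: BtU|].
  by rewrite /Bt mulmxA (projT_idem subM) //; exact/gaM/JJ1.
split; first by rewrite ga0 Bt0 pj_orthonormal // -PV /x /P -surjective_pairing.
have dphi := smooth_diff (chart_smooth lp) Ou.
have dga : is_derive 0 (1 : R) ga (h1 M f w) by rewrite hb; exact: is_derive_dir.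
set Pi' := tdiff M (projT M) x (h1 M f w).
have dpr : differentiable (fun u => projT M (phi u)) u by exact: smooth_diff (smooth_projT_chart lp) Ou.
have dPi : is_derive 0 (1 : R) Pi Pi'.
  by rewrite /Pi' /x -phiu hb (tdiff_chart b (findim_cV n) lp Ou dpr); exact: is_derive_dir.
have Pi'sym : Pi'^T = Pi'.
  apply: (is_derive_unique (is_derive_trmx dPi)); apply: near_eq_is_derive dPi.
  by apply: filterS (open_near oJ1 J10) => t Jt; rewrite (projT_sym subM) //; exact: gaM.
have Pi'Pi : Pi' *m projT M x + projT M x *m Pi' = Pi'.
  have := is_derive_mulmx dPi dPi; rewrite /Pi ga0 => H2; apply: (is_derive_unique H2).
  apply: near_eq_is_derive dPi.
  by apply: filterS (open_near oJ1 J10) => t Jt; rewrite (projT_idem subM) //; exact: gaM.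
(* Differentiating [Pi *m Pi = Pi] shows that [Pi'] has no tangential block, and the range of [P] is
   tangent. *)
have PPi'P : P *m Pi' *m P = 0.
  have E : P *m Pi' *m P + P *m Pi' *m P = P *m Pi' *m P.
    by rewrite -[in RHS]Pi'Pi mulmxDr mulmxDl !mulmxA PPi -[P *m Pi' *m _ *m P]mulmxA PiP.
  by apply: (addrI (P *m Pi' *m P)); rewrite E addr0.
have dlin : is_derive 0 (1 : R) (fun t : R => (P - t *: H) *m V) (- H *m V).
  have d1 : is_derive 0 (1 : R) (fun t : R => P - t *: H) (- H).
    have := is_derive_line P (- H) 0; congr is_derive; apply/funext => t.
    by rewrite scalerN.
  have d2 : is_derive 0 (1 : R) (fun t : R => V) 0 by exact: is_derive_cst.
  by have := is_derive_mulmx d1 d2; rewrite mulmx0 addr0.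
have dBt : is_derive 0 (1 : R) Bt (Pi' *m V - H *m V).
  have := is_derive_mulmx dPi dlin; rewrite scale0r subr0 PVV /Pi ga0.
  by rewrite mulNmx mulmxN mulmxA PiH.
have pC : smooth J (fun t => pj (Bt t)) by move=> j; exact: (Ck_snd oJ (cC j)).
pose D := derive1 (fun t => pj (Bt t)) 0.
have dp : is_derive 0 (1 : R) (fun t => pj (Bt t)) D by exact: smooth_is_derive pC J0.
have pj0 : pj (Bt 0) = P by rewrite Bt0 pj_orthonormal.
have Dsym : D^T = D.
  apply: (is_derive_unique (is_derive_trmx dp)); apply: near_eq_is_derive dp.
  by apply: filterS (open_near oJ J0) => t Jt; rewrite pj_sym.
(* The derivative of [pj (Bt t) *m Bt t = Bt t] gives [D *m V], hence [D *m P]. Idempotence then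
   splits [D] into [D *m P] and [P *m D], which is the transpose of [D *m P]. *)
have DV : D *m V + P *m (Pi' *m V - H *m V) = Pi' *m V - H *m V.
  have := is_derive_mulmx dp dBt; rewrite Bt0 pj_orthonormal // -PV => H2; apply: (is_derive_unique H2).
  apply: near_eq_is_derive dBt.
  by apply: filterS (open_near oJ J0) => t Jt; rewrite pj_mul //; exact: BtU.
have DP : D *m P + P *m D = D.
  have := is_derive_mulmx dp dp; rewrite pj0 => H2; apply: (is_derive_unique H2).
  apply: near_eq_is_derive dp.
  by apply: filterS (open_near oJ J0) => t Jt; rewrite pj_idem //; exact: BtU.
have DPE : D *m P = Pi' *m P - H *m P + P *m H *m P.
  have DVE : D *m V = (Pi' *m V - H *m V) - P *m (Pi' *m V - H *m V).
    by apply/eqP; rewrite eq_sym subr_eq DV.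
  have DVE2 : D *m V = ((Pi' - H) - P *m (Pi' - H)) *m V.
    by rewrite DVE -mulmxBl mulmxA -mulmxBl.
  have -> : D *m P = (D *m V) *m V^T by rewrite -mulmxA -PV.
  by rewrite DVE2 -mulmxA -PV mulmxBr !mulmxBl PPi'P sub0r opprK.
have PD : P *m D = (D *m P)^T by rewrite trmx_mul Dsym Ps.
have trD (A B : 'M[R]_n) : (A + B)^T = A^T + B^T by rewrite linearD.
have trN (A : 'M[R]_n) : (- A)^T = - A^T by rewrite linearN.
have PDE : P *m D = P *m Pi' - P *m H + P *m H *m P.
  rewrite PD DPE !trD trN.
  rewrite (_ : (Pi' *m P)^T = P *m Pi'); last by rewrite trmx_mul Pi'sym Ps.
  rewrite (_ : (H *m P)^T = P *m H); last by rewrite trmx_mul Hs Ps.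
  by rewrite (_ : (P *m H *m P)^T = P *m H *m P) // !trmx_mul Hs Ps mulmxA.
have CE : commutator P (commutator P H) = (P *m H - P *m H *m P) - (P *m H *m P - H *m P).
  rewrite /commutator mulmxBr mulmxBl; congr (_ - _); first by rewrite !mulmxA PP.
  by rewrite -[H *m P *m P]mulmxA PP.
have zident (a1 a2 a3 a4 a5 : 'M[R]_n) :
    (a1 - a2 + a3) + (a4 - a5 + a3) = - ((a5 - a3) - (a3 - a2)) + (a1 + a4).
  by apply/matrixP => i j; rewrite !mxE; ring.
have DE : D = h2 k M f w.
  rewrite -DP DPE PDE zident -CE /h2 (IIhatE _ Sw) -/Pi'.
  by rewrite (_ : (Pi' *m P)^T = P *m Pi') // trmx_mul Pi'sym Ps.
rewrite /hfield -DE derive1E; have [_ E] := is_derive_pair dga dp.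
exact: E.
Qed.

End GrassmannBundle.

(** * Charts of the Grassmann bundle over a chart of the base *)

Section GrassmannCharts.
Context {R : realType}.

(** The columns of [A^T] become the first [k] columns of an invertible matrix. *)
Lemma row_free_complete k e (A : 'M[R]_(k, k + e)) : row_free A ->
  exists2 C : 'M[R]_(k + e), C \in unitmx & C *m col_mx 1%:M 0 = A^T.
Proof.
move=> Af; pose D : 'M[R]_(k + e) := block_mx (col_ebase A) 0 0 1%:M.
exists (D *m row_ebase A)^T.
  rewrite unitmx_tr unitmx_mul row_ebase_unit andbT unitmxE det_ublock det1 mulr1.
  by rewrite -unitmxE col_ebase_unit.
rewrite -[LHS]trmxK trmx_mul trmxK tr_col_mx trmx1 trmx0; congr (_^T).
rewrite -[RHS](mulmx_ebase A) (eqP Af) mulmxA mul_row_block !mul1mx !mul0mx !addr0.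
by rewrite pid_mx_row mul_mx_row mulmx1 mulmx0.
Qed.

Variables (n k e : nat) (M : set 'cV[R]_n).
Variables (Om : set 'cV[R]_(k + e)) (phi : 'cV[R]_(k + e) -> 'cV[R]_n).
Variables (V : 'M[R]_(n, k)) (C : 'M[R]_(k + e)).
Hypothesis subM : submanifold (k + e) M.
Hypothesis lp : local_param M Om phi.
Hypothesis CU : C \in unitmx.
Notation N := (k + e + e * k)%N.

(** A coordinate vector is a point in the chart of [M] followed by a flattened [e] by [k] slope
    matrix. *)
Definition gc_base (z : 'cV[R]_N) : 'cV[R]_(k + e) := usubmx z.
Definition gc_fiber (z : 'cV[R]_N) : 'M[R]_(e, k) := vec_mx (dsubmx z)^T.
Definition gc_join (u : 'cV[R]_(k + e)) (X : 'M[R]_(e, k)) : 'cV[R]_N := col_mx u (mxvec X)^T.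

Lemma gc_joinK z : gc_join (gc_base z) (gc_fiber z) = z.
Proof. by rewrite /gc_join /gc_fiber vec_mxK trmxK vsubmxK. Qed.

Lemma gc_base_join u X : gc_base (gc_join u X) = u.
Proof. by rewrite /gc_base col_mxKu. Qed.

Lemma gc_fiber_join u X : gc_fiber (gc_join u X) = X.
Proof. by rewrite /gc_fiber col_mxKd trmxK mxvecK. Qed.

Lemma gc_base_Ck j : Ck j setT gc_base.
Proof.
apply: Ck_mxP => [|a b]; first exact: openT.
rewrite (_ : (fun x => _) = fun z : 'cV_N => z (lshift _ a) b); last by apply/funext => z; rewrite mxE.
by apply: Ck_entry; [exact: openT|exact: Ck_id].
Qed.

Lemma gc_fiber_Ck j : Ck j setT gc_fiber.
Proof.
apply: Ck_mxP => [|a b]; first exact: openT.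
rewrite (_ : (fun x => _) = fun z : 'cV_N => z (rshift _ (mxvec_index a b)) 0); last first.
  by apply/funext => z; rewrite !mxE.
by apply: Ck_entry; [exact: openT|exact: Ck_id].
Qed.

Lemma gc_join_Ck (W : normedModType R) j (U : set W) (u : W -> 'cV[R]_(k + e)) (X : W -> 'M[R]_(e, k)) :
  open U -> Ck j U u -> Ck j U X -> Ck j U (fun y => gc_join (u y) (X y)).
Proof.
move=> oU uC XC; apply: Ck_mxP => // i b; rewrite ord1.
case: (split_ordP i) => [i' ->|i' ->].
  rewrite (_ : (fun y => _) = fun y => u y i' 0); first exact: Ck_entry.
  by apply/funext => y; rewrite col_mxEu.
case: (mxvec_indexP i') => p q.
rewrite (_ : (fun y => _) = fun y => X y p q); first exact: Ck_entry.
by apply/funext => y; rewrite col_mxEd mxE mxvecE.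
Qed.

(* Over the chart [phi], a [k]-plane near the given one has a unique basis of the form
   [J(u) C [1; X]], where [J] is the Jacobian matrix of [phi]. *)
Definition gc_frame (z : 'cV[R]_N) : 'M[R]_(n, k) :=
  jac phi (gc_base z) *m C *m col_mx 1%:M (gc_fiber z).

Definition gc_param (z : 'cV[R]_N) : 'cV[R]_n * 'M[R]_n := (phi (gc_base z), pj (gc_frame z)).

(** The determinant condition says that the plane projects isomorphically onto the range of the
    reference frame [V]. *)
Definition gc_dom : set 'cV[R]_N :=
  [set z | Om (gc_base z) /\ \det (V^T *m gc_frame z) != 0].

(** For a projector [Q] onto tangent vectors, the coordinates of the columns of [Q *m V] in the
    basis formed by the columns of [jac phi u *m C]. *)
Definition gc_coord (u : 'cV[R]_(k + e)) (Q : 'M[R]_n) : 'M[R]_(k + e, k) :=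
  invmx C *m (invmx ((jac phi u)^T *m jac phi u) *m (jac phi u)^T *m (Q *m V)).

(** Unchanged when [Y] is multiplied on the right by an invertible matrix, that is, under a change
    of basis of the plane. *)
Definition gc_slope (Y : 'M[R]_(k + e, k)) : 'M[R]_(e, k) := dsubmx Y *m invmx (usubmx Y).

Lemma gc_open_base : open (gc_base @^-1` Om).
Proof.
have := open_smooth_preimage openT lp.1 (fun j => gc_base_Ck j : Ck j setT gc_base).
by rewrite setTI.
Qed.

Lemma gc_jac_Ck j : Ck j (gc_base @^-1` Om) (fun z => jac phi (gc_base z)).
Proof.
apply: (Ck_comp (findim_cV (k + e)) (findim_mx n (k + e)) gc_open_base (U' := Om) _ _
  (smooth_jac lp.1 (chart_smooth lp) j)) => //.
by apply: Ck_sub (gc_base_Ck j).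
Qed.

Lemma gc_frame_Ck j : Ck j (gc_base @^-1` Om) gc_frame.
Proof.
have oB := gc_open_base.
apply: Ck_mulmx => //; first by apply: Ck_mulmx => //; [exact: gc_jac_Ck|exact: Ck_cst].
apply: Ck_mxP => // i b; case: (split_ordP i) => [i' ->|i' ->].
  rewrite (_ : (fun y => _) = fun=> (1%:M : 'M[R]_k) i' b); first exact: Ck_cst.
  by apply/funext => y; rewrite col_mxEu.
rewrite (_ : (fun y => _) = fun y => gc_fiber y i' b).
  by apply: Ck_entry => //; apply: Ck_sub (gc_fiber_Ck j).
by apply/funext => y; rewrite col_mxEd.
Qed.

Lemma gc_frame_unit z : Om (gc_base z) -> (gc_frame z)^T *m gc_frame z \in unitmx.
Proof.
move=> Oz; apply: mulmx_inj_unit => c; rewrite /gc_frame -mulmxA -mulmxA.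
rewrite -(mulmx0 _ (jac phi (gc_base z))) => /(unit_mulmx_inj (jac_unit lp Oz)).
rewrite -(mulmx0 _ C) => /(congr1 (mulmx (invmx C))); rewrite !mulKmx // mul_col_mx mul1mx.
by move=> /(congr1 usubmx); rewrite col_mxKu linear0.
Qed.

Lemma gc_dom_open : open gc_dom.
Proof.
have := open_smooth_preimage gc_open_base (@open_neq0 R) _ (f := fun z => \det (V^T *m gc_frame z)).
apply => j; apply: Ck_det; first exact: gc_open_base.
by apply: Ck_mulmx; [exact: gc_open_base|exact: Ck_cst|exact: gc_frame_Ck].
Qed.

Lemma gc_param_smooth : smooth gc_dom gc_param.
Proof.
move=> j; apply: (@Ck_sub _ _ _ _ (gc_base @^-1` Om)); first by move=> z [].
have oB := gc_open_base.
apply: Ck_pair => //; [exact: findim_cV|exact: findim_mx| |].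
  apply: (Ck_comp (findim_cV (k + e)) (findim_cV n) oB (U' := Om) _ _ (chart_smooth lp j)) => //.
  by apply: Ck_sub (gc_base_Ck j).
by apply: Ck_pj => //; [exact: gc_frame_unit|exact: gc_frame_Ck].
Qed.

Lemma projT_frame z : Om (gc_base z) -> projT M (phi (gc_base z)) *m gc_frame z = gc_frame z.
Proof.
by move=> Oz; rewrite (projT_chart lp Oz) /gc_frame !mulmxA (pj_mul (jac_unit lp Oz)).
Qed.

Lemma gc_param_mem z : gc_dom z -> grass_bundle k M (gc_param z).
Proof.
move=> [Oz _]; apply: (pj_grassmann subM); first exact: chart_mem lp Oz.
  exact: gc_frame_unit.
exact: projT_frame.
Qed.

Lemma gc_coord_param z : Om (gc_base z) -> gc_coord (gc_base z) (pj (gc_frame z)) =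
  col_mx 1%:M (gc_fiber z) *m (invmx ((gc_frame z)^T *m gc_frame z) *m ((gc_frame z)^T *m V)).
Proof.
move=> Oz; rewrite /gc_coord /pj -!mulmxA.
set K := invmx ((gc_frame z)^T *m gc_frame z) *m _; rewrite /gc_frame.
rewrite (mulmxA (jac phi (gc_base z))^T) (mulKmx (jac_unit lp Oz)).
by rewrite mulKmx.
Qed.

Lemma gc_dom_unit z : gc_dom z ->
  invmx ((gc_frame z)^T *m gc_frame z) *m ((gc_frame z)^T *m V) \in unitmx.
Proof.
move=> [Oz dz]; rewrite unitmx_mul unitmx_inv gc_frame_unit //=.
by rewrite -unitmx_tr trmx_mul trmxK unitmxE unitfE.
Qed.

Lemma gc_slope_mul (X : 'M[R]_(e, k)) (K : 'M[R]_k) : K \in unitmx ->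
  gc_slope (col_mx 1%:M X *m K) = X.
Proof.
by move=> KU; rewrite /gc_slope mul_col_mx col_mxKd col_mxKu mul1mx mulmxK.
Qed.

Lemma proj_rank_eq (P Q : 'M[R]_n) : P^T = P -> Q^T = Q -> P *m P = P ->
  Q *m P = P -> \rank P = \rank Q -> P = Q.
Proof.
move=> Ps Qs PP QP rk.
have PQ : P *m Q = P by rewrite -[LHS]trmxK trmx_mul Ps Qs QP Ps.
have sub : (P <= Q)%MS by rewrite -PQ submxMl.
have : (Q <= P)%MS by rewrite -(mxrank_leqif_sup sub) rk.
by move=> /submxP[D QD]; rewrite -QP QD -mulmxA PP.
Qed.

(** The columns of [gc_frame z] are those of [Q *m V] up to an invertible factor; they span a
    [k]-plane inside the range of [Q], and the ranks agree. *)
Lemma gc_inverse_mem u Q : Om u -> grass_bundle k M (phi u, Q) ->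
  usubmx (gc_coord u Q) \in unitmx ->
  let z := gc_join u (gc_slope (gc_coord u Q)) in gc_dom z /\ gc_param z = (phi u, Q).
Proof.
move=> Ou SQ; set Y := gc_coord u Q => YU z.
have [_ [Qs QQ Qk _]] := SQ; rewrite /= in Qs QQ Qk.
have PQ : projT M (phi u) *m Q = Q by have := grass_projT subM SQ.
have zu : gc_base z = u by exact: gc_base_join.
have YE : Y = col_mx 1%:M (gc_fiber z) *m usubmx Y.
  by rewrite /z gc_fiber_join /gc_slope mul_col_mx mul1mx mulmxKV // vsubmxK.
have QV : Q *m V = gc_frame z *m usubmx Y.
  rewrite /gc_frame zu -mulmxA -YE /Y /gc_coord -mulmxA mulKVmx // !mulmxA.
  by rewrite -/(pj (jac phi u)) -(projT_chart lp Ou) PQ.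
have BU : (gc_frame z)^T *m gc_frame z \in unitmx by apply: gc_frame_unit; rewrite zu.
have BE : gc_frame z = Q *m V *m invmx (usubmx Y) by rewrite QV mulmxK.
have QB : Q *m gc_frame z = gc_frame z by rewrite BE !mulmxA QQ.
have pE : pj (gc_frame z) = Q.
  apply: proj_rank_eq => //; [exact: pj_sym|exact: pj_idem| |by rewrite pj_rank].
  by rewrite /pj -(mulmxA (gc_frame z)) (mulmxA Q) QB.
split; last by rewrite /gc_param zu pE.
split; first by rewrite zu.
have : V^T *m gc_frame z \in unitmx.
  have E : (Q *m V)^T *m (Q *m V) = V^T *m gc_frame z *m usubmx Y.
    by rewrite trmx_mul Qs QV -(mulmxA V^T Q) (mulmxA Q (gc_frame z)) QB mulmxA.
  have : (Q *m V)^T *m (Q *m V) \in unitmx.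
    apply: mulmx_inj_unit => c; rewrite QV -mulmxA -(mulmx0 _ (gc_frame z)).
    by move=> /(unit_mulmx_inj BU)/(congr1 (mulmx (invmx (usubmx Y)))); rewrite mulKmx // mulmx0.
  by rewrite E unitmx_mul => /andP[].
by rewrite unitmxE unitfE.
Qed.

Lemma grass_chart : local_param (grass_bundle k M) gc_dom gc_param.
Proof.
apply: local_paramI; [exact: gc_dom_open|exact: gc_param_smooth|exact: gc_param_mem|].
move=> z0 dz0; have [Oz0 _] := dz0; set u0 := gc_base z0 in Oz0.
have [Q [g [oQ Qu gs gO [gE gK]]]] := chart_inv lp Oz0.
have fstC j : Ck j setT (fun w : 'cV[R]_n * 'M[R]_n => w.1).
  by apply: Ck_fst; [exact: openT|exact: Ck_id].
pose U1 : set ('cV[R]_n * 'M[R]_n) := fst @^-1` Q.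
have oU1 : open U1.
  have := open_smooth_preimage openT oQ (fun j => fstC j : Ck j setT fst).
  by rewrite setTI.
have gC j : Ck j U1 (fun w => g w.1).
  by apply: (Ck_comp (findim_cV n) (findim_cV (k + e)) oU1 (U' := Q) _ _ (gs j)) => //; apply: Ck_sub (fstC j).
pose Y (w : 'cV[R]_n * 'M[R]_n) := gc_coord (g w.1) w.2.
have YC j : Ck j U1 Y.
  have jC : Ck j U1 (fun w => jac phi (g w.1)).
    apply: (Ck_comp (findim_cV (k + e)) (findim_mx n (k + e)) oU1 (U' := Om) _ (gC j)
      (smooth_jac lp.1 (chart_smooth lp) j)).
    by move=> w /gO.
  have jtC := Ck_trmx oU1 jC.
  apply: Ck_mulmx => //; first exact: Ck_cst.
  apply: Ck_mulmx => //; last first.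
    by apply: Ck_mulmx => //; [apply: Ck_snd => //; exact: Ck_id|exact: Ck_cst].
  apply: Ck_mulmx => //; apply: Ck_invmx => //; first by move=> w /gO Ow; exact: (jac_unit lp Ow).
  exact: Ck_mulmx.
have uYC j : Ck j U1 (fun w => usubmx (Y w)).
  apply: Ck_mxP => // a b; rewrite (_ : (fun w => _) = fun w => Y w (lshift _ a) b).
    exact: Ck_entry.
  by apply/funext => w; rewrite mxE.
have dYC j : Ck j U1 (fun w => dsubmx (Y w)).
  apply: Ck_mxP => // a b; rewrite (_ : (fun w => _) = fun w => Y w (rshift _ a) b).
    exact: Ck_entry.
  by apply/funext => w; rewrite mxE.
(* The slope is smooth where the upper block of the coordinates is invertible; [gc_dom_unit] shows
   that this includes the given point. *)
pose U2 := U1 `&` (fun w => \det (usubmx (Y w))) @^-1` [set y : R | y != 0].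
have oU2 : open U2.
  by apply: (open_smooth_preimage oU1 (@open_neq0 R)) => j; exact: Ck_det.
have U21 : U2 `<=` U1 by exact: subIsetl.
have U2u w : U2 w -> usubmx (Y w) \in unitmx by move=> [_ h]; rewrite unitmxE unitfE.
exists U2, (fun w => gc_join (g w.1) (gc_slope (Y w))); split => //.
- split; first exact: Qu.
  have := gc_dom_unit dz0; rewrite /preimage /= -unitfE -unitmxE /Y /= (gK _ Oz0 Qu).
  by rewrite gc_coord_param // mul_col_mx col_mxKu mul1mx.
- move=> j; apply: gc_join_Ck => //; first exact: Ck_sub U21 (gC j).
  apply: Ck_mulmx => //; first exact: Ck_sub U21 (dYC j).
  by apply: Ck_invmx => //; exact: Ck_sub U21 (uYC j).
- move=> [y P] SP U2P; have [U1P _] := U2P.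
  have [Mx _] := SP; have yE : phi (g y) = y by exact: gE.
  have := @gc_inverse_mem (g y) P (gO _ U1P); rewrite yE.
  by move=> /(_ SP (U2u _ U2P)).
move=> z dz U2z; have [Oz _] := dz; have [Qz _] := U2z.
rewrite /Y /= (gK _ Oz Qz) gc_coord_param // gc_slope_mul ?gc_joinK //.
exact: gc_dom_unit.
Qed.

End GrassmannCharts.

(** With [C] chosen so that the first [k] columns of [jac phi u *m C] form the frame of the given
    plane, that plane is the point of slope 0. *)
Lemma grass_bundle_submanifold (R : realType) n k e (M : set 'cV[R]_n) :
  submanifold (k + e) M -> submanifold (k + e + e * k) (grass_bundle k M).
Proof.
move=> subM w Sw; have [Mx [Ps PP Pk PT]] := Sw.
have [Om [phi [lp [u Ou phiu]]]] := subM _ Mx.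
have [VV PV] := frameP Sw; set V := frame k w.2 in VV PV.
have PVV : w.2 *m V = V by rewrite {1}PV -mulmxA VV mulmx1.
pose J := jac phi u; have JU := jac_unit lp Ou.
pose B := invmx (J^T *m J) *m J^T *m V.
have JB : J *m B = V.
  by rewrite /B !mulmxA -/(pj J) -(projT_chart lp Ou) phiu -PVV mulmxA (grass_projT subM Sw).
have Bf : row_free B^T.
  rewrite -[row_free _]/(\rank B^T == k) mxrank_tr eqn_leq rank_leq_col /=.
  by rewrite -[leqLHS](mxrank1 R) -VV -{2}JB mulmxA mxrankM_maxr.
have [C CU CE] := row_free_complete Bf; rewrite trmxK in CE.
exists (gc_dom Om phi V C), (gc_param phi C); split; first exact: grass_chart.
pose z := gc_join u 0 : 'cV[R]_(k + e + e * k).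
have frz : gc_frame phi C z = V.
  by rewrite /gc_frame gc_base_join gc_fiber_join -mulmxA CE JB.
exists z; last first.
  by rewrite /gc_param frz gc_base_join phiu pj_orthonormal // -PV -surjective_pairing.
by split; [rewrite gc_base_join|rewrite frz VV det1 oner_neq0].
Qed.

(** * Balls of the exponential map *)

Section ExponentialBall.
Context {R : realType} {V : normedModType R}.
Variables (S : set V) (met : V -> V -> V -> R) (m : nat) (w : V) (r1 : R).
Hypotheses (fV : findim V) (hm : metric_on S met) (subS : submanifold m S) (Sw : S w).
Hypotheses (r10 : 0 < r1)
  (Edef : forall D, tangent S w D -> met_norm met w D < r1 -> exp_graph S met w D !=set0)
  (Ediff : diffeo_into S [set D | tangent S w D /\ met_norm met w D < r1] (Exp S met w)).

Lemma tangent_lincomp a x y : tangent S w x -> tangent S w y -> tangent S w (a *: x + y).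
Proof.
have [Om [phi [lp [u Ou <-]]]] := subS Sw.
have df : differentiable phi u by exact: smooth_diff (chart_smooth lp) Ou.
move=> /(tangent_chart _ fV lp Ou)[b ->] /(tangent_chart _ fV lp Ou)[c ->].
apply/(tangent_chart _ fV lp Ou); exists (a *: b + c).
by rewrite !deriveE // linearP.
Qed.

Lemma tangent0 : tangent S w 0.
Proof.
have [Om [phi [lp [u Ou <-]]]] := subS Sw.
have df : differentiable phi u by exact: smooth_diff (chart_smooth lp) Ou.
by apply/(tangent_chart _ fV lp Ou); exists 0; rewrite deriveE // linear0.
Qed.

Lemma tangent_frame_exists : exists (p : nat) (b : 'I_p -> V),
  [/\ forall u : 'cV_p, tangent S w (\sum_i u i 0 *: b i),
      forall i j, met w (b i) (b j) = (i == j)%:R &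
      forall D, tangent S w D -> D = \sum_i met w D (b i) *: b i].
Proof.
have [lin sym pos def _] := hm.
have [p [b [bT bO bC]]] := orthonormal_basis (B := met w) fV tangent0 tangent_lincomp
  (lin w) (sym w) (fun x _ => pos w x) (def w ^~ Sw).
exists p, b; split => // u; elim/big_ind : _ => [|x y Tx Ty|i _]; first exact: tangent0.
  by rewrite -[x]scale1r; exact: tangent_lincomp.
by rewrite -[_ *: _]addr0; apply: tangent_lincomp => //; exact: tangent0.
Qed.

Lemma Exp0 : Exp S met w 0 = w.
Proof.
have [p [b [bT bO bC]]] := tangent_frame_exists.
have := normal_chart0 fV hm subS bT bO r10 Edef; rewrite /normal_chart /tframe big1 // => i _.
by rewrite mxE scale0r.
Qed.

Lemma riem_dist_Exp D : tangent S w D -> met_norm met w D < r1 ->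
  (riem_dist S met w (Exp S met w D) <= (met_norm met w D)%:E)%E.
Proof.
move=> TD D1; have [p [b [bT bO bC]]] := tangent_frame_exists.
have DE := tcoordK bC TD; have nE := met_norm_tframe hm bO (tcoord met w b D).
rewrite DE in nE; rewrite nE in D1 *.
have := riem_dist_normal_chart fV hm subS bT bO bC r10 Edef Ediff D1.
by rewrite /normal_chart DE.
Qed.

(** Some curve joining the two points has length below [L], and such a curve cannot leave the normal
    ball. It is used from the centre to reach the starting point, and from an iterate to reach the
    next one. *)
Lemma Exp_ball_extend D w' L : tangent S w D -> met_norm met w D + L <= r1 ->
  (riem_dist S met (Exp S met w D) w' < L%:E)%E ->
  exists D', [/\ tangent S w D', met_norm met w D' < met_norm met w D + L & Exp S met w D' = w'].
Proof.
move=> TD Lr; have [p [b [bT bO bC]]] := tangent_frame_exists.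
have DE := tcoordK bC TD; have nE := met_norm_tframe hm bO (tcoord met w b D).
rewrite DE in nE; rewrite nE in Lr *.
move=> /ereal_inf_lt[_ [c [cS c0 c1] <-] cL].
have L0 : 0 < L.
  by rewrite -lte_fin; apply: le_lt_trans cL; apply: integral_ge0 => t _; rewrite lee_fin sqrtr_ge0.
have cE : c 0 = normal_chart S met w b (tcoord met w b D) by rewrite c0 /normal_chart DE.
have ur : normal_ball r1 (tcoord met w b D).
  by apply: lt_le_trans Lr; rewrite ltrDl.
have Lr' : (curve_length met c < (r1 - fnorm (tcoord met w b D))%:E)%E.
  by apply: lt_le_trans cL _; rewrite lee_fin lerBrDl.
have [v [vr cv] vu] := curve_stays_in_normal_chart fV hm subS bT bO bC r10 Edef Ediff cS ur cE Lr'.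
exists (tframe b v); split; first exact: bT.
  rewrite (met_norm_tframe hm bO) -lte_fin; apply: le_lt_trans vu _.
  by rewrite EFinD lteD2lE.
by rewrite -c1 cv.
Qed.

End ExponentialBall.

(** * Iterates of the comparison matrix *)

Section SpectralNorm.
Context {R : realType}.

Lemma fnorm_le m (u v : 'cV[R]_m) : (forall i, 0 <= u i 0 <= v i 0) -> fnorm u <= fnorm v.
Proof.
move=> uv; rewrite !fnormE ler_sqrt; last by apply: sumr_ge0 => i _; exact: sqr_ge0.
apply: ler_sum => i _; have /andP[u0 ui] := uv i.
by rewrite ler_sqr // nnegrE // (le_trans u0).
Qed.

Lemma entry_le_fnorm m (u : 'cV[R]_m) i : `|u i 0| <= fnorm u.
Proof.
rewrite fnormE -sqrtr_sqr ler_sqrt; last by apply: sumr_ge0 => j _; exact: sqr_ge0.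
by rewrite /sqnorm (bigD1 i) //= lerDl; apply: sumr_ge0 => j _; exact: sqr_ge0.
Qed.

Lemma fnorm_eq0 m (u : 'cV[R]_m) : fnorm u = 0 -> u = 0.
Proof.
by move=> u0; apply/colP => i; apply/eqP; rewrite mxE -normr_le0 -u0 entry_le_fnorm.
Qed.

Lemma fnorm0 m : fnorm (0 : 'cV[R]_m) = 0.
Proof. by rewrite -(scale0r 0) fnormZ_cV normr0 mul0r. Qed.

Lemma spectral_norm_le m n (A : 'M[R]_(m, n)) (v : 'cV[R]_n) :
  fnorm (A *m v) <= spectral_norm A * fnorm v.
Proof.
have [/fnorm_eq0 -> |v0] := eqVneq (fnorm v) 0; first by rewrite mulmx0 !fnorm0 mulr0.
have vp : 0 < fnorm v by rewrite lt_neqAle eq_sym v0 fnorm_ge0.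
rewrite -ler_pdivrMr // mulrC -[(fnorm v)^-1]ger0_norm ?invr_ge0 ?fnorm_ge0 //.
rewrite -fnormZ_cV scalemxAr; apply: sup_upper_bound; last first.
  by exists ((fnorm v)^-1 *: v) => //=; rewrite fnormZ_cV normfV ger0_norm ?fnorm_ge0 // mulVf.
split; first by exists (fnorm (A *m (0 : 'cV_n))), 0 => //=; rewrite fnorm0.
(* Sums of absolute values along the rows bound the image of the unit ball, so the supremum is a
   true one. *)
exists (fnorm (\col_i \sum_j `|A i j|)) => _ [u /= u1 <-].
rewrite (_ : fnorm (A *m u) = fnorm (\col_i `|(A *m u) i 0|)); last first.
  by rewrite !fnormE; congr Num.sqrt; apply: eq_bigr => i _; rewrite [in RHS]mxE real_normK // num_real.
apply: fnorm_le => i; rewrite ![(\col__ _) _ _]mxE normr_ge0 /= mxE.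
apply: le_trans (ler_norm_sum _ _ _) _; apply: ler_sum => j _.
by rewrite normrM ler_piMr // (le_trans (entry_le_fnorm u j)).
Qed.

Lemma spectral_norm_ge0 m n (A : 'M[R]_(m, n.+1)) : 0 <= spectral_norm A.
Proof.
have := spectral_norm_le A (delta_mx 0 0); rewrite (_ : fnorm (delta_mx 0 0) = 1).
  by rewrite mulr1; apply: le_trans; exact: fnorm_ge0.
rewrite fnormE /sqnorm (bigD1 0) //= big1 ?mxE ?eqxx ?addr0 ?expr1n ?sqrtr1 // => i i0.
by rewrite mxE (negPf i0) expr0n.
Qed.

End SpectralNorm.

Section TwoByTwo.
Context {R : realType}.
Variables q q' e s : R.
Hypotheses (q0 : 0 <= q) (q'0 : 0 <= q') (e0 : 0 <= e) (s0 : 0 <= s).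
Local Notation A := (Amx q q' e s).
Local Notation m1 := (mu1 q q' e s).
Local Notation m2 := (mu2 q q' e s).

Let disc_ge0 : 0 <= (q - q') ^+ 2 + 4 * s * (e + s).
Proof. by rewrite addr_ge0 ?sqr_ge0 // !mulr_ge0 ?addr_ge0. Qed.

Lemma mu_sum : m1 + m2 = q + q' + 2 * s.
Proof. by rewrite /mu1 /mu2; lra. Qed.

(** The right side is the determinant of the matrix, as that of [mu_sum] is its trace. *)
Lemma mu_prod : m1 * m2 = (q + s) * (q' + s) - s * (e + s).
Proof.
rewrite /mu1 /mu2; set S := Num.sqrt _.
have SE : S ^+ 2 = (q - q') ^+ 2 + 4 * s * (e + s) by rewrite sqr_sqrtr.
apply: (@etrans _ _ (4^-1 * ((q + q' + 2 * s) ^+ 2 - S ^+ 2))); first by field.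
by rewrite SE; field.
Qed.

Lemma mu2_le1 : m2 <= m1.
Proof.
by rewrite /mu1 /mu2 ler_pM2l ?invr_gt0 // lerD2l; apply: (@le_trans _ _ 0); rewrite ?oppr_le0 sqrtr_ge0.
Qed.

(** The square of the trace exceeds the discriminant by [4 * (q * q' + s * (q + q' - e))], four
    times the determinant. The second bound on the step size is used here. *)
Lemma mu2_ge0 : e <= q + q' -> 0 <= m2.
Proof.
move=> eq; rewrite /mu2 pmulr_rge0 ?invr_gt0 // subr_ge0.
rewrite -[leRHS]ger0_norm; last by rewrite !addr_ge0 // mulr_ge0.
rewrite -sqrtr_sqr ler_sqrt ?sqr_ge0 //.
have qq := mulr_ge0 q0 q'0; have se : 0 <= s * (q + q' - e) by rewrite mulr_ge0 // subr_ge0.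
by nra.
Qed.

(** The larger eigenvalue is below 1 when the trace is below 2 and the characteristic polynomial is
    positive at 1. With both [q] and [q'] replaced by their maximum, its value there is [(c - s)^2 -
    s (e + s) = c^2 - s (e + 2 c)], which is the origin of the bound on [s]. *)
Lemma mu1_lt1 : Num.max q q' < 1 ->
  s * (e + 2 * (1 - Num.max q q')) < (1 - Num.max q q') ^+ 2 -> m1 < 1.
Proof.
move=> q1 sc; set c := 1 - Num.max q q' in sc.
have c0 : 0 < c by rewrite subr_gt0.
have ac : c <= 1 - q by rewrite lerD2l lerN2 le_max lexx.
have bc : c <= 1 - q' by rewrite lerD2l lerN2 le_max lexx orbT.
(* One of [q], [q'] attains the maximum; this removes the second-order term left by the
   replacement. *)
have cE : (1 - q - c) * (1 - q' - c) = 0.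
  by rewrite /c; case: (leP q q') => _; rewrite subrr ?mulr0 ?mul0r.
have sc2 : 2 * s < c.
  have : s * (2 * c) < c * c by apply: le_lt_trans sc; rewrite ler_wpM2l // lerDr.
  by nra.
have T0 : 0 < 2 - (q + q' + 2 * s) by lra.
rewrite /mu1 -ltr_pdivlMl ?invr_gt0 // invrK mulr1 -ltrBrDl.
rewrite -[ltRHS]ger0_norm ?(ltW T0) // -sqrtr_sqr ltr_sqrt ?exprn_gt0 //.
by nra.
Qed.

Lemma AmxE (v : 'cV[R]_2) : (A *m v) 0 0 = (q + s) * v 0 0 + s * v 1 0 /\
  (A *m v) 1 0 = (e + s) * v 0 0 + (q' + s) * v 1 0.
Proof. by rewrite !mxE !big_ord_recl !big_ord0 !mxE /= !addr0; split; congr (_ + _ * v _ _); apply/val_inj. Qed.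

Lemma ord2P (P : 'I_2 -> Prop) : P 0 -> P 1 -> forall i, P i.
Proof.
move=> P0 P1 i; have [->|i0] := eqVneq i 0; first exact: P0.
rewrite (_ : i = 1); first exact: P1.
by apply/val_inj; case: i i0 => -[|[|//]].
Qed.

Lemma Amx_le (u v : 'cV[R]_2) : (forall i, u i 0 <= v i 0) -> forall i, (A *m u) i 0 <= (A *m v) i 0.
Proof.
move=> uv; have [u1 u2] := AmxE u; have [v1 v2] := AmxE v.
apply: ord2P; rewrite ?u1 ?u2 ?v1 ?v2; apply: lerD; apply: ler_wpM2l => //; exact: addr_ge0.
Qed.

Lemma Amx_sqr (v : 'cV[R]_2) : A *m (A *m v) = (m1 + m2) *: (A *m v) - (m1 * m2) *: v.
Proof.
rewrite mu_sum mu_prod; have [v1 v2] := AmxE v; have [w1 w2] := AmxE (A *m v).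
apply/colP; apply: ord2P; rewrite [in RHS]mxE [X in _ = X + _]mxE [X in _ = _ + X]mxE [X in _ = _ - X]mxE.
  by rewrite w1 v2 v1; ring.
by rewrite w2 v2 v1; ring.
Qed.

(* The quotient [(m1^t - m2^t) / (m1 - m2)], in a form that allows [m1 = m2]. *)
Definition mu_power t : R := \sum_(i < t) m1 ^+ (t.-1 - i) * m2 ^+ i.

Lemma mu_powerSr t : mu_power t.+1 = m1 * mu_power t + m2 ^+ t.
Proof.
rewrite /mu_power big_ord_recr /= subnn expr0 mul1r; congr (_ + _).
rewrite mulr_sumr; apply: eq_bigr => i _; rewrite mulrA -exprS.
by case: t i => [[]//|t] i; rewrite -subSn // -ltnS.
Qed.

Lemma mu_powerSS t : mu_power t.+2 = (m1 + m2) * mu_power t.+1 - m1 * m2 * mu_power t.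
Proof. by rewrite !mu_powerSr exprS; ring. Qed.

Lemma mu_power_sub t : (m1 - m2) * mu_power t = m1 ^+ t - m2 ^+ t.
Proof.
elim: t => [|t IH]; first by rewrite /mu_power big_ord0 !expr0 subrr mulr0.
by rewrite mu_powerSr mulrDr mulrCA IH !exprS; ring.
Qed.

Lemma iter_Amx t (v : 'cV[R]_2) : iter t.+1 (mulmx A) v =
  mu_power t.+1 *: (A *m v) - (m1 * m2 * mu_power t) *: v.
Proof.
elim: t => [|t IH].
  by rewrite mu_powerSr /mu_power !big_ord0 !mulr0 add0r scale0r subr0 scale1r.
rewrite iterS IH mulmxBr -!scalemxAr Amx_sqr mu_powerSS; set x := A *m v.
rewrite scalerBr !scalerA scalerBl [mu_power t.+1 * _]mulrC [_ * (m1 * m2)]mulrC.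
by rewrite addrAC.
Qed.

Hypotheses (m20 : 0 <= m2) (m11 : m1 < 1).

Lemma mu_power_ge0 t : 0 <= mu_power t.
Proof.
by apply: sumr_ge0 => i _; rewrite mulr_ge0 // exprn_ge0 // (le_trans m20) // mu2_le1.
Qed.

Lemma iter_Amx_ge0 t (v : 'cV[R]_2) : (forall i, 0 <= v i 0) -> forall i, 0 <= iter t (mulmx A) v i 0.
Proof.
move=> v0; elim: t => // t IH i; rewrite iterS.
by have := Amx_le (u := 0) (v := iter t (mulmx A) v); rewrite mulmx0 => /(_ _ i); rewrite mxE; apply => j; rewrite mxE.
Qed.

Lemma fnorm_iter_Amx t (v : 'cV[R]_2) : (forall i, 0 <= v i 0) ->
  fnorm (iter t.+1 (mulmx A) v) <= mu_power t.+1 * (spectral_norm A * fnorm v).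
Proof.
move=> v0; apply: (@le_trans _ _ (mu_power t.+1 * fnorm (A *m v))); last first.
  by rewrite ler_wpM2l ?mu_power_ge0 // spectral_norm_le.
rewrite -[X in X * _]ger0_norm ?mu_power_ge0 // -fnormZ_cV; apply: fnorm_le => i.
rewrite iter_Amx_ge0 // andTb iter_Amx mxE gerDl mxE oppr_le0 mxE mulr_ge0 //.
by apply: mulr_ge0 (mu_power_ge0 t); apply: mulr_ge0 m20; exact: le_trans m20 mu2_le1.
Qed.

(** The alternative is the form taken by the initial condition once the conventions on fractions are
    resolved: [m1 = m2] survives only with a zero spectral norm. *)
Lemma iter_Amx_converges (r : R) (v : 'cV[R]_2) : (forall i, 0 <= v i 0) -> 0 < r -> fnorm v < r ->
  (m1 != m2 /\ Num.max (m1 ^+ 2 / (m1 - m2)) 1 * spectral_norm A * fnorm v < r) \/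
    spectral_norm A = 0 ->
  (forall t, fnorm (iter t (mulmx A) v) < r) /\
  exists C rho : R, [/\ 0 < C, 0 < rho, rho < 1 &
    forall t, fnorm (iter t (mulmx A) v) <= C * rho ^+ t].
Proof.
move=> v0 r0 vr; have m10 : 0 <= m1 by rewrite (le_trans m20) // mu2_le1.
have N0 := spectral_norm_ge0 A; have nv0 := fnorm_ge0 v.
move=> [[m12 vb]|A0]; last first.
  have it0 t : fnorm (iter t.+1 (mulmx A) v) = 0.
    by apply/eqP; rewrite eq_le fnorm_ge0 (le_trans (fnorm_iter_Amx t v0)) // A0 mul0r mulr0.
  split=> [[|t] //|]; first by rewrite it0.
  exists r, 2^-1; split=> //; [by rewrite invf_lt1 ?ltr1n| case=> [|t]].
    by rewrite mulr1 ltW.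
  by rewrite it0 mulr_ge0 ?exprn_ge0 ?invr_ge0 // ltW.
have m120 : 0 < m1 - m2 by rewrite subr_gt0 lt_neqAle eq_sym m12 mu2_le1.
have powle t : mu_power t <= m1 ^+ t / (m1 - m2).
  by rewrite ler_pdivlMr // mulrC mu_power_sub gerBl exprn_ge0.
(* [mu_power 1 = 1]; from exponent 2 on, [m1 < 1] makes the bound at exponent 2 the largest. *)
have powle' t : mu_power t.+1 <= Num.max (m1 ^+ 2 / (m1 - m2)) 1.
  rewrite le_max; case: t => [|t]; apply/orP; [right|left].
    by rewrite mu_powerSr /mu_power big_ord0 mulr0 add0r.
  apply: le_trans (powle _) _; rewrite ler_pM2r ?invr_gt0 // !exprS mulrA -expr2.
  by rewrite expr0 mulr1 -expr2 ler_piMr ?sqr_ge0 // exprn_ile1 // ltW.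
split=> [[|t] //|].
  apply: le_lt_trans (fnorm_iter_Amx t v0) (le_lt_trans _ vb).
  by rewrite -mulrA ler_wpM2r // mulr_ge0.
pose K := spectral_norm A * fnorm v.
have K0 : 0 <= K by exact: mulr_ge0.
have rho0 : 0 < Num.max m1 2^-1 by rewrite lt_max invr_gt0 ltr0n orbT.
(* The summand [r] covers [t = 0], the other one [t >= 1]. *)
exists (r + K / (m1 - m2)), (Num.max m1 2^-1); split => //.
- by rewrite ltr_wpDr // divr_ge0 // ltW.
- by rewrite gt_max m11 invf_lt1 // ltr1n.
move=> [|t].
  by rewrite expr0 mulr1; apply: le_trans (ltW vr) _; rewrite lerDl divr_ge0 // ltW.
apply: le_trans (fnorm_iter_Amx t v0) _; rewrite -/K.
apply: (@le_trans _ _ (K / (m1 - m2) * m1 ^+ t.+1)).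
  by rewrite mulrC -mulrA ler_wpM2l // mulrC.
apply: ler_pM => //; [by rewrite divr_ge0 // ltW|exact: exprn_ge0|by rewrite lerDr ltW|].
by rewrite lerXn2r ?nnegrE // ?(ltW rho0) // le_max lexx.
Qed.

End TwoByTwo.

(** * Consequences of the step-size and initial-point conditions *)

Section StepSize.
Context {R : realType}.

(** [sup] is 0 on sets without a supremum, so [Mconst] is nonnegative in every case. *)
Lemma sup_nonneg (E : set R) : (forall x, E x -> 0 <= x) -> 0 <= sup E.
Proof.
move=> E0; have [h|/sup_out -> //] := pselect (has_sup E).
have [[x Ex] _] := h; exact: le_trans (E0 x Ex) (sup_upper_bound h Ex).
Qed.

Lemma efracE (a b : R) : b != 0 -> efrac a%:E b%:E = (a / b)%:E.
Proof. by move=> b0; rewrite /efrac eqe (negPf b0) inver (negPf b0) EFinM. Qed.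

Lemma lt_efrac (x a b : R) : 0 < b -> (x%:E < efrac a%:E b%:E)%E -> x * b < a.
Proof. by move=> b0; rewrite efracE ?gt_eqF // lte_fin ltr_pdivlMr. Qed.

(** A zero supremum makes the fraction infinite but forces [x = 0]; an infinite one makes the
    fraction 0, against [0 < eta]. *)
Lemma efrac_sup_bound (S : \bar R) (eta mu x : R) : 0 < eta -> 0 < mu -> 0 <= x ->
  (x%:E <= S)%E -> (eta%:E < efrac mu%:E S)%E -> eta * x < mu.
Proof.
move=> eta0 mu0 x0; case: S => [S| |//].
  rewrite lee_fin; have [->|S0 xS] := eqVneq S 0.
    by move=> x00 _; rewrite (_ : x = 0) ?mulr0 //; apply/eqP; rewrite eq_le x00.
  move=> h; have Sp : 0 < S by rewrite lt_neqAle eq_sym S0 (le_trans x0).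
  by apply: le_lt_trans (lt_efrac Sp h); rewrite ler_pM2l.
by move=> _; rewrite /efrac /= /inve mule0 lte_fin ltNge (ltW eta0).
Qed.

(** Inserts a real radius between the distance and the threshold. If [m1 = m2] and [N > 0] the
    threshold is 0 and no distance is below it; if [N = 0], the product of [+oo] with 0 is 0 and the
    threshold is [r]. *)
Lemma initial_radius (gd : \bar R) (m1 m2 N r : R) : 0 <= N -> 0 < r -> (0 <= gd)%E ->
  (gd < efrac r%:E (Order.max (Order.max (efrac (m1 ^+ 2)%:E (m1 - m2)%:E) 1%:E * N%:E) 1%:E))%E ->
  exists2 rho : R, [/\ 0 < rho, rho <= r & (gd < rho%:E)%E] &
    (m1 != m2 /\ Num.max (m1 ^+ 2 / (m1 - m2)) 1 * N * rho <= r) \/ N = 0.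
Proof.
move=> N0 r0 gd0; have [m12|m12] := eqVneq m1 m2.
  rewrite m12 subrr /efrac eqxx maxye; have [-> |Nn] := eqVneq N 0.
    rewrite mule0 max_r ?lee_fin ?ler01 // eqe oner_eq0 inve1 mule1 => gdr.
    by exists r; [split|right].
  have Np : 0 < N by rewrite lt_neqAle eq_sym Nn.
  by rewrite gt0_mulye ?lte_fin // maxye /= /inve mule0 ltNge gd0.
rewrite efracE ?subr_eq0 // -EFin_max -EFinM -EFin_max.
set K := _ * N; have X1 : 1 <= Num.max K 1 by rewrite le_max lexx orbT.
have X0 : 0 < Num.max K 1 by apply: lt_le_trans X1.
rewrite efracE ?gt_eqF // => gdr; exists (r / Num.max K 1).
  by split=> //; [exact: divr_gt0|rewrite ler_pdivrMr // ler_peMr // ltW].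
left; split=> //; rewrite mulrA ler_pdivrMr // mulrC ler_pM2l //.
by rewrite le_max lexx.
Qed.

Lemma gap_abs (a b c e l : R) : a <= b -> b < 0 -> 0 < c -> c <= e -> a <= l -> l <= e ->
  l <= b \/ c <= l -> 0 < `|l| <= e - a.
Proof.
move=> ab b0 c0 ce al le [lb|cl]; first by rewrite ltr0_norm; [apply/andP; split|]; lra.
by rewrite gtr0_norm; [apply/andP; split|]; lra.
Qed.

Lemma gap_le (a b c e : R) : a <= b -> b < 0 -> 0 < c -> c <= e ->
  [/\ 0 < c - b, c - b <= e - a, 0 < e - a & e - a <= e - a].
Proof. by move=> ab b0 c0 ce; split; lra. Qed.

Variables (d k : nat) (lam : d.-tuple R) (eta : R).
Hypotheses (k1 : (1 <= k)%N) (kd : (k < d)%N) (lam_sorted : sorted <=%R lam).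
Hypotheses (lamk1 : nth 0 lam k.-1 < 0) (lamk : 0 < nth 0 lam k).
Local Notation L := (nth 0 lam d.-1 - nth 0 lam 0).

Let d0 : (0 < d)%N.
Proof. exact: leq_ltn_trans kd. Qed.

Let nth_le i j : (i <= j)%N -> (j < d)%N -> nth 0 lam i <= nth 0 lam j.
Proof.
move=> ij jd; apply: (le_sorted_leq_nth 0 lam_sorted) => //; rewrite inE size_tuple //.
exact: leq_ltn_trans jd.
Qed.

Lemma spectral_gap_gt0 : 0 < L.
Proof.
have lk0 : nth 0 lam 0 <= nth 0 lam k.-1 by apply: nth_le => //; exact: leq_ltn_trans (leq_pred _) kd.
have ldk : nth 0 lam k <= nth 0 lam d.-1 by apply: nth_le; rewrite ?prednK // -ltnS prednK.
by have [] := gap_le lk0 lamk1 lamk ldk.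
Qed.

Hypotheses (eta0 : 0 < eta) (etaL : eta * L < 2).

Let lt_one_sub x : 0 < x -> x <= L -> `|1 - eta * x| < 1.
Proof.
move=> x0 xL; have ex : 0 < eta * x by exact: mulr_gt0.
have eL : eta * x <= eta * L by rewrite ler_pM2l.
by have := etaL; rewrite ltr_norml; set a := eta * L in eL * => ?; set b := eta * x in ex eL *; apply/andP; split; lra.
Qed.

(** The spectrum lies on both sides of 0, so no eigenvalue exceeds the spread [L] in absolute value.
    Hence the single bound [eta * L < 2] controls [q1] and [q2] alike. *)
Lemma spectrum_abs l : l \in lam -> 0 < `|l| <= L.
Proof.
move=> /(nthP 0)[i]; rewrite size_tuple => id <-.
have l0 : nth 0 lam 0 <= nth 0 lam i by exact: nth_le.
have ld : nth 0 lam i <= nth 0 lam d.-1 by apply: nth_le; rewrite ?prednK // -ltnS prednK.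
have lk0 : nth 0 lam 0 <= nth 0 lam k.-1 by apply: nth_le => //; exact: leq_ltn_trans (leq_pred _) kd.
have ldk : nth 0 lam k <= nth 0 lam d.-1 by apply: nth_le; rewrite ?prednK // -ltnS prednK.
apply: (gap_abs lk0 lamk1 lamk ldk l0 ld).
have [ik|ki] := ltnP i k; [left|right]; last exact: nth_le.
by apply: nth_le; [rewrite -ltnS prednK|exact: leq_ltn_trans (leq_pred _) kd].
Qed.

Lemma q1_lt1 : q1 lam eta < 1.
Proof.
have h0 : 0 < `|nth 0 lam 0| <= L by apply/spectrum_abs/mem_nth; rewrite size_tuple.
pose P (x : R) := 0 < x <= L.
have Pmin : P (\big[Num.min/`|nth 0 lam 0|]_(l <- lam) `|l|).
  by rewrite big_seq_cond; elim/big_ind : _ => [|x y Px Py|l /andP[/spectrum_abs]] //; rewrite /P; case: (leP x y).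
have Pmax : P (\big[Num.max/`|nth 0 lam 0|]_(l <- lam) `|l|).
  by rewrite big_seq_cond; elim/big_ind : _ => [|x y Px Py|l /andP[/spectrum_abs]] //; rewrite /P; case: (leP x y).
have /andP[a0 aL] := Pmin; have /andP[b0 bL] := Pmax.
by rewrite /q1 gt_max !lt_one_sub.
Qed.

Lemma q2_lt1 : q2 k lam eta < 1.
Proof.
have lk0 : nth 0 lam 0 <= nth 0 lam k.-1 by apply: nth_le => //; exact: leq_ltn_trans (leq_pred _) kd.
have ldk : nth 0 lam k <= nth 0 lam d.-1 by apply: nth_le; rewrite ?prednK // -ltnS prednK.
have [h1 h2 h3 h4] := gap_le lk0 lamk1 lamk ldk.
by rewrite /q2 gt_max !lt_one_sub.
Qed.

End StepSize.

Lemma q1_ge0 (R : realType) (lam : seq R) eta : 0 <= q1 lam eta.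
Proof. by rewrite /q1 le_max normr_ge0. Qed.

Lemma q2_ge0 (R : realType) d k (lam : d.-tuple R) eta : 0 <= q2 k lam eta.
Proof. by rewrite /q2 le_max normr_ge0. Qed.

Lemma Mconst_ge0 (R : realType) n (M : set 'cV[R]_n) f Hbar OpII w : 0 <= Mconst M f Hbar OpII w.
Proof. by apply: sup_nonneg => _ [de _ <-]; exact: fnorm_ge0. Qed.

Lemma riem_dist_ge0 (R : realType) (V : normedModType R) (S : set V) met w w' :
  (0 <= riem_dist S met w w')%E.
Proof.
apply: le_ereal_inf_tmp => _ [c _ <-]; apply: integral_ge0 => t _.
by rewrite lee_fin sqrtr_ge0.
Qed.

(** The infimum of the empty set is [+oo], so a finite distance provides a curve, which starts in
    [S]. *)
Lemma riem_dist_mem (R : realType) (V : normedModType R) (S : set V) met w w' (r : R) :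
  (riem_dist S met w w' < r%:E)%E -> S w.
Proof.
move=> /ereal_inf_lt[_ [c [[cS _] <- _] _] _]; apply: cS.
by rewrite lexx ler01.
Qed.

Lemma col2_ge0 (R : realType) n (M : set 'cV[R]_n) ws D i : 0 <= col2 M ws D i 0.
Proof. by rewrite mxE; case: i => -[|[|//]] ? /=; exact: fnorm_ge0. Qed.

Lemma fnorm_col2 (R : realType) n (M : set 'cV[R]_n) ws D : fnorm (col2 M ws D) = sasaki_norm M ws D.
Proof.
rewrite fnormE /sqnorm !big_ord_recl big_ord0 !mxE /= addr0.
by rewrite /sasaki_norm /met_norm /sasaki !sqr_sqrtr ?inner_ge0.
Qed.

Lemma met_normZ (R : realType) (V : normedModType R) (S : set V) met w a D :
  metric_on S met -> met_norm met w (a *: D) = `|a| * met_norm met w D.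
Proof.
move=> hm; have metZ X : met w (a *: D) X = a * met w D X.
  by have := met_suml w (fun _ : 'I_1 => a) (fun=> D) X hm; rewrite !big_ord1.
have [_ sym _ _ _] := hm.
by rewrite /met_norm metZ sym metZ mulrA -expr2 sqrtrM ?sqr_ge0 // sqrtr_sqr.
Qed.

(** * Linear convergence *)

Theorem theorem3 (R : realType) (n d k : nat) (M : set 'cV[R]_n)
    (f : 'cV[R]_n -> R) (xs : 'cV[R]_n) (Ps : 'M[R]_n) (lam : d.-tuple R)
    (domM : set ('cV[R]_n * 'cV[R]_n)) (RM : 'cV[R]_n -> 'cV[R]_n -> 'cV[R]_n)
    (VT : 'cV[R]_n -> 'cV[R]_n -> 'cV[R]_n -> 'cV[R]_n)
    (Rh : 'cV[R]_n -> 'M[R]_n -> 'M[R]_(n, k) -> 'M[R]_n -> 'M[R]_(n, k))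
    (domG : set (('cV[R]_n * 'M[R]_n) * ('cV[R]_n * 'M[R]_n)))
    (RG : 'cV[R]_n * 'M[R]_n -> 'cV[R]_n * 'M[R]_n -> 'cV[R]_n * 'M[R]_n)
    (U : set 'cV[R]_n) (Hbar : 'cV[R]_n -> 'M[R]_n)
    (OpII : 'cV[R]_n -> 'cV[R]_n -> 'M[R]_n -> 'M[R]_n)
    (c1 r1 r2 c3 r3 eta : R) (w : nat -> 'cV[R]_n * 'M[R]_n) :
  let ws := (xs, Ps) in
  let Mc := Mconst M f Hbar OpII ws in
  let q := q1 lam eta in
  let q' := q2 k lam eta in
  let qmax := Num.max q q' in
  let s := c3 * r3 in
  let A := Amx q q' (eta * Mc) s in
  let m1 := mu1 q q' (eta * Mc) s in
  let m2 := mu2 q q' (eta * Mc) s in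
  Ck 3 setT f ->
  submanifold d M ->
  (1 <= k)%N -> (k < d)%N ->
  (* the saddle point *)
  index_saddle d M f k xs ->
  spectrum_on (rhess M f xs) lam ->
  nth 0 lam k.-1 < 0 -> 0 < nth 0 lam k ->
  is_orthoproj (lowest_space (rhess M f xs) lam k) Ps ->
  (* the iteration *)
  bundle_retraction M domM RM VT Rh domG RG ->
  grass_bundle k M (w 0%N) ->
  (forall t, w t.+1 = RG (w t) (eta *: hfield k M f (w t))) ->
  (* the extensions entering the constant Mc *)
  open U -> U xs ->
  hess_extension M f U Hbar ->
  II_extension k M U OpII ->
  (* the constants c1, r1, r2, c3, r3 *)
  exp_retraction_constants k M domG RG ws c1 r1 ->
  0 < r2 -> r2 < r1 ->
  0 < r3 -> r3 <= r2 -> 0 <= c3 ->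
  (forall D, gtangent k M ws D -> sasaki_norm M ws D < r3 -> forall i : 'I_2,
    col2 M ws (Fmap k M f RG ws r1 eta D) i 0 <= (A *m col2 M ws D) i 0) ->
  (* step size *)
  0 < eta ->
  (eta%:E < Order.min (efrac 2%:E (nth 0 lam d.-1 - nth 0 lam 0)%:E)
           (Order.min (efrac (q + q')%:E Mc%:E)
                      (efrac (Num.min ((r1 - r2) / c1) r1)%:E
                             (sup_hfield k M f ws r1))))%E ->
  (* initial point *)
  (gdist k M ws (w 0%N) <
     efrac r3%:E
       (Order.max (Order.max (efrac (m1 ^+ 2)%:E (m1 - m2)%:E) 1%:E
                   * (spectral_norm A)%:E) 1%:E))%E ->
  (s%:E < efrac ((1 - qmax) ^+ 2)%:E (eta * Mc + 2 * (1 - qmax))%:E)%E ->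
  converges_linearly k M ws w.
Proof.
move=> ws Mc q q' qmax s A m1 m2 f3 subM k1 kd [Mxs _ _] [_ lam_sorted] lk1 lk _ _ _ wS _ _ _ _.
move=> [c10 r10 Edef Ediff Rdist] r20 r21 r30 r32 c30 Hstep eta0 Heta Hgd Hs.
have f2 : Ck 2 setT f by exact: Ck_pred f3.
move: Heta; rewrite !lt_min => /and3P[etaL etaM etah].
have L0 := spectral_gap_gt0 kd lam_sorted lk1 lk.
have {}etaL := lt_efrac L0 etaL.
have q_lt1 : qmax < 1.
  by rewrite gt_max (q1_lt1 k1 kd lam_sorted lk1 lk eta0 etaL) (q2_lt1 kd lam_sorted lk1 lk eta0 etaL).
have q0 : 0 <= q := q1_ge0 _ _; have q'0 : 0 <= q' := q2_ge0 _ _ _.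
have Mc0 : 0 <= Mc := Mconst_ge0 _ _ _ _ _.
have e0 : 0 <= eta * Mc by rewrite mulr_ge0 // ltW.
have eq : eta * Mc <= q + q'.
  (* For [Mc = 0] the fraction is [+oo] and carries no bound, but the claim is then plain. *)
  have [->|Mcn] := eqVneq Mc 0; first by rewrite mulr0 addr_ge0.
  by apply/ltW; apply: (lt_efrac _ etaM); rewrite lt_neqAle eq_sym Mcn.
have s0 : 0 <= s by rewrite mulr_ge0 // ltW.
have den0 : 0 < eta * Mc + 2 * (1 - qmax) by rewrite ltr_wpDl // mulr_gt0 // subr_gt0.
have m11 : m1 < 1 by apply: mu1_lt1 => //; exact: lt_efrac Hs.
have m20 : 0 <= m2 by exact: mu2_ge0.
have mu0 : 0 < Num.min ((r1 - r2) / c1) r1 by rewrite lt_min r10 andbT divr_gt0 // subr_gt0.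
have [rho [rho0 rho3 rhod] rhoA] :=
  initial_radius (spectral_norm_ge0 A) r30 (riem_dist_ge0 _ _ _ _) Hgd.
pose S := grass_bundle k M.
have subS : submanifold (k + (d - k) + (d - k) * k) S.
  by apply: grass_bundle_submanifold; rewrite subnKC // ltnW.
have hm : metric_on S (sasaki M) by exact: sasaki_metric subM.
have fV : findim ('cV[R]_n * 'M[R]_n)%type by apply: findim_prod; [exact: findim_cV|exact: findim_mx].
have Sws : S ws by exact: riem_dist_mem rhod.
have Edef' D : tangent S ws D -> met_norm (sasaki M) ws D < r1 -> exp_graph S (sasaki M) ws D !=set0.
  by move=> TD /ltW; exact: Edef.
have r31 : r3 < r1 by exact: le_lt_trans r21.
have E0 : Exp S (sasaki M) ws 0 = ws by exact: (Exp0 fV hm subS Sws r10 Edef').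
have n0 : met_norm (sasaki M) ws 0 = 0 by rewrite -(scale0r 0) (met_normZ _ _ _ hm) normr0 mul0r.
have T0 : tangent S ws 0 by exact: tangent0 fV subS Sws.
(* The starting point is reached from the centre of the ball, whose logarithm is 0. *)
have [D0 [TD0 D0rho wE0]] : exists D, [/\ tangent S ws D, met_norm (sasaki M) ws D < 0 + rho &
    Exp S (sasaki M) ws D = w 0%N].
  rewrite -{1}n0; apply: (Exp_ball_extend fV hm subS Sws r10 Edef' Ediff T0).
    by rewrite n0 add0r ltW // (le_lt_trans rho3).
  by rewrite E0.
rewrite add0r in D0rho.
pose F := Fmap k M f RG ws r1 eta.
(* The value of [Fmap] is a true preimage under the exponential map and not the default 0. *)
have stepF D : gtangent k M ws D -> sasaki_norm M ws D < r3 ->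
    [/\ gtangent k M ws (F D), sasaki_norm M ws (F D) < r1 &
        gExp k M ws (F D) = RG (gExp k M ws D) (eta *: hfield k M f (gExp k M ws D))].
  move=> TD D3; set y := gExp k M ws D; set x := sasaki_norm M y (hfield k M f y).
  have D1 : sasaki_norm M ws D <= r1 by rewrite ltW // (lt_trans D3).
  (* The first term of the minimum bounds the length of the step by [r1 - r2]; the second makes the
     step short enough for the estimate on the retraction to apply. *)
  have ex : eta * x < Num.min ((r1 - r2) / c1) r1.
    apply: (efrac_sup_bound eta0 mu0 _ _ etah); first exact: sqrtr_ge0.
    by apply: ereal_sup_ubound; exists D.
  have Sy : S y.
    have [z yz] := Edef D TD D1; rewrite /y /gExp /Exp.
    have : exp_graph (grass_bundle k M) (sasaki M) ws D (xget ws (exp_graph (grass_bundle k M) (sasaki M) ws D)).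
      by apply: xgetPex; exists z.
    by move=> [J [c [[_ _ cS _] J01 _ _ <-]]]; apply/cS/J01; rewrite /= in_itv /= ler01 lexx.
  have Ty : gtangent k M y (eta *: hfield k M f y).
    rewrite -[_ *: _]addr0; apply: (tangent_lincomp fV subS Sy); last exact: tangent0 fV subS Sy.
    exact: (hfield_tangent subM f2 Sy).
  have nE : sasaki_norm M y (eta *: hfield k M f y) = eta * x.
    by rewrite /sasaki_norm (met_normZ _ _ _ hm) gtr0_norm.
  have [_ dy] : domG (y, eta *: hfield k M f y) /\
      (gdist k M y (RG y (eta *: hfield k M f y)) <= (c1 * (eta * x))%:E)%E.
    rewrite -nE; apply: Rdist => //; rewrite -/y nE ltW //.
    by apply: lt_le_trans ex _; rewrite ge_min lexx orbT.
  have [D' [TD' D'1 D'E]] : exists D', [/\ tangent S ws D',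
      met_norm (sasaki M) ws D' < met_norm (sasaki M) ws D + (r1 - r2) &
      Exp S (sasaki M) ws D' = RG y (eta *: hfield k M f y)].
    apply: (Exp_ball_extend fV hm subS Sws r10 Edef' Ediff TD).
      have : sasaki_norm M ws D <= r2 by rewrite ltW // (lt_le_trans D3).
      by rewrite -subr_le0 -(gerDl r1) addrCA.
    apply: le_lt_trans dy _; rewrite lte_fin mulrC -ltr_pdivlMr //.
    by apply: lt_le_trans ex _; rewrite ge_min lexx.
  rewrite /F /Fmap -/y.
  apply: (@xgetPex _ 0 [set D' | [/\ gtangent k M ws D', sasaki_norm M ws D' < r1 &
    gExp k M ws D' = RG y (eta *: hfield k M f y)]]).
  exists D'; split => //; apply: lt_le_trans D'1 _.
  have : sasaki_norm M ws D <= r2 by rewrite ltW // (lt_le_trans D3).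
  by rewrite -subr_le0 -(gerDl r1) addrCA.
pose v := col2 M ws D0.
have v0 i : 0 <= v i 0 by exact: col2_ge0.
have vrho : fnorm v < rho by rewrite fnorm_col2.
have vr3 : fnorm v < r3 by exact: lt_le_trans rho3.
have {rhoA} vA : (m1 != m2 /\ Num.max (m1 ^+ 2 / (m1 - m2)) 1 * spectral_norm A * fnorm v < r3) \/
    spectral_norm A = 0.
  case: rhoA => [[m12 h]|]; [left; split=> //|by right].
  have K0 : 0 <= Num.max (m1 ^+ 2 / (m1 - m2)) 1 * spectral_norm A.
    by rewrite mulr_ge0 ?spectral_norm_ge0 // le_max ler01 orbT.
  move: K0 h; set K := _ * spectral_norm A => K0 h.
  (* Strictness comes from [fnorm v < rho] when the factor [K] is positive, and from [0 < r3] when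
     it vanishes. *)
  have [->|Kn] := eqVneq K 0; first by rewrite mul0r.
  by apply: lt_le_trans h; rewrite ltr_pM2l // lt_neqAle eq_sym Kn.
have [vt3 [C [rate [C0 rate0 rate1 vC]]]] := iter_Amx_converges q0 q'0 e0 s0 m20 m11 v0 r30 vr3 vA.
(* The comparison with the matrix iterates is carried along because it gives the bound by [r3] under
   which the next step is defined and compared. *)
have inv t : [/\ gtangent k M ws (iter t F D0), gExp k M ws (iter t F D0) = w t &
    forall i, col2 M ws (iter t F D0) i 0 <= iter t (mulmx A) v i 0].
  have small u : (forall i, col2 M ws (iter u F D0) i 0 <= iter u (mulmx A) v i 0) ->
      sasaki_norm M ws (iter u F D0) < r3.
    move=> h; rewrite -fnorm_col2; apply: le_lt_trans (vt3 u); apply: fnorm_le => i.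
    by rewrite col2_ge0 h.
  elim: t => [|t [TD DE Dle]]; first by split.
  have [TF F1 FE] := stepF _ TD (small _ Dle).
  rewrite !iterS; split=> //; first by rewrite FE DE wS.
  move=> i; apply: le_trans (Hstep _ TD (small _ Dle) i) _.
  exact: Amx_le.
exists C, rate; split => // t; have [TD <- Dle] := inv t.
have Dv : sasaki_norm M ws (iter t F D0) <= fnorm (iter t (mulmx A) v).
  by rewrite -fnorm_col2; apply: fnorm_le => i; rewrite col2_ge0 Dle.
apply: (@le_trans _ _ (sasaki_norm M ws (iter t F D0))%:E).
  apply: (riem_dist_Exp fV hm subS Sws r10 Edef' Ediff TD).
  by apply: le_lt_trans Dv (lt_trans (vt3 t) r31).
by rewrite lee_fin (le_trans Dv).
Qed.
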